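(* Let $(E,\|\cdot\|)$ be a Banach space, $J\subseteq \mathbb{R}$ be a non-degenerate interval, $F$ a locally convex space and $P\subseteq F$, $U\subseteq E$ be open subsets. Let $r,s\in \mathbb{N}_0\cup\{\infty\}$ with $s\geq 1$ and let $f\colon J\times (U\times P)\to E$ be a $C^{r,r+s}$-map. If $t_0\in J$, $z_0\in U$ and $q_0\in P$, then there exist a convex neighbourhood $J_0\subseteq J$ of $t_0$ and open neighbourhoods $U_0\subseteq U$ of $z_0$ and $P_0\subseteq P$ of $q_0$ such that for all $(\tau_0,x_0,p_0)\in J_0\times U_0\times P_0$, the initial value problem $$\begin{cases} x'(t)=f(t,x(t),p_0)\\ x(\tau_0)=x_0\end{cases}$$ has a unique solution $\phi_{\tau_0,x_0,p_0}\colon J_0\to U$, and the map $$J_0\times (U_0\times P_0)\to E,\quad (t,x_0,p_0)\mapsto \phi_{\tau_0,x_0,p_0}(t)$$ is $C^{r+1,s}$, for each $\tau_0\in J_0$.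
   Context: Locally convex spaces are real Hausdorff locally convex topological vector spaces. A subset $U$ of a locally convex space is called locally convex if every $x\in U$ has a convex neighbourhood in $U$. A neighbourhood of $t_0$ in $J$ is meant with respect to the relative topology of $J$. Conventions: $\infty+1=\infty$, $r+s=\infty$ if $r=\infty$ or $s=\infty$. $C^{r,s}$-maps: let $E_1,E_2,H$ be locally convex spaces and $D_hf(z):=\lim_{t\to0}t^{-1}(f(z+th)-f(z))$. For $A\subseteq E_1$, $B\subseteq E_2$ open, $f\colon A\times B\to H$ is $C^{r,s}$ if for all $i,j\in\mathbb{N}_0$ with $i\le r$, $j\le s$ the iterated directional derivative $d^{(i,j)}f(x,y,w_1,\dots,w_i,v_1,\dots,v_j):=(D_{(w_i,0)}\cdots D_{(w_1,0)}D_{(0,v_j)}\cdots D_{(0,v_1)}f)(x,y)$ exists for all $x\in A$, $y\in B$, $w_a\in E_1$, $v_b\in E_2$ and $d^{(i,j)}f\colon A\times B\times E_1^i\times E_2^j\to H$ is continuous. If $A,B$ are locally convex subsets with dense interior (e.g. $A$ a non-degenerate interval in $E_1=\mathbb{R}$), $f$ is $C^{r,s}$ if $f|_{A^\circ\times B^\circ}$ is $C^{r,s}$ and each $d^{(i,j)}(f|_{A^\circ\times B^\circ})$ extends to a continuous map $d^{(i,j)}f\colon A\times B\times E_1^i\times E_2^j\to H$ (with $d^{(0,0)}f=f$). Here the first factor is $J\subseteq\mathbb{R}$ and the second is the open subset $U\times P$ of $E\times F$ (respectively $J_0$ and $U_0\times P_0$). *)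

(* Defs.v *)
From HB Require Import structures.
From mathcomp Require Import all_boot all_order all_algebra.
From mathcomp Require Import all_classical all_reals all_analysis.

Set Implicit Arguments.
Unset Strict Implicit.
Unset Printing Implicit Defensive.

Import Order.TTheory GRing.Theory Num.Theory.
Import numFieldNormedType.Exports.

Local Open Scope classical_set_scope.
Local Open Scope ring_scope.

(* N u {oo}, with None as oo. *)
Definition enat := option nat.

Definition le_enat (i : nat) (r : enat) : bool :=
  if r is Some n then (i <= n)%N else true.

Definition add_enat (r s : enat) : enat :=
  if r is Some m then if s is Some n then Some (m + n)%N else None else None.

(* The library's [derive] and [lim] are not available here: the former wants
   normed modules, the latter a pointed codomain. *)
Section directional_derivative.
Context {R : realType} {V W : tvsType R}.

Definition is_ddir (f : V -> W) (h z : V) (l : W) : Prop :=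
  (fun t : R => t^-1 *: (f (z + t *: h) - f z)) @ 0^' --> l.

(* D_h f; junk value 0 where the limit does not exist.  It is only used for
   Hausdorff W, where the limit is unique. *)
Definition ddir (f : V -> W) (h : V) : V -> W :=
  fun z => xget 0 [set l | is_ddir f h z l].

(* iter_ddir f [:: h1; ...; hn] = D_hn ( ... (D_h1 f)). *)
Definition iter_ddir (f : V -> W) (hs : seq V) : V -> W := foldl ddir f hs.

Fixpoint ex_iter_ddir (O : set V) (f : V -> W) (hs : seq V) : Prop :=
  if hs is h :: hs' then
    (forall z, O z -> exists l, is_ddir f h z l) /\
    ex_iter_ddir O (ddir f h) hs'
  else True.

End directional_derivative.

(* Functions on a subset A x B are represented by total functions, whose values
   outside A x B are irrelevant.  The powers E1^i and E2^j carry the product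
   topology. *)
Section CRS.
Context {R : realType} {E1 E2 H : tvsType R}.

Definition dirs {i j : nat} (w : {ptws 'I_i -> E1}) (v : {ptws 'I_j -> E2}) :
    seq (E1 * E2)%type :=
  [seq (0, v b) | b <- enum 'I_j] ++ [seq (w a, 0) | a <- enum 'I_i].

Definition dij (i j : nat) (f : (E1 * E2)%type -> H) :
    ((E1 * E2) * ({ptws 'I_i -> E1} * {ptws 'I_j -> E2}))%type -> H :=
  fun q => iter_ddir f (dirs q.2.1 q.2.2) q.1.

Definition CRS_open (r s : enat) (A : set E1) (B : set E2)
    (f : (E1 * E2)%type -> H) : Prop :=
  forall i j : nat, le_enat i r -> le_enat j s ->
    (forall (w : {ptws 'I_i -> E1}) (v : {ptws 'I_j -> E2}),
       ex_iter_ddir (A `*` B) f (dirs w v)) /\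
    {within (A `*` B) `*` setT, continuous (@dij i j f)}.

(* C^{r,s}-maps on A x B, for A and B locally convex with dense interior. *)
Definition CRS (r s : enat) (A : set E1) (B : set E2)
    (f : (E1 * E2)%type -> H) : Prop :=
  CRS_open r s A° B° f /\
  forall i j : nat, le_enat i r -> le_enat j s ->
    exists g : ((E1 * E2) * ({ptws 'I_i -> E1} * {ptws 'I_j -> E2}))%type -> H,
      [/\ {within (A `*` B) `*` setT, continuous g},
          {in (A° `*` B°) `*` setT, g =1 @dij i j f} &
          (i = 0 -> j = 0 -> {in (A `*` B) `*` setT, forall q, g q = f q.1})%N].

Lemma CRS_openP (r s : enat) (A : set E1) (B : set E2)
    (f : (E1 * E2)%type -> H) :
  open A -> open B -> CRS r s A B f <-> CRS_open r s A B f.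
Proof.
move=> /interior_id oA /interior_id oB; rewrite /CRS oA oB.
split=> [[]//|fC]; split=> // i j ir js; exists (@dij i j f).
split=> //; first by have [] := fC i j ir js.
move=> i0 j0 q _; rewrite /dij /iter_ddir /dirs; subst i j.
by rewrite !enum_ord0.
Qed.

End CRS.

Section initial_value_problem.
Context {R : realType} {E : normedModType R} {F : Type}.

(* x : J0 -> U solves x'(t) = f(t, x(t), p), x(tau) = x0.  The limit is taken
   within J0, so the derivative is one-sided at an endpoint of J0. *)
Definition is_solution (f : (R * (E * F))%type -> E) (J0 : set R) (U : set E)
    (tau : R) (x0 : E) (p : F) (x : R -> E) : Prop :=
  [/\ {homo x : t / J0 t >-> U t},
      forall t, J0 t ->
        (u - t)^-1 *: (x u - x t) @[u --> within J0 t^'] --> f (t, (x t, p)) &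
      x tau = x0].

End initial_value_problem.

(* Main.v *)
Require Import Defs.
From HB Require Import structures.
From mathcomp Require Import all_boot all_order all_algebra.
From mathcomp Require Import all_classical all_reals all_analysis.
From mathcomp Require Import ring lra.
Import Order.TTheory GRing.Theory Num.Theory.
Import numFieldNormedType.Exports.

Local Open Scope classical_set_scope.
Local Open Scope ring_scope.
Set Implicit Arguments.
Unset Strict Implicit.
Unset Printing Implicit Defensive.

(** Near (t0, z0, q0) the right-hand side f is bounded by some M and Lipschitz
    in the state with some constant L, because its differential is continuous
    ([local_bounds]).  On a compact interval J0 = [a, b] around t0 in J with
    L (b - a) <= 1/2 and M (b - a) small, Picard iteration converges
    ([ode_exists], resting on [primitive]), and a solution is unique among all
    solutions with values in U since the set of times where two of them agree is
    open and closed in J0 ([ode_unique]).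

    Smoothness in the initial value and the parameter is proved for a general
    equation y' = g(t, y, x) whose state lies in the Banach space E and whose
    parameter x lies in an arbitrary locally convex space X; here x = (x0, p).
    If z solves the linearised equation z' = dg(t, (y, x); (z, m)), then
    d = y(t, x + h m) - y(t, x) - h z satisfies |d'| <= L |d| + o(h), uniformly
    in t by compactness of J0, hence d = o(h) by [short_gronwall]: so z is the
    derivative of y in the direction m ([ode_differentiable]).  No norm on X is
    needed, because a continuous differential controls difference quotients
    uniformly near each point ([diff_quotient]).  The linearised equation is
    again an equation with state in E, now with parameter (x, m), defined on the
    whole of E and with the same Lipschitz constant L.  It can therefore be
    solved on the same J0, and induction on the number of derivatives gives all
    of them on one and the same interval ([ode_regularity]).  The time derivative
    of y is g(t, y, x) itself, which accounts for the additional order in t.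

    The induction needs a notion of differentiability that is stable under
    composition.  This is [mixedC]: it counts all derivatives and, among them,
    the time derivatives, allows them in any order, and records the differential
    of f as one function of a point and a direction, so that differentiating a
    composition gives a composition again ([mixedC_comp]).  A C^{r,k}-map belongs
    to it by Schwarz's theorem and the multilinearity of iterated directional
    derivatives ([CRS_mixedC]); conversely, the iterated directional derivatives
    of a solution are read off in [solutionC_CRS]. *)

(** * Filters and identities in modules *)

Section filters.

Lemma near_withinS {T : Type} (A B : set T) (F : set_system T) {FF : Filter F}
    (P : T -> Prop) :
  A `<=` B -> (\forall x \near within B F, P x) -> \forall x \near within A F, P x.
Proof. by move=> AB H; apply: (@filterS _ F _ _ _ _ H) => x BP /AB. Qed.

Lemma cvg_withinS {T : Type} {U : nbhsType} (A B : set T) (F : set_system T)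
    {FF : Filter F} (f : T -> U) (l : U) :
  A `<=` B -> f x @[x --> within B F] --> l -> f x @[x --> within A F] --> l.
Proof. by move=> AB H P /H; exact: (@near_withinS _ A B F FF (fun x => P (f x)) AB). Qed.

Lemma near_withinW {T : Type} (A : set T) (F : set_system T) {FF : Filter F}
    (P : T -> Prop) : F P -> \forall x \near within A F, P x.
Proof. exact: (@cvg_within T F FF A P). Qed.

End filters.

Section cancel.
Variable V : zmodType.
Implicit Types x y : V.
Lemma eq_sub0 x y : x - y = 0 -> x = y. Proof. by move/eqP; rewrite subr_eq0 => /eqP. Qed.
End cancel.

(** Proves identities in a module by cancelling every summand against its
    opposite. *)
Ltac cancel_in B x nx :=
  lazymatch B with
  | ?C + ?y => first
      [unify y nx; first [rewrite (addrK y C) | rewrite (subrK x C)]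
      | rewrite (addrAC C y x); cancel_in C x nx]
  | _ => unify B nx; first [rewrite (subrr B) | rewrite (addNr x)]
  end.
Ltac cancel_last :=
  lazymatch goal with
  | |- ?B - ?x = 0 => cancel_in B (- x) x
  | |- ?B + ?x = 0 => cancel_in B x (- x)
  end.
Ltac zmodule := apply: eq_sub0;
  rewrite ?(scalerBl, scalerDl, scalerBr, scalerDr, scaleNr, scalerN, opprD, opprK, addrA,
            subr0, addr0, add0r, oppr0, scaler0, scale0r, scale1r);
  repeat (cancel_last; rewrite ?(add0r, addr0)); try reflexivity.

(** * Mean value inequalities on an interval *)

Section mean_value.
Context {R : realType} {E : normedModType R}.
Implicit Types (D : R -> E) (s t K : R).

(** The function |D v - D s| - (K + e) (v - s) takes smaller values immediately
    to the right of any point before t, so it attains its minimum at t. *)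
Let mean_value_closed D s t K : s <= t ->
  (forall u, s <= u <= t ->
     D v @[v --> within `[s, t]%classic (nbhs u)] --> D u) ->
  (forall u, s <= u <= t -> forall e, 0 < e ->
     \forall v \near within `[s, t]%classic (nbhs u),
       `|D v - D u| <= (K + e) * `|v - u|) ->
  `|D t - D s| <= K * (t - s).
Proof.
move=> st Dc Dl.
apply/ler_addgt0Pr => e e0.
pose e' := e / (t - s + 1).
have ts0 : 0 < t - s + 1 by rewrite ltr_wpDl// subr_ge0.
have e'0 : 0 < e' by rewrite divr_gt0.
suff H : `|D t - D s| <= (K + e') * (t - s).
  apply: le_trans H _; rewrite mulrDl lerD2l /e' mulrAC ler_pdivrMr//.
  by rewrite ler_pM2l// lerDl.
pose Q u := `|D u - D s| - (K + e') * (u - s).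
have Qc : {within `[s, t], continuous Q}.
  apply/subspace_continuousP => u; rewrite /= in_itv/= => ust.
  apply: cvgB.
    apply: cvg_norm; apply: cvgB; last exact: cvg_cst.
    exact: Dc.
  apply: cvgM; first exact: cvg_cst.
  by apply: cvgB; [exact: cvg_within | exact: cvg_cst].
have [c cst cmin] := EVT_min st Qc.
move: cst; rewrite in_itv/= => /andP[sc ct].
have [tc|ct'] := leP t c.
  have -> : t = c by apply/eqP; rewrite eq_le tc ct.
  have := cmin s; rewrite /Q in_itv/= lexx st/= !subrr normr0 mulr0 subr0.
  by move=> /(_ isT); rewrite subr_le0.
exfalso.
have e20 : 0 < e' / 2 by rewrite divr_gt0.
have sct : s <= c <= t by rewrite sc ct.
have := Dl c sct _ e20; rewrite /within/= => Hn.
have Hn' : \forall v \near c^'+, v \in `[s, t] ->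
    `|D v - D c| <= (K + e' / 2) * `|v - c| by exact: (@near_withinW _ _ (nbhs c) _ _ Hn).
near c^'+ => v.
have cv : c < v by near: v; exact: nbhs_right_gt.
have vt : v < t by near: v; exact: nbhs_right_lt.
have sv : s <= v by apply: le_trans sc (ltW cv).
have vst : v \in `[s, t] by rewrite in_itv/= sv (ltW vt).
have Hv : `|D v - D c| <= (K + e' / 2) * `|v - c|.
  by apply: (near Hn' v).
have := cmin v vst; rewrite /Q.
have vc : 0 < v - c by rewrite subr_gt0.
move: Hv; rewrite (gtr0_norm vc) => Hv.
have tri : `|D v - D s| <= `|D v - D c| + `|D c - D s|.
  by rewrite -[D v - D s](subrKA (D c)) ler_normD.
have : 0 < e' / 2 * (v - c) by rewrite mulr_gt0.
lra.
Unshelve. all: by end_near. Qed.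

(** The Lipschitz estimate at a point has a slack e because a derivative gives no
    more than that.  Endpoints are reached as limits of inner points, so that
    derivatives which exist in the interior only can be used. *)
Lemma mean_value D s t K : 0 <= K -> s <= t ->
  (forall u, s <= u <= t ->
     D v @[v --> within `[s, t]%classic (nbhs u)] --> D u) ->
  (forall u, s < u < t -> forall e, 0 < e ->
     \forall v \near within `[s, t]%classic (nbhs u),
       `|D v - D u| <= (K + e) * `|v - u|) ->
  `|D t - D s| <= K * (t - s).
Proof.
move=> K0; rewrite le_eqVlt => /predU1P[->|st] Dc Dl.
  by rewrite !subrr normr0 mulr0.
apply/ler_addgt0Pr => e e0.
have e20 : 0 < e / 2 by rewrite divr_gt0.
pose m := (s + t) / 2.
have sm : s < m by rewrite /m; lra.
have mt : m < t by rewrite /m; lra.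
have sst : s <= s <= t by rewrite lexx ltW.
have tst : s <= t <= t by rewrite lexx ltW.
have /cvgrPdist_le/(_ _ e20) := Dc s sst; rewrite /within/= => Hs.
have /cvgrPdist_le/(_ _ e20) := Dc t tst; rewrite /within/= => Ht.
have Hs' : \forall v \near s^'+, v \in `[s, t] -> `|D s - D v| <= e / 2.
  exact: (@near_withinW _ _ (nbhs s) _ _ Hs).
have Ht' : \forall w \near t^'-, w \in `[s, t] -> `|D t - D w| <= e / 2.
  exact: (@near_withinW _ _ (nbhs t) _ _ Ht).
near s^'+ => v; near t^'- => w.
have sv : s < v by near: v; exact: nbhs_right_gt.
have vm : v < m by near: v; exact: nbhs_right_lt.
have wt : w < t by near: w; exact: nbhs_left_lt.
have mw : m < w by near: w; exact: nbhs_left_gt.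
have vst : v \in `[s, t] by rewrite in_itv/= (ltW sv); apply/ltW; lra.
have wst : w \in `[s, t] by rewrite in_itv/= (ltW wt) andbT; apply/ltW; lra.
have Hv : `|D s - D v| <= e / 2.
  by apply: (near Hs' v).
have Hw : `|D t - D w| <= e / 2.
  by apply: (near Ht' w).
have vw : v <= w by apply/ltW; lra.
have sub u : u \in `[v, w] -> u \in `[s, t].
  by rewrite !in_itv/= => /andP[vu uw]; apply/andP; split; lra.
have H : `|D w - D v| <= K * (w - v).
  apply: mean_value_closed => //.
  - by move=> u uvw; apply: cvg_withinS (Dc u (sub u uvw)) => z /sub.
  - move=> u uvw d d0.
    have ust : s < u < t by move/andP: uvw => [? ?]; apply/andP; split; lra.
    by apply: near_withinS (Dl u ust d d0) => z /sub.
have -> : D t - D s = (D t - D w) + ((D w - D v) - (D s - D v)).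
  by rewrite opprB subrKA subrKA.
apply: (le_trans (ler_normD _ _)); rewrite addrC.
apply: (@le_trans _ _ (K * (w - v) + e / 2 + e / 2)).
  by apply: lerD => //; apply: (le_trans (ler_normB _ _)); apply: lerD.
rewrite -addrA -splitr lerD2r ler_wpM2l//; lra.
Unshelve. all: by end_near. Qed.

End mean_value.

Section time_derivative.
Context {R : realType}.

(** The derivative within J; it is one-sided at an endpoint of J. *)
Definition tder (J : set R) {H : tvsType R} (x : R -> H) (t : R) (l : H) :=
  (u - t)^-1 *: (x u - x t) @[u --> within J t^'] --> l.

Context {E : normedModType R}.
Implicit Types (J : set R) (x : R -> E).

Lemma tderP J x t l : tder J x t l <->
  forall e, 0 < e -> \forall u \near within J (nbhs t),
    `|x u - x t - (u - t) *: l| <= e * `|u - t|.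
Proof.
split=> [/cvgrPdist_le xl e e0|xl].
  have := xl e e0; rewrite /within /dnbhs/= /within/= => H.
  apply: (@filterS _ (nbhs t) _ _ _ _ H) => u Hu Ju.
  have [->|ut] := eqVneq u t; first by rewrite !(subrr, scale0r, normr0, mulr0).
  have ut0 : u - t != 0 by rewrite subr_eq0.
  have {Hu}Hu := Hu ut Ju.
  have -> : x u - x t - (u - t) *: l =
            (u - t) *: - (l - (u - t)^-1 *: (x u - x t)).
    by rewrite opprB scalerBr scalerA mulfV// scale1r.
  by rewrite normrZ normrN mulrC ler_wpM2r.
apply/cvgrPdist_le => e e0; have := xl e e0.
rewrite /within /dnbhs/= /within/= => H.
apply: (@filterS _ (nbhs t) _ _ _ _ H) => u Hu ut Ju.
have ut0 : u - t != 0 by rewrite subr_eq0.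
have {Hu}Hu := Hu Ju.
rewrite -(@ler_pM2l _ `|u - t|) ?normr_gt0// -normrZ scalerBr scalerA mulfV//.
by rewrite scale1r distrC mulrC.
Qed.

Lemma tder_cvg J x t l : tder J x t l -> x u @[u --> within J (nbhs t)] --> x t.
Proof.
move=> /tderP xl; apply/cvgrPdist_le => e e0.
have l1 : 0 < 1 + `|l| by rewrite ltr_pwDl.
have d0 : 0 < e / (1 + `|l|) by rewrite divr_gt0.
have H1 := xl 1 ltr01.
have H2 : \forall u \near within J (nbhs t), `|u - t| < e / (1 + `|l|).
  apply: near_withinW; apply/nbhs_ballP; exists (e / (1 + `|l|)) => //= y.
  by rewrite /ball/= distrC.
apply: filterS2 H1 H2 => u H1 H2; rewrite distrC.
rewrite -[x u - x t](subrK ((u - t) *: l)).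
apply: (le_trans (ler_normD _ _)).
apply: (@le_trans _ _ (1 * `|u - t| + `|u - t| * `|l|)).
  by rewrite lerD// normrZ.
by rewrite mulrC -mulrDr -ler_pdivlMr// ltW.
Qed.

Lemma mean_value_tder J x x' c K s t : 0 <= K -> s <= t ->
  (forall u, s <= u <= t -> J u) ->
  (forall u, s <= u <= t -> x v @[v --> within J (nbhs u)] --> x u) ->
  (forall u, s < u < t -> tder J x u (x' u)) ->
  (forall u, s < u < t -> `|x' u - c| <= K) ->
  `|x t - x s - (t - s) *: c| <= K * (t - s).
Proof.
move=> K0 st sJ xc xd xK.
have stJ : `[s, t] `<=` J by move=> u /=; rewrite in_itv/= => /sJ.
have -> : x t - x s - (t - s) *: c = (x t - t *: c) - (x s - s *: c).
  by rewrite scalerBl !opprB addrACA [RHS]addrACA; congr (_ + _); rewrite addrC.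
apply: (@mean_value _ _ (fun u => x u - u *: c)) => //.
  move=> u ust; apply: cvgB; first by apply: cvg_withinS (xc u ust).
  by apply: cvgZr_tmp; exact: cvg_within.
move=> u ust e e0; have /tderP/(_ _ e0) := xd u ust.
move=> /(near_withinS stJ); apply: filterS => v Hv.
have -> : x v - v *: c - (x u - u *: c) =
   (x v - x u - (v - u) *: x' u) + (v - u) *: (x' u - c).
  rewrite scalerBr subrKA scalerBl !opprB addrACA [RHS]addrACA.
  by congr (_ + _); rewrite addrC.
apply: (le_trans (ler_normD _ _)); rewrite mulrDl addrC lerD//.
by rewrite normrZ mulrC ler_wpM2r// xK.
Qed.

End time_derivative.

Section estimates.
Context {R : realType} {E : normedModType R} (a b : R).
Local Notation J := (`[a, b]%classic : set R).
Implicit Types (x : R -> E).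

(** The bound on x' is wanted only at points between s and t, expressed through
    the distance to s so that the order of s and t does not matter. *)
Lemma mean_value_oo x x' c K s t : 0 <= K -> J s -> J t ->
  (forall u, J u -> x v @[v --> within J (nbhs u)] --> x u) ->
  (forall u, a < u < b -> tder J x u (x' u)) ->
  (forall u, a < u < b -> `|u - s| <= `|t - s| -> `|x' u - c| <= K) ->
  `|x t - x s - (t - s) *: c| <= K * `|t - s|.
Proof.
rewrite /= !in_itv/= => K0 /andP[as_ sb] /andP[at_ tb] xc xd xK.
have [st|ts] := leP s t.
  have cl u : s <= u <= t -> J u.
    by move=> /andP[su ut]; rewrite /= in_itv/= (le_trans as_)//= (le_trans ut).
  have oo u : s < u < t -> a < u < b.
    by move=> /andP[su ut]; rewrite (le_lt_trans as_)//= (lt_le_trans ut).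
  rewrite ger0_norm ?subr_ge0//; apply: (@mean_value_tder _ _ J x x') => //.
  - by move=> u /cl; exact: xc.
  - by move=> u /oo; exact: xd.
  move=> u stu; apply: xK (oo u stu) _; move/andP: stu => [su ut].
  by rewrite !ger0_norm ?subr_ge0// ?lerD2r ltW.
have cl u : t <= u <= s -> J u.
  by move=> /andP[su ut]; rewrite /= in_itv/= (le_trans at_)//= (le_trans ut).
have oo u : t < u < s -> a < u < b.
  by move=> /andP[su ut]; rewrite (le_lt_trans at_)//= (lt_le_trans ut).
have -> : x t - x s - (t - s) *: c = - (x s - x t - (s - t) *: c) by zmodule.
rewrite normrN [`|t - s|]distrC [`|s - t|]ger0_norm ?subr_ge0 ?(ltW ts)//.
apply: (@mean_value_tder _ _ J x x'); rewrite ?(ltW ts)//.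
- by move=> u /cl; exact: xc.
- by move=> u /oo; exact: xd.
move=> u tus; apply: xK (oo u tus) _; move/andP: tus => [su ut].
rewrite [leLHS]distrC [leRHS]distrC !ger0_norm ?subr_ge0 ?(ltW ut) ?(ltW ts)//.
by rewrite lerD2l lerN2 ltW.
Qed.

Lemma mean_value_itv x x' c K s t : 0 <= K -> J s -> J t ->
  (forall u, J u -> tder J x u (x' u)) ->
  (forall u, J u -> `|u - s| <= `|t - s| -> `|x' u - c| <= K) ->
  `|x t - x s - (t - s) *: c| <= K * `|t - s|.
Proof.
move=> K0 Js Jt xd xK; have JJ u : a < u < b -> J u.
  by move=> /andP[au ub]; rewrite /= in_itv/= !ltW.
apply: (@mean_value_oo x x') => // u; last by move=> /JJ; exact: xK.
  by move=> Ju; exact: tder_cvg (xd u Ju).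
by move=> /JJ; exact: xd.
Qed.

Lemma itv_dist s t : J s -> J t -> `|t - s| <= b - a.
Proof.
rewrite /= !in_itv/= => /andP[as_ sb] /andP[at_ tb].
by rewrite ler_norml; apply/andP; split; lra.
Qed.

(** Since L (b - a) <= 1/2, no exponential is needed: the maximum S of |x|
    satisfies S <= |x tau| + (b - a) (L S + eta), and L (b - a) S can be absorbed
    on the left. *)
Lemma short_gronwall x x' L eta tau : 0 <= L -> 0 <= eta -> L * (b - a) <= 2^-1 ->
  J tau -> (forall t, J t -> tder J x t (x' t)) ->
  (forall t, J t -> `|x' t| <= L * `|x t| + eta) ->
  forall t, J t -> `|x t| <= 2 * (`|x tau| + (b - a) * eta).
Proof.
move=> L0 eta0 Lab Jtau xd xL t Jt.
have ab : a <= b by move: Jtau; rewrite /= in_itv/= => /andP[]; exact: le_trans.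
have ab0 : 0 <= b - a by rewrite subr_ge0.
have Nc : {within J, continuous (fun u => `|x u|)}.
  apply/subspace_continuousP => u Ju; apply: cvg_norm.
  by apply: tder_cvg; exact: xd.
have [c cJ cmax] := EVT_max ab Nc.
apply: (le_trans (cmax t Jt)).
have M0 : 0 <= L * `|x c| + eta by rewrite addr_ge0// mulr_ge0.
have /= := @mean_value_itv x x' 0 _ tau c M0 Jtau cJ xd.
move=> /(_ _) H; have {H} : `|x c - x tau| <= (L * `|x c| + eta) * `|c - tau|.
  rewrite -[x c - x tau]subr0 -(scaler0 _ (c - tau)); apply: H => u Ju _.
  rewrite subr0; apply: (le_trans (xL u Ju)).
  by rewrite lerD2r ler_wpM2l// cmax.
have cd := itv_dist Jtau cJ.
move=> /le_trans/(_ (ler_wpM2l M0 cd)) H.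
have : `|x c| <= `|x c - x tau| + `|x tau| by rewrite -{1}(subrK (x tau) (x c)) ler_normD.
have := normr_ge0 (x c); move: Lab H.
have : L * `|x c| * (b - a) = L * (b - a) * `|x c| by rewrite mulrAC.
rewrite mulrDl => ->.
move: (L * (b - a)) (`|x c|) (`|x tau|) (`|x c - x tau|) => p y z w p2 H y0 H2.
have : p * y <= 2^-1 * y by rewrite ler_wpM2r.
rewrite (mulrC eta) in H; move: ((b - a) * eta) H => q H. lra.
Qed.

End estimates.

(** * Primitives of continuous functions *)

Section primitives.
Context {R : realType} (a b : R).
Local Notation J := (`[a, b]%classic : set R).

(** Compactness makes a property that holds near every time uniform in time. *)
Lemma tube {I : Type} (F : set_system I) {FF : Filter F} (P : R -> I -> Prop) :
  (forall t, J t -> \forall q \near filter_prod (within J (nbhs t)) F, P q.1 q.2) ->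
  \forall i \near F, forall t, J t -> P t i.
Proof.
move=> H; have /compact_near_coveringP/near_covering_withinP := @segment_compact R a b.
move=> /(_ I F (fun i t => P t i) FF); apply=> t Jt.
have [[A B] /= [At FB] AB] := H t Jt.
exists ((fun u => J u -> A u), B) => //= -[u i] /= [Au Bi] Ju.
by apply: (AB (u, i)); split => //; exact: Au.
Qed.

Lemma uniform_continuity {E : normedModType R} (f : R -> E) :
  (forall t, J t -> f u @[u --> within J (nbhs t)] --> f t) ->
  forall e : R, 0 < e -> exists2 d, 0 < d &
    forall s t, J s -> J t -> `|t - s| < d -> `|f t - f s| <= e.
Proof.
move=> fc e e0.
suff : \forall d \near (0:R)^'+, forall s, J s ->
    forall t, J t -> `|t - s| < d -> `|f t - f s| <= e.
  move=> H; near (0:R)^'+ => d; exists d; first by near: d; exact: nbhs_right_gt.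
  by move=> s t Js; apply: (near H d).
apply: (@tube _ ((0:R)^'+) _ (fun s d => forall t, J t -> `|t - s| < d -> _)) => t Jt.
have e20 : 0 < e / 2 by rewrite divr_gt0.
have /cvgrPdist_le/(_ _ e20) := fc t Jt.
rewrite /within/= => /nbhs_ballP[r /= r0 Hr].
have r20 : 0 < r / 2 by rewrite divr_gt0.
exists ([set s | J s /\ `|t - s| < r / 2], [set d | d < r / 2]).
  split=> /=; last exact: nbhs_right_lt.
  by apply/nbhs_ballP; exists (r / 2).
move=> [s d] /= [[Js ts] dr] u Ju us.
rewrite -(subrKA (f t)); apply: (le_trans (ler_normD _ _)).
rewrite (splitr e) lerD//; last by apply: Hr Js; rewrite /ball/=; lra.
rewrite distrC; apply: Hr Ju; rewrite /ball/= -(subrKA s).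
by apply: (le_lt_trans (ler_normD _ _)); rewrite [`|s - u|]distrC; lra.
Unshelve. all: by end_near. Qed.

Lemma uniform_cauchy_lim {E : completeNormedModType R} {T : Type} (A : set T)
    (F : nat -> T -> E) :
  (forall e : R, 0 < e -> exists N, forall n m, (N <= n)%N -> (N <= m)%N ->
     forall t, A t -> `|F n t - F m t| <= e) ->
  exists G : T -> E, forall e : R, 0 < e -> exists N, forall n, (N <= n)%N ->
     forall t, A t -> `|F n t - G t| <= e.
Proof.
move=> H; exists (fun t => lim (F ^~ t @ \oo)) => e e0.
have e20 : 0 < e / 2 by rewrite divr_gt0.
have [N HN] := H _ e20; exists N => n Nn t At.
have Fc : cvg (F ^~ t @ \oo).
  apply/cauchy_cvgP/cauchy_exP => d d0; have d20 : 0 < d / 2 by rewrite divr_gt0.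
  have [M HM] := H _ d20.
  exists (F M t); exists M => // m /= Mm; rewrite -ball_normE /=.
  have := HM M m (leqnn M) Mm t At; lra.
have /cvgrPdist_le/(_ _ e20)[M _ HM] := Fc.
pose k := maxn N M.
rewrite -(subrKA (F k t)); apply: (le_trans (ler_normD _ _)).
rewrite (splitr e) lerD// ?HN// ?leq_maxl//.
by rewrite distrC; apply: HM; rewrite /= leq_maxr.
Qed.

End primitives.

Section primitive.
Context {R : realType} {E : completeNormedModType R} (a b : R) (ab : a < b).
Context (f : R -> E).
Local Notation J := (`[a, b]%classic : set R).
Hypothesis fc : forall t, J t -> f u @[u --> within J (nbhs t)] --> f t.

Let mesh n : R := (b - a) / n.+1%:R.
Let pt n k : R := a + k%:R * mesh n.
(* Num.min t q - Num.min t p is the length of the part of [p, q] before t, so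
   this is the primitive, vanishing at a, of the step function with the value
   f (pt n k) on the k-th cell. *)
Let step n (t : R) := \sum_(0 <= k < n.+1)
  (Num.min t (pt n k.+1) - Num.min t (pt n k)) *: f (pt n k).

Let mesh_gt0 n : 0 < mesh n.
Proof. by rewrite divr_gt0// subr_gt0. Qed.

Let ptS n k : pt n k.+1 = pt n k + mesh n.
Proof. by rewrite /pt -natr1 mulrDl mul1r addrA. Qed.

Let pt0 n : pt n 0 = a.
Proof. by rewrite /pt mul0r addr0. Qed.

Let ptn n : pt n n.+1 = b.
Proof. by rewrite /pt /mesh mulrC divfK ?pnatr_eq0// addrC subrK. Qed.

Let pt_in n k : (k < n.+1)%N -> J (pt n k).
Proof.
move=> kn; rewrite /= in_itv/=; apply/andP; split.
  by rewrite lerDl mulr_ge0// ltW.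
rewrite -(ptn n) lerD2l ler_wpM2r ?ler_nat ?(ltnW kn)//.
by rewrite ltW.
Qed.

(* The length of the intersection of [p, q] and [s, t]. *)
Let weight (p q s t : R) := (Num.min t q - Num.min t p) - (Num.min s q - Num.min s p).

Let weight_ge0 p q s t : p <= q -> s <= t -> 0 <= weight p q s t.
Proof.
move=> pq st; rewrite /weight.
by case: (leP t q); case: (leP t p); case: (leP s q); case: (leP s p); lra.
Qed.

Let weight_eq0 p q s t : p <= q -> s <= t -> (t <= p) || (q <= s) ->
  weight p q s t = 0.
Proof.
move=> pq st; rewrite /weight.
by case: (leP t q); case: (leP t p); case: (leP s q); case: (leP s p) => ? ? ? ? /orP[]; lra.
Qed.

Let sum_min n t : J t ->
  \sum_(0 <= k < n.+1) (Num.min t (pt n k.+1) - Num.min t (pt n k)) = t - a.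
Proof.
rewrite /= in_itv/= => /andP[at_ tb].
rewrite (telescope_sumr (fun k => Num.min t (pt n k)))// ptn pt0.
by rewrite min_l// min_r.
Qed.

(** The sample point of the cell that contains s may lie to the left of s by up
    to one mesh width, whence the range of v. *)
Let step_increment n s t c e : J s -> J t -> s <= t ->
  (forall v, J v -> s - mesh n <= v <= t -> `|f v - c| <= e) ->
  `|step n t - step n s - (t - s) *: c| <= e * (t - s).
Proof.
move=> Js Jt st H.
have sw : \sum_(0 <= k < n.+1) weight (pt n k) (pt n k.+1) s t = t - s.
  by rewrite sumrB !sum_min//; lra.
have -> : step n t - step n s - (t - s) *: c =
    \sum_(0 <= k < n.+1) weight (pt n k) (pt n k.+1) s t *: (f (pt n k) - c).
  rewrite -sw scaler_suml -!sumrB; apply: eq_bigr => k _.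
  by rewrite scalerBr -scalerBl.
apply: (le_trans (ler_norm_sum _ _ _)); rewrite -sw mulr_sumr.
apply: ler_sum_nat => k /andP[_ kn].
have pk : pt n k <= pt n k.+1 by rewrite ptS lerDl ltW.
rewrite normrZ ger0_norm ?weight_ge0// mulrC.
have [tp|pt_] := leP t (pt n k); first by rewrite weight_eq0 ?tp// !mulr0.
have [ps|sp] := leP (pt n k.+1) s; first by rewrite weight_eq0 ?ps ?orbT// !mulr0.
rewrite ler_wpM2r ?weight_ge0//; apply: H; first exact: pt_in.
by apply/andP; split; [move: sp; rewrite ptS; lra|exact: ltW].
Qed.

Let step_near e d n s t : J s -> J t -> 0 < e ->
  (forall s t, J s -> J t -> `|t - s| < d -> `|f t - f s| <= e) ->
  `|t - s| + mesh n < d ->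
  `|step n t - step n s - (t - s) *: f s| <= e * `|t - s|.
Proof.
move=> Js Jt e0 H; have [st|ts] := leP s t.
  rewrite ger0_norm ?subr_ge0// => d1; apply: step_increment => // v Jv vst.
  apply: H => //; have := mesh_gt0 n; move/andP: vst => [v1 v2] m0.
  by rewrite ltr_norml; apply/andP; split; lra.
rewrite distrC ger0_norm ?subr_ge0 ?(ltW ts)// => d1.
have -> : step n t - step n s - (t - s) *: f s =
          - (step n s - step n t - (s - t) *: f s).
  by rewrite opprD opprK opprB -[in RHS](opprB t s) scaleNr.
rewrite normrN; apply: step_increment => //; first exact: ltW.
move=> v Jv /andP[v1 v2]; apply: H => //; have m0 := mesh_gt0 n.
by rewrite ltr_norml; apply/andP; split; lra.
Qed.

Let mesh_small d : 0 < d -> exists N, forall n, (N <= n)%N -> mesh n < d.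
Proof.
move=> d0; have q0 : 0 <= (b - a) / d by rewrite divr_ge0 ?subr_ge0// ltW.
exists (Num.bound ((b - a) / d)) => n Nn.
rewrite /mesh ltr_pdivrMr// mulrC -ltr_pdivrMr//.
apply: (lt_le_trans (archi_boundP q0)).
by rewrite ler_nat; apply: (leq_trans Nn).
Qed.

Let step_a n : step n a = 0.
Proof.
rewrite /step big_nat_cond big1// => k /andP[/andP[_ kn] _].
have pk : a <= pt n k by have := pt_in kn; rewrite /= in_itv/= => /andP[].
rewrite (min_l pk) min_l ?subrr ?scale0r//.
by rewrite ptS (le_trans pk)// lerDl ltW.
Qed.

(** The primitives of finer and finer step functions differ by functions with
    small Lipschitz constants, hence converge uniformly; the estimate of their
    increments passes to the limit and is differentiability. *)
Lemma primitive : exists F : R -> E, forall t, J t -> tder J F t (f t).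
Proof.
have ba0 : 0 < b - a by rewrite subr_gt0.
have main e : 0 < e -> exists2 d, 0 < d & exists N, forall n, (N <= n)%N ->
    forall s t, J s -> J t -> `|t - s| < d ->
    `|step n t - step n s - (t - s) *: f s| <= e * `|t - s|.
  move=> e0; have [d d0 H] := uniform_continuity fc e0.
  have d20 : 0 < d / 2 by rewrite divr_gt0.
  exists (d / 2) => //; have [N HN] := mesh_small d20; exists N => n /HN Hn s t Js Jt ts.
  by apply: (step_near Js Jt e0 H); lra.
have [|F HF] := @uniform_cauchy_lim R E R J step.
  move=> e e0; pose e' := e / (2 * (b - a)).
  have e'0 : 0 < e' by rewrite divr_gt0// mulr_gt0.
  have [d d0 [N HN]] := main e' e'0; exists N => n m Nn Nm t Jt.
  pose D u := step n u - step m u.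
  have -> : step n t - step m t = D t - D a by rewrite {2}/D !step_a subrr subr0.
  have loc u v : J u -> J v -> `|v - u| < d -> `|D v - D u| <= e' * 2 * `|v - u|.
    move=> Ju Jv uv.
    have -> : D v - D u = (step n v - step n u - (v - u) *: f u) -
                          (step m v - step m u - (v - u) *: f u).
      by rewrite /D; zmodule.
    apply: (le_trans (ler_normB _ _)); rewrite mulrAC mulr_natr mulr2n lerD//; exact: HN.
  have aJ : J a by rewrite /= in_itv/= lexx ltW.
  move: (Jt); rewrite /= in_itv/= => /andP[at_ tb].
  have sJ u : a <= u <= t -> J u.
    by move=> /andP[au ut]; rewrite /= in_itv/= au (le_trans ut tb).
  have K0 : 0 <= e' * 2 by rewrite mulr_ge0// ltW.
  have near_lt (u : R) : \forall v \near nbhs u, `|v - u| < d.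
    by apply/nbhs_ballP; exists d => //= v; rewrite /ball/= distrC.
  have H : `|D t - D a| <= e' * 2 * (t - a).
    apply: mean_value => //.
    - move=> u /sJ Ju; apply/cvgrPdist_le => r r0.
      have r1 : 0 < r / (e' * 2) by rewrite divr_gt0// mulr_gt0.
      have Hr : \forall v \near nbhs u, `|v - u| < r / (e' * 2).
        by apply/nbhs_ballP; exists (r / (e' * 2)) => //= v; rewrite /ball/= distrC.
      rewrite near_withinE; apply: filterS2 (near_lt u) Hr => v vd vr.
      rewrite /= in_itv/= => /sJ Jv; rewrite distrC (le_trans (loc u v Ju Jv vd))//.
      by rewrite mulrC -ler_pdivlMr ?ltW// mulr_gt0.
    move=> u /andP[au ut] r r0; rewrite near_withinE.
    apply: filterS (near_lt u) => v vd; rewrite /= in_itv/= => /sJ Jv.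
    rewrite (le_trans (loc u v (sJ u _) Jv vd)) ?(ltW au) ?(ltW ut)//.
    by rewrite ler_wpM2r// lerDl ltW.
  apply: (le_trans H); apply: (@le_trans _ _ (e' * 2 * (b - a))).
    by rewrite ler_wpM2l// lerD2r.
  rewrite -mulrA /e' divfK//; exact: lt0r_neq0 (mulr_gt0 _ _).
exists F => s Js; apply/tderP => e e0.
have [d d0 [N HN]] := main e e0.
rewrite near_withinE; apply/nbhs_ballP; exists d => //= t; rewrite /ball/= distrC => ts Jt.
apply/ler_addgt0Pr => r r0; have r20 : 0 < r / 2 by rewrite divr_gt0.
have [M HM] := HF _ r20; pose n := maxn N M.
have Hn := HN n (leq_maxl _ _) s t Js Jt ts.
have Ht := HM n (leq_maxr _ _) t Jt; have Hs := HM n (leq_maxr _ _) s Js.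
have -> : F t - F s - (t - s) *: f s = (step n t - step n s - (t - s) *: f s) -
    (step n t - F t) + (step n s - F s).
  by zmodule.
rewrite (splitr r) [leRHS]addrA; apply: (le_trans (ler_normD _ _)); rewrite lerD//.
by apply: (le_trans (ler_normB _ _)); rewrite lerD.
Qed.

End primitive.

(** * Ordinary differential equations on a short interval *)

Section tder_algebra.
Context {R : realType} {E : normedModType R}.
Implicit Types (J : set R) (x y : R -> E).

Lemma tder_subset (A B : set R) x t l : A `<=` B -> tder B x t l -> tder A x t l.
Proof.
by move=> AB /tderP H; apply/tderP => e e0; exact: near_withinS AB (H e e0).
Qed.

Lemma tderD J x y t l m : tder J x t l -> tder J y t m ->
  tder J (fun u => x u + y u) t (l + m).
Proof.
move=> /tderP Hx /tderP Hy; apply/tderP => e e0.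
have e20 : 0 < e / 2 by rewrite divr_gt0.
apply: filterS2 (Hx _ e20) (Hy _ e20) => u H1 H2.
have -> : x u + y u - (x t + y t) - (u - t) *: (l + m) =
   (x u - x t - (u - t) *: l) + (y u - y t - (u - t) *: m) by zmodule.
by apply: (le_trans (ler_normD _ _)); rewrite (splitr e) mulrDl lerD.
Qed.

Lemma tderZ J (c : R) x t l : tder J x t l -> tder J (fun u => c *: x u) t (c *: l).
Proof.
move=> /tderP Hx; apply/tderP => e e0.
have c0 : 0 < `|c| + 1 by rewrite ltr_wpDl.
have e1 : 0 < e / (`|c| + 1) by rewrite divr_gt0.
apply: filterS (Hx _ e1) => u H.
have -> : c *: x u - c *: x t - (u - t) *: (c *: l) = c *: (x u - x t - (u - t) *: l).
  by rewrite 2!scalerBr scalerA mulrC -scalerA.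
rewrite normrZ; apply: (@le_trans _ _ ((`|c| + 1) * (e / (`|c| + 1) * `|u - t|))).
  by rewrite ler_pM// lerDl.
by rewrite mulrA [(_ + 1) * _]mulrC divfK// gt_eqF//.
Qed.

Lemma tderB J x y t l m : tder J x t l -> tder J y t m ->
  tder J (fun u => x u - y u) t (l - m).
Proof.
move=> Hx Hy; have := tderD Hx (@tderZ J (-1) _ _ _ Hy); rewrite scaleN1r => /tderP H.
by apply/tderP => e e0; apply: filterS (H e e0) => u; rewrite !scaleN1r.
Qed.

End tder_algebra.

Section ode.
Context {R : realType} {E : completeNormedModType R} (a b : R) (ab : a < b).
Local Notation J := (`[a, b]%classic : set R).

Lemma lip_comp_cvg (g : R -> E -> E) (W : set E) L (y : R -> E) t :
  0 <= L -> J t ->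
  (forall u z z', J u -> W z -> W z' -> `|g u z - g u z'| <= L * `|z - z'|) ->
  (forall z, W z -> g u z @[u --> within J (nbhs t)] --> g t z) ->
  (forall u, J u -> W (y u)) -> y u @[u --> within J (nbhs t)] --> y t ->
  g u (y u) @[u --> within J (nbhs t)] --> g t (y t).
Proof.
move=> L0 Jt gL gc yW yc; apply/cvgrPdist_le => e e0.
have e20 : 0 < e / 2 by rewrite divr_gt0.
have L1 : 0 < L + 1 by rewrite ltr_wpDl.
have d0 : 0 < e / 2 / (L + 1) by rewrite divr_gt0.
have /cvgrPdist_le/(_ _ e20) H1 := gc (y t) (yW t Jt).
have /cvgrPdist_le/(_ _ d0) H2 := yc.
have H3 : \forall u \near within J (nbhs t), J u by exact: withinT.
apply: filterS3 H1 H2 H3 => u H1 H2 Ju.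
rewrite -(subrKA (g u (y t))) (splitr e); apply: (le_trans (ler_normD _ _)).
rewrite lerD//; apply: (le_trans (gL u _ _ Ju (yW t Jt) (yW u Ju))).
apply: (@le_trans _ _ ((L + 1) * `|y t - y u|)); first by rewrite ler_wpM2r// lerDl.
by rewrite mulrC -ler_pdivlMr.
Qed.

Lemma bounded_itv (y : R -> E) :
  (forall t, J t -> y u @[u --> within J (nbhs t)] --> y t) ->
  exists2 M, 0 <= M & forall t, J t -> `|y t| <= M.
Proof.
move=> yc; have Nc : {within J, continuous (fun u => `|y u|)}.
  by apply/subspace_continuousP => u Ju; apply: cvg_norm; exact: yc.
by have [c cJ cmax] := EVT_max (ltW ab) Nc; exists `|y c|.
Qed.

(** Picard iteration in a closed set W which the integral operator preserves: a
    ball for a right-hand side that is defined locally, the whole space for a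
    linear equation. *)
Lemma ode_exists (g : R -> E -> E) (W : set E) L tau x0 :
  0 <= L -> L * (b - a) <= 2^-1 -> J tau -> W x0 -> closed W ->
  (forall t z z', J t -> W z -> W z' -> `|g t z - g t z'| <= L * `|z - z'|) ->
  (forall t z, J t -> W z -> g u z @[u --> within J (nbhs t)] --> g t z) ->
  (forall y Y : R -> E, (forall t, J t -> W (y t)) ->
     (forall t, J t -> tder J Y t (g t (y t))) -> Y tau = x0 ->
     forall t, J t -> W (Y t)) ->
  exists y : R -> E, [/\ y tau = x0, forall t, J t -> W (y t) &
    forall t, J t -> tder J y t (g t (y t))].
Proof.
move=> L0 Lab Jtau Wx0 Wcl gL gc Winv.
pose good y := (forall t, J t -> y u @[u --> within J (nbhs t)] --> (y t : E)) /\
               (forall t, J t -> W (y t)).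
have step (y : R -> E) : exists Y : R -> E, good y ->
    [/\ good Y, Y tau = x0 & forall t, J t -> tder J Y t (g t (y t))].
  have [[yc yW]|] := pselect (good y); last by exists y.
  have [|F Fd] := @primitive R E a b ab (fun t => g t (y t)).
    move=> t Jt; apply: (@lip_comp_cvg g W L y t) => //; last exact: yc.
    by move=> z Wz; exact: gc.
  have Yd t : J t -> tder J (fun u => F u - F tau + x0) t (g t (y t)).
    move=> Jt; have /tderP H := Fd t Jt; apply/tderP => e e0; apply: filterS (H e e0).
    by move=> u; have -> // : F u - F tau + x0 - (F t - F tau + x0) = F u - F t by zmodule.
  have Yt : F tau - F tau + x0 = x0 by rewrite subrr add0r.
  exists (fun u => F u - F tau + x0) => _; split => //; split=> t Jt.
    exact: tder_cvg (Yd t Jt).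
  exact: (Winv y _ yW Yd).
have {step}[S HS] := choice step.
pose y n := iter n S (fun=> x0).
have good_y n : good (y n).
  elim: n => [|n IH] /=; first by split=> t Jt //; exact: cvg_cst.
  by have [] := HS _ IH.
have yd n t : J t -> tder J (y n.+1) t (g t (y n t)).
  by move: t; have [] := HS _ (good_y n).
have ytau n : y n tau = x0 by case: n => [//|n]; have [] := HS _ (good_y n).
(* The Picard operator halves distances because [L * (b - a) <= 1/2]. *)
have contraction (u v u' v' : R -> E) M : 0 <= M -> u' tau = v' tau ->
    (forall t, J t -> W (u t)) -> (forall t, J t -> W (v t)) ->
    (forall t, J t -> tder J u' t (g t (u t))) ->
    (forall t, J t -> tder J v' t (g t (v t))) ->
    (forall t, J t -> `|u t - v t| <= M) ->
    forall t, J t -> `|u' t - v' t| <= M / 2.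
  move=> M0 uv' uW vW ud vd uvM t Jt.
  have LM : 0 <= L * M by rewrite mulr_ge0.
  have H : `|(u' t - v' t) - (u' tau - v' tau) - (t - tau) *: 0| <= L * M * `|t - tau|.
    apply: (@mean_value_itv _ _ a b (fun s => u' s - v' s)
              (fun s => g s (u s) - g s (v s)) 0 (L * M)) => //.
      by move=> s Js; apply: tderB; [exact: ud|exact: vd].
    move=> s Js _; rewrite subr0; apply: (le_trans (gL s _ _ Js (uW s Js) (vW s Js))).
    by rewrite ler_wpM2l// uvM.
  move: H; rewrite uv' subrr scaler0 !subr0 => /le_trans; apply.
  apply: (le_trans (ler_wpM2l LM (itv_dist Jtau Jt))).
  by rewrite mulrAC mulrC ler_wpM2l.
have [M M0 HM] : exists2 M, 0 <= M & forall t, J t -> `|y 1%N t - y 0%N t| <= M.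
  apply: (@bounded_itv (fun t => y 1%N t - y 0%N t)) => t Jt.
  by apply: cvgB; [exact: (good_y 1%N).1|exact: (good_y 0%N).1].
have dist n t : J t -> `|y n.+1 t - y n t| <= M / 2 ^+ n.
  elim: n t => [|n IH] t Jt; first by rewrite expr0 divr1 HM.
  rewrite exprSr invfM mulrA.
  apply: (contraction (y n.+1) (y n) (y n.+2) (y n.+1)) => //; rewrite ?ytau//.
  - by rewrite divr_ge0// exprn_ge0.
  - exact: (good_y _).2.
  - exact: (good_y _).2.
  - exact: yd.
  - exact: yd.
have distk n k t : J t -> `|y (n + k)%N t - y n t| <= 2 * M / 2 ^+ n - 2 * M / 2 ^+ (n + k).
  move=> Jt; elim: k => [|k IH]; first by rewrite addn0 !subrr normr0.
  rewrite -(subrKA (y (n + k)%N t)) addnS; apply: (le_trans (ler_normD _ _)).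
  have := dist (n + k)%N t Jt; have -> : 2 * M / 2 ^+ (n + k).+1 = M / 2 ^+ (n + k).
    by rewrite exprS invfM mulrACA mulfV// mul1r.
  move: IH; have -> : 2 * M / 2 ^+ (n + k) = M / 2 ^+ (n + k) + M / 2 ^+ (n + k).
    by rewrite -mulrA mulr_natl mulr2n.
  by move=> H1 H2; lra.
have [e e0|yl Hyl] := @uniform_cauchy_lim R E R J y.
  have q0 : 0 < e / (4 * M + 1) by rewrite divr_gt0// ltr_wpDl// mulr_ge0.
  have M1 : 0 < 4 * M + 1 by rewrite ltr_wpDl// mulr_ge0.
  pose N := Num.bound (4 * M / e).
  have bN : 4 * M / 2 ^+ N <= e.
    rewrite ler_pdivrMr ?exprn_gt0// [e * _]mulrC -ler_pdivrMr//.
    apply: ltW; apply: (lt_trans (archi_boundP _)); first by rewrite divr_ge0 ?mulr_ge0// ltW.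
    by rewrite -natrX ltr_nat ltn_expl.
  exists N => n m Nn Nm t Jt.
  have bd k : (N <= k)%N -> `|y k t - y N t| <= 2 * M / 2 ^+ N.
    move=> Nk; have := distk N (k - N)%N t Jt; rewrite subnKC// => /le_trans; apply.
    by rewrite gerBl divr_ge0 ?mulr_ge0// exprn_ge0.
  rewrite -(subrKA (y N t)); apply: (le_trans (ler_normD _ _)).
  rewrite [`|y N t - _|]distrC; apply: le_trans bN.
  have := bd n Nn; have := bd m Nm; have -> : 4 * M / 2 ^+ N = 2 * M / 2 ^+ N + 2 * M / 2 ^+ N.
    by rewrite -mulrDl -mulrDl -natrD.
  by lra.
have yl_good : good yl.
  split=> t Jt.
    apply/cvgrPdist_le => e e0; have e30 : 0 < e / 3 by rewrite divr_gt0.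
    have [N HN] := Hyl _ e30; have {}HN := HN N (leqnn N).
    have /cvgrPdist_le/(_ _ e30) := (good_y N).1 t Jt.
    have H3 : \forall u \near within J (nbhs t), J u by exact: withinT.
    apply: filterS2 H3 => u Ju Hu.
    rewrite -(subrKA (y N t)) -[y N t - _](subrKA (y N u)).
    apply: (le_trans (ler_normD _ _)); rewrite distrC.
    have := ler_normD (y N t - y N u) (y N u - yl u).
    by have := HN t Jt; have := HN u Ju; lra.
  apply: (@closed_cvg _ _ \oo _ (fun n => y n t) W Wcl).
    by apply: nearW => n; exact: (good_y n).2.
  apply/cvgrPdist_le => e e0; have [N HN] := Hyl e e0.
  by exists N => // n /= Nn; rewrite distrC; exact: HN.
have [Ygood Ytau Yd] := HS _ yl_good.
have Yyl t : J t -> yl t = S yl t.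
  move=> Jt; apply/eqP; rewrite -subr_eq0 -normr_le0; apply/ler_addgt0Pr => e e0; rewrite add0r.
  have e20 : 0 < e / 2 by rewrite divr_gt0.
  have [N HN] := Hyl _ e20.
  have H1 := HN N.+1 (leqnSn N) t Jt; have {}HN := HN N (leqnn N).
  have H2 : `|y N.+1 t - S yl t| <= e / 2 / 2.
    apply: (contraction (y N) yl (y N.+1) (S yl)) => //; rewrite ?ytau//.
    - exact: ltW.
    - exact: (good_y N).2.
    - exact: yl_good.2.
    - exact: yd.
  rewrite -(subrKA (y N.+1 t)); apply: (le_trans (ler_normD _ _)); rewrite distrC.
  by lra.
exists (S yl); split => //; first exact: Ygood.2.
by move=> t Jt; rewrite -Yyl//; exact: Yd.
Unshelve. all: by end_near. Qed.

(** An interval is connected. *)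
Lemma itv_clopen (P : R -> Prop) tau : J tau -> P tau ->
  (forall t, J t -> P t -> \forall u \near within J (nbhs t), P u) ->
  (forall t, J t -> ~ P t -> \forall u \near within J (nbhs t), ~ P u) ->
  forall t, J t -> P t.
Proof.
move=> Jtau Ptau Po Pc; pose B := J `&` [set t | P t].
suff -> : J = B by move=> t [].
apply/esym; apply: (@segment_connected R a b) => //.
- by exists tau.
- exists ([set u | J u -> P u]°); first exact: open_interior.
  apply/seteqP; split=> [t [Jt Pt]|t [Jt /nbhs_singleton Pt]]; split=> //.
    exact: Po.
  exact: Pt.
exists (closure B); first exact: closed_closure.
apply/seteqP; split=> [t [Jt Pt]|t [Jt ct]]; split=> //; first exact: subset_closure.
apply: contrapT => nPt; have := Pc t Jt nPt; rewrite near_withinE => H.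
by have [u [[Ju Pu] /(_ Ju)]] := ct _ H.
Qed.

(** Only y is assumed to stay in B.  At a time where x agrees with y the value of
    x lies in the open set B, so x stays in B for a while and [short_gronwall]
    applies on a small interval around that time. *)
Lemma ode_unique (g : R -> E -> E) (B : set E) L tau (x y : R -> E) :
  0 <= L -> L * (b - a) <= 2^-1 -> J tau -> open B ->
  (forall t z z', J t -> B z -> B z' -> `|g t z - g t z'| <= L * `|z - z'|) ->
  (forall t, J t -> B (y t)) ->
  (forall t, J t -> tder J x t (g t (x t))) ->
  (forall t, J t -> tder J y t (g t (y t))) ->
  x tau = y tau -> forall t, J t -> x t = y t.
Proof.
move=> L0 Lab Jtau oB gL yB xd yd xytau.
have dc t : J t -> x u - y u @[u --> within J (nbhs t)] --> x t - y t.
  by move=> Jt; apply: cvgB; apply: tder_cvg; [exact: xd|exact: yd].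
apply: (itv_clopen Jtau xytau) => t Jt; last first.
  move=> /eqP; rewrite -subr_eq0 => xy0.
  have := @cvgr_neq0 _ _ _ (within J (nbhs t)) _ (fun u => x u - y u) _ (dc t Jt) xy0.
  have FF : Filter (within J (nbhs t)) by exact: within_filter.
  by move=> /(_ FF); apply: filterS => u /[swap] ->; rewrite subrr eqxx.
move=> xyt.
have : \forall u \near within J (nbhs t), B (x u).
  apply: (tder_cvg (xd t Jt)); rewrite xyt; apply: open_nbhs_nbhs; split=> //; exact: yB.
rewrite near_withinE => /nbhs_ballP[d /= d0 Hd].
pose a' := Num.max a (t - d / 2); pose b' := Num.min b (t + d / 2).
have [at_ tb] : a <= t /\ t <= b by move: Jt; rewrite /= in_itv/= => /andP[].
have J' u : u \in `[a', b'] -> J u /\ B (x u).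
  rewrite in_itv/= ge_max le_min => /andP[/andP[au du] /andP[ub ud]].
  have Ju : J u by rewrite /= in_itv/= au.
  by split=> //; apply: Hd Ju; rewrite /ball/= ltr_norml; apply/andP; split; lra.
have J'J : `[a', b'] `<=` J by move=> u /J'[].
have Jt' : t \in `[a', b'].
  by rewrite in_itv/= ge_max le_min at_ tb/=; apply/andP; split; lra.
near=> u; apply/eqP; rewrite -subr_eq0 -normr_le0.
have Ju' : u \in `[a', b'].
  have Ju : J u by near: u; exact: withinT.
  have ud : `|u - t| < d / 2.
    near: u; apply: near_withinW; apply/nbhs_ballP; exists (d / 2) => /=.
      by rewrite divr_gt0.
    by move=> v; rewrite /ball/= distrC.
  move: Ju; rewrite /= !in_itv/= ge_max le_min => /andP[-> ->]/=.
  by move: ud; rewrite ltr_norml => /andP[? ?]; apply/andP; split; lra.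
have Lab' : L * (b' - a') <= 2^-1.
  apply: le_trans Lab; rewrite ler_wpM2l// lerB//.
    by rewrite ge_min lexx.
  by rewrite le_max lexx.
have := @short_gronwall R E a' b' (fun s => x s - y s)
  (fun s => g s (x s) - g s (y s)) L 0 t L0 (lexx 0) Lab' Jt'.
rewrite xyt subrr normr0 mulr0 addr0 mulr0; apply => // [s Js|s /J'[Js Bs]].
  have [Js' _] := J' s Js.
  have Hx := tder_subset J'J (xd s Js'); have Hy := tder_subset J'J (yd s Js').
  exact: tderB Hx Hy.
by rewrite addr0; apply: gL => //; exact: yB.
Unshelve. all: by end_near. Qed.

End ode.

(** * Directional derivatives and the chain rule *)

Section directional.
Context {R : realType} {X : tvsType R} {E : normedModType R}.

(** Without the division, the increment h = 0 is no exception any more. *)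
Lemma is_ddirP (g : X -> E) v x l : is_ddir g v x l <->
  forall e, 0 < e -> \forall h \near (0 : R),
    `|g (x + h *: v) - g x - h *: l| <= e * `|h|.
Proof.
split=> [/cvgrPdist_le xl e e0|xl].
  have := xl e e0; rewrite /dnbhs/= /within/= => H.
  apply: (@filterS _ (nbhs (0 : R)) _ _ _ _ H) => h Hh.
  have [->|h0] := eqVneq h 0; first by rewrite !(scale0r, addr0, subrr, normr0, mulr0).
  have {Hh}Hh := Hh h0.
  have -> : g (x + h *: v) - g x - h *: l =
            h *: - (l - h^-1 *: (g (x + h *: v) - g x)).
    by rewrite opprB scalerBr scalerA mulfV// scale1r.
  by rewrite normrZ normrN mulrC ler_wpM2r.
apply/cvgrPdist_le => e e0; have := xl e e0.
rewrite /dnbhs/= /within/= => H.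
apply: (@filterS _ (nbhs (0 : R)) _ _ _ _ H) => h Hh h0.
rewrite -(@ler_pM2l _ `|h|) ?normr_gt0// -normrZ scalerBr scalerA mulfV//.
by rewrite scale1r distrC mulrC.
Qed.

Lemma is_ddir_unique (g : X -> E) v x l m :
  is_ddir g v x l -> is_ddir g v x m -> l = m.
Proof. by move=> H1 H2; apply: (cvg_unique _ H1 H2). Qed.

Lemma shift_cvg {V : tvsType R} (io : V -> X) (x : X) (v : V) : continuous io ->
  q.1.1 + q.2 *: io q.1.2 @[q --> nbhs ((x, v), (0 : R))] --> x.
Proof.
move=> ioc; rewrite -[X in _ --> X]addr0 -[X in x + X](scale0r (io v)).
have c1 : q.1.1 @[q --> nbhs ((x, v), (0 : R))] --> x.
  by apply: (@cvg_comp _ _ _ fst fst _ (nbhs (x, v))); exact: cvg_fst.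
have c2 : io q.1.2 @[q --> nbhs ((x, v), (0 : R))] --> io v.
  have c2' : q.1.2 @[q --> nbhs ((x, v), (0 : R))] --> v.
    by apply: (@cvg_comp _ _ _ fst snd _ (nbhs (x, v))); [exact: cvg_fst|exact: cvg_snd].
  exact: (cvg_comp _ _ c2' (ioc v)).
have c3 : (q.2 : R^o) @[q --> nbhs ((x, v), (0 : R))] --> (0 : R^o) by exact: cvg_snd.
have c4 : q.2 *: io q.1.2 @[q --> nbhs ((x, v), (0 : R))] --> (0 : R) *: io v.
  exact: (cvg_comp _ _ (cvg_pair c3 c2) (@scale_continuous R X (0 : R, io v))).
exact: (cvg_comp _ _ (cvg_pair c1 c4) (@add_continuous X (x, (0 : R) *: io v))).
Qed.

Lemma line_tder (g : X -> E) (x v : X) (h s : R) l :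
  is_ddir g v (x + (s * h) *: v) l ->
  tder `[0, 1]%classic (fun s => g (x + (s * h) *: v)) s (h *: l).
Proof.
move=> /is_ddirP H; apply/tderP => e e0.
have h1 : 0 < `|h| + 1 by rewrite ltr_wpDl.
have e1 : 0 < e / (`|h| + 1) by rewrite divr_gt0.
have /nbhs_ballP[r /= r0 Hr] := H _ e1.
apply: near_withinW; apply/nbhs_ballP; exists (r / (`|h| + 1)) => /=; first by rewrite divr_gt0.
move=> u; rewrite /ball/= distrC ltr_pdivlMr// => us.
have hb : `|(u - s) * h| <= `|u - s| * (`|h| + 1).
  by rewrite normrM ler_wpM2l// lerDl.
have := Hr ((u - s) * h); rewrite /ball/= sub0r normrN => /(_ (le_lt_trans hb us)).
have -> : x + (s * h) *: v + ((u - s) * h) *: v = x + (u * h) *: v.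
  by rewrite -addrA -scalerDl -mulrDl [s + _]addrC subrK.
rewrite scalerA => /le_trans; apply.
rewrite -mulrA [_^-1 * _]mulrC mulrA ler_pdivrMr// -mulrA ler_wpM2l//; exact: ltW.
Qed.

End directional.

Lemma continuous_idfun {T : topologicalType} : continuous (@id T).
Proof. by move=> x; exact: cvg_id. Qed.

Section jcont.
Context {R : realType} (a b : R).
Local Notation J := (`[a, b]%classic : set R).

(** Continuity on [a, b] x O.  Time is confined to [a, b], where one-sided limits
    are meant at the ends; O is always open, so the second filter is not
    restricted. *)
Definition jcont {X H : topologicalType} (O : set X) (f : R -> X -> H) : Prop :=
  forall t x, J t -> O x ->
    f q.1 q.2 @[q --> filter_prod (within J (nbhs t)) (nbhs x)] --> f t x.

(** The difference quotient converges to the differential uniformly near every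
    time, point and direction.  By continuity of the vector space operations the
    segment from x' to x' + h (io v') stays in a given neighbourhood of x for
    small h, and the mean value inequality along it compares the increment with
    the differential.  The map io serves to differentiate in the directions of a
    subspace only. *)
Lemma diff_quotient {X V : tvsType R} {E : normedModType R} (O : set X)
    (io : V -> X) (g : R -> X -> E) (dg : R -> (X * V)%type -> E) t x v :
  open O -> continuous io ->
  (forall t x v, J t -> O x -> is_ddir (g t) (io v) x (dg t (x, v))) ->
  jcont (O `*` setT) dg -> J t -> O x ->
  forall e : R, 0 < e ->
    \forall q \near filter_prod (within J (nbhs t)) (nbhs ((x, v), (0 : R))),
      `|g q.1 (q.2.1.1 + q.2.2 *: io q.2.1.2) - g q.1 q.2.1.1 - q.2.2 *: dg t (x, v)|
        <= e * `|q.2.2|.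
Proof.
move=> oO ioc gd dgc Jt Ox e e0.
have Oxv : (O `*` setT) (x, v) by split.
have /cvgrPdist_le/(_ _ e0)[[A B] /= [HA [[Bx Bv] /= [HBx HBv] HB]] HAB] := dgc t _ Jt Oxv.
have nO : nbhs x (Bx `&` O).
  by apply: filterI => //; apply: open_nbhs_nbhs; split.
have [[C D] /= [[[Cx Cv] /= [HCx HCv] HC] HD] HCD] := shift_cvg v ioc nO.
have [r /= r0 Hr] : exists2 r : R, 0 < r & forall h, `|h| < r -> D h.
  move: HD => /nbhs_ballP[r r0 Hr]; exists r => // h hr.
  by apply: Hr; rewrite /ball/= sub0r normrN.
exists (A `&` J, (C `&` [set p | Bv p.2]) `*` [set h | `|h| < r]).
  split=> /=; first by apply: filterI => //; exact: withinT.
  exists (C `&` [set p | Bv p.2], [set h | `|h| < r]) => //=; split.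
    apply: filterI; first by exists (Cx, Cv).
    by exists (setT, Bv) => //=; [split=> //; exact: filterT|move=> p []].
  by apply/nbhs_ballP; exists r => //= h; rewrite /ball/= sub0r normrN.
move=> [u [[x' v'] h]] /= [[Au Ju] [[Cp Bv'] hr]].
have seg s : s \in `[0, 1] -> (Bx `&` O) (x' + (s * h) *: io v').
  rewrite in_itv/= => /andP[s0 s1]; apply: (HCD ((x', v'), s * h)); split => //=.
  apply: Hr; apply: le_lt_trans hr; rewrite normrM (ger0_norm s0).
  by rewrite ler_piMl.
have := @mean_value_itv R E 0 1 (fun s => g u (x' + (s * h) *: io v'))
  (fun s => h *: dg u (x' + (s * h) *: io v', v')) (h *: dg t (x, v)) (e * `|h|) 0 1.
rewrite mul1r mul0r scale0r addr0 subr0 scale1r normr1 mulr1; apply.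
- by rewrite mulr_ge0// ltW.
- by rewrite /= in_itv/= lexx ler01.
- by rewrite /= in_itv/= lexx ler01.
- move=> s s01; apply: line_tder; apply: gd => //; exact: (seg s s01).2.
move=> s s01 _; rewrite -scalerBr normrZ mulrC ler_wpM2r// distrC.
apply: (HAB (u, (x' + (s * h) *: io v', v'))); split=> //=; apply: HB; split => //=.
exact: (seg s s01).1.
Qed.

End jcont.

Section chain_rules.
Context {R : realType} (a b : R).
Local Notation J := (`[a, b]%classic : set R).
Context {X Y : tvsType R} {E : normedModType R} (O : set Y).
Context (g : R -> Y -> E) (dg : R -> (Y * Y)%type -> E).
Hypotheses (oO : open O)
  (gd : forall t y v, J t -> O y -> is_ddir (g t) v y (dg t (y, v)))
  (dgc : jcont a b (O `*` setT) dg).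

(** eta (x + h v) is eta x + h w, where the difference quotient w of eta converges
    to l; the outer increment is then controlled by [diff_quotient]. *)
Lemma ddir_chain (eta : X -> Y) x v l t : J t -> O (eta x) -> is_ddir eta v x l ->
  is_ddir (fun x => g t (eta x)) v x (dg t (eta x, l)).
Proof.
move=> Jt Oy etad; apply/is_ddirP => e e0.
have [[A B] /= [HA HB] HAB] := diff_quotient l oO continuous_idfun gd dgc Jt Oy e0.
have At : A t by apply: (nbhs_singleton HA).
have idc : (h : R) @[h --> (0 : R)^'] --> (0 : R) by apply: cvg_within.
have cst : eta x @[h --> (0 : R)^'] --> eta x by exact: cvg_cst.
have : (eta x, h^-1 *: (eta (x + h *: v) - eta x), h) @[h --> (0 : R)^'] -->
    ((eta x, l), (0 : R)).
  exact: cvg_pair (cvg_pair cst etad) idc.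
move=> /(_ B HB); rewrite /dnbhs/= => H.
apply: (@filterS _ (nbhs (0 : R)) _ _ _ _ H) => h Hh.
have [->|h0] := eqVneq h 0.
  by rewrite !(scale0r, addr0, subrr, normr0, mulr0).
have {Hh}/= Hh := Hh h0.
have /= := HAB (t, ((eta x, h^-1 *: (eta (x + h *: v) - eta x)), h)).
rewrite scalerA mulfV// scale1r subrKC; apply; split => //.
Qed.

(** The increment splits into the increment in time of g at the moving point
    eta u, handled by the mean value inequality and the continuity of gt, and the
    increment of g t from eta t to eta u, handled by [diff_quotient]. *)
Lemma tder_chain (gt : R -> Y -> E) (eta : R -> Y) t l :
  (forall t y, J t -> O y -> tder J (g ^~ y) t (gt t y)) -> jcont a b O gt ->
  J t -> O (eta t) -> eta u @[u --> within J (nbhs t)] --> eta t -> tder J eta t l ->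
  tder J (fun u => g u (eta u)) t (gt t (eta t) + dg t (eta t, l)).
Proof.
move=> gtd gtc Jt Oy etac etad; apply/tderP => e e0.
have e20 : 0 < e / 2 by rewrite divr_gt0.
have [[A B] /= [HA HB] HAB] := diff_quotient l oO continuous_idfun gd dgc Jt Oy e20.
have At : A t by apply: (nbhs_singleton HA).
have /cvgrPdist_le/(_ _ e20)[[A' B'] /= [HA' HB'] HAB'] := gtc t _ Jt Oy.
have {HA'} [r /= r0 Hr] : exists2 r : R, 0 < r & forall u, J u -> `|u - t| < r -> A' u.
  move: HA'; rewrite /within/= => /nbhs_ballP[r r0 Hr]; exists r => // u Ju ur.
  by apply: Hr Ju; rewrite /ball/= distrC.
have nB : nbhs (eta t) (B' `&` O).
  by apply: filterI => //; apply: open_nbhs_nbhs; split.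
have H1 : \forall u \near within J (nbhs t), (B' `&` O) (eta u) by exact: (etac _ nB).
have H2 : \forall u \near within J (nbhs t), `|u - t| < r.
  apply: near_withinW; apply/nbhs_ballP; exists r => //= y.
  by rewrite /ball/= distrC.
have H3 : \forall u \near within J (nbhs t), J u by exact: withinT.
have H4 : \forall u \near within J (nbhs t),
    `|g t (eta u) - g t (eta t) - (u - t) *: dg t (eta t, l)| <= e / 2 * `|u - t|.
  have idc : u - t @[u --> within J t^'] --> (0 : R).
    rewrite -(subrr t); apply: cvgB; last exact: cvg_cst.
    apply: (@cvg_trans _ (t^')); last exact: cvg_within.
    exact: cvg_within.
  have cst : eta t @[u --> within J t^'] --> eta t by exact: cvg_cst.
  have : (eta t, (u - t)^-1 *: (eta u - eta t), u - t) @[u --> within J t^'] -->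
      ((eta t, l), (0 : R)).
    exact: cvg_pair (cvg_pair cst etad) idc.
  move=> /(_ B HB); rewrite /within /dnbhs/= /within/= => H.
  apply: (@filterS _ (nbhs t) _ _ _ _ H) => u Hu Ju.
  have [->|ut] := eqVneq u t; first by rewrite !(scale0r, subrr, normr0, mulr0).
  have {Hu}/= Hu := Hu ut Ju.
  have ut0 : u - t != 0 by rewrite subr_eq0.
  have /= := HAB (t, ((eta t, (u - t)^-1 *: (eta u - eta t)), u - t)).
  by rewrite scalerA mulfV// scale1r subrKC; apply; split.
have H5 : \forall u \near within J (nbhs t),
    `|g u (eta u) - g t (eta u) - (u - t) *: gt t (eta t)| <= e / 2 * `|u - t|.
  apply: filterS3 H1 H2 H3 => u [Bu Ou] ur Ju.
  apply: (@mean_value_itv _ _ a b (g ^~ (eta u)) (gt ^~ (eta u))) => //.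
  - exact: ltW.
  - by move=> s Js; apply: gtd.
  move=> s Js su; rewrite distrC; apply: (HAB' (s, eta u)); split=> //=.
  by apply: Hr => //; exact: le_lt_trans su ur.
apply: filterS2 H4 H5 => u H4 H5.
have -> : g u (eta u) - g t (eta t) - (u - t) *: (gt t (eta t) + dg t (eta t, l)) =
  (g u (eta u) - g t (eta u) - (u - t) *: gt t (eta t)) +
  (g t (eta u) - g t (eta t) - (u - t) *: dg t (eta t, l)) by zmodule.
by apply: (le_trans (ler_normD _ _)); rewrite (splitr e) mulrDl lerD.
Qed.

End chain_rules.

Section linc.
Context {R : realType}.

(** Continuous linear maps. *)
Definition linc {X Y : tvsType R} (l : X -> Y) : Prop :=
  (forall (c : R) x y, l (c *: x + y) = c *: l x + l y) /\ continuous l.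

Implicit Types X Y Z : tvsType R.

Lemma linc0 X Y (l : X -> Y) : linc l -> l 0 = 0.
Proof.
by move=> [lin _]; have := lin (-1) 0 0; rewrite scaler0 addr0 scaleN1r addNr.
Qed.

Lemma lincD X Y (l : X -> Y) x y : linc l -> l (x + y) = l x + l y.
Proof. by move=> [lin _]; have := lin 1 x y; rewrite !scale1r. Qed.

Lemma lincZ X Y (l : X -> Y) c x : linc l -> l (c *: x) = c *: l x.
Proof. by move=> H; have := H.1 c x 0; rewrite addr0 (linc0 H) addr0. Qed.

Lemma linc_fst X Y : linc (@fst X Y).
Proof. by split=> // p; exact: cvg_fst. Qed.

Lemma linc_snd X Y : linc (@snd X Y).
Proof. by split=> // p; exact: cvg_snd. Qed.

Lemma linc_id X : linc (@id X).
Proof. by split=> // p; exact: cvg_id. Qed.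

Lemma linc_cst0 X Y : linc (fun _ : X => (0 : Y)).
Proof. by split=> [c x y|x]; [rewrite scaler0 addr0|exact: cvg_cst]. Qed.

Lemma linc_comp X Y Z (l : Y -> Z) (m : X -> Y) : linc l -> linc m -> linc (l \o m).
Proof.
move=> [ll lc] [ml mc]; split=> [c x y|x]; first by rewrite /= ml ll.
by apply: continuous_comp; [exact: mc|exact: lc].
Qed.

Lemma linc_pair X Y Z (l : X -> Y) (m : X -> Z) :
  linc l -> linc m -> linc (fun x => (l x, m x)).
Proof.
move=> [ll lc] [ml mc]; split=> [c x y|x]; first by rewrite ll ml.
by apply: cvg_pair; [exact: lc|exact: mc].
Qed.

Lemma is_ddir_linc X Y (l : X -> Y) v x : linc l -> is_ddir l v x (l v).
Proof.
move=> H; apply: (@cvg_trans _ (l v @[h --> (0 : R)^'])); last exact: cvg_cst.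
apply: near_eq_cvg; near=> h; rewrite (lincD _ _ H) (lincZ _ _ H) addrC addKr scalerA mulVf ?scale1r//.
by near: h; exact: nbhs_dnbhs_neq.
Unshelve. all: by end_near. Qed.

End linc.

(** * Maps with mixed time and space derivatives *)

Section mixed_class.
Context {R : realType} (a b : R).
Local Notation J := (`[a, b]%classic : set R).

(** Maps on [a, b] x O with continuous derivatives of total order k, at most r of
    them in time, taken in any order.  The differential is a map on the tangent
    space O x X instead of a family of multilinear maps: the domain changes in the
    recursion, but the form of the condition does not.  Time derivatives are
    one-sided at a and b. *)
Fixpoint mixedC (k r : nat) {X H : tvsType R} (O : set X) (f : R -> X -> H)
    {struct k} : Prop :=
  jcont a b O f /\
  if k is k'.+1 then
    (exists df : R -> (X * X)%type -> H,
       (forall t x v, J t -> O x -> is_ddir (f t) v x (df t (x, v))) /\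
       mixedC k' r (O `*` setT) df) /\
    (if r is r'.+1 then
       exists ft : R -> X -> H,
         (forall t x, J t -> O x -> tder J (f ^~ x) t (ft t x)) /\
         mixedC k' r' O ft
     else True)
  else True.

Lemma mixedC_cont k r (X H : tvsType R) (O : set X) (f : R -> X -> H) :
  mixedC k r O f -> jcont a b O f.
Proof. by case: k => [|k] []. Qed.

Lemma mixedC_le1 k r (X H : tvsType R) (O : set X) (f : R -> X -> H) :
  mixedC k.+1 r O f -> mixedC k r O f.
Proof.
elim: k r X O f => [|k IH] r X O f; first by case.
move=> [fc [[df [fd dfC]] ftC]]; split => //; split.
  by exists df; split=> //; exact: IH.
by case: r fc dfC ftC => // r _ _ [ft [ftd ftC]]; exists ft; split=> //; exact: IH.
Qed.

Lemma mixedC_ler1 k r (X H : tvsType R) (O : set X) (f : R -> X -> H) :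
  mixedC k r.+1 O f -> mixedC k r O f.
Proof.
elim: k r X O f => [//|k IH] r X O f.
move=> [fc [[df [fd dfC]] ftC]]; split => //; split.
  by exists df; split=> //; exact: IH.
by case: r fc dfC ftC => // r _ _ [ft [ftd ftC]]; exists ft; split=> //; exact: IH.
Qed.

Lemma jcont_inner (X Y H : topologicalType) (O : set X) (Q : set Y)
    (f : R -> X -> H) (l : Y -> X) :
  continuous l -> (forall y, Q y -> O (l y)) -> jcont a b O f ->
  jcont a b Q (fun t y => f t (l y)).
Proof.
move=> lc lO fc t y Jt Qy.
have lp : (q.1, l q.2) @[q --> filter_prod (within J (nbhs t)) (nbhs y)] -->
    filter_prod (within J (nbhs t)) (nbhs (l y)).
  have fs : q.1 @[q --> filter_prod (within J (nbhs t)) (nbhs y)] --> within J (nbhs t).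
    exact: cvg_fst.
  have sc : q.2 @[q --> filter_prod (within J (nbhs t)) (nbhs y)] --> y by exact: cvg_snd.
  exact: (cvg_pair fs (cvg_comp _ _ sc (lc y))).
exact: (cvg_comp _ _ lp (fc t _ Jt (lO _ Qy))).
Qed.

Lemma jcont_comp (X Y H : topologicalType) (O : set X) (Q : set Y)
    (g : R -> Y -> H) (f : R -> X -> Y) :
  jcont a b O f -> (forall t x, J t -> O x -> Q (f t x)) -> jcont a b Q g ->
  jcont a b O (fun t x => g t (f t x)).
Proof.
move=> fc fQ gc t x Jt Ox.
have fp : (q.1, f q.1 q.2) @[q --> filter_prod (within J (nbhs t)) (nbhs x)] -->
    filter_prod (within J (nbhs t)) (nbhs (f t x)).
  have fs : q.1 @[q --> filter_prod (within J (nbhs t)) (nbhs x)] --> within J (nbhs t).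
    exact: cvg_fst.
  exact: (cvg_pair fs (fc t x Jt Ox)).
exact: (cvg_comp _ _ fp (gc t _ Jt (fQ _ _ Jt Ox))).
Qed.

Lemma jcont_pair (X Y Z : topologicalType) (O : set X) (f : R -> X -> Y) (g : R -> X -> Z) :
  jcont a b O f -> jcont a b O g -> jcont a b O (fun t x => (f t x, g t x)).
Proof. by move=> fc gc t x Jt Ox; exact: (cvg_pair (fc t x Jt Ox) (gc t x Jt Ox)). Qed.

Lemma jcont_slice (X H : topologicalType) (O : set X) (f : R -> X -> H) t x :
  jcont a b O f -> J t -> O x -> f u x @[u --> within J (nbhs t)] --> f t x.
Proof.
move=> fc Jt Ox.
have p : (u, x) @[u --> within J (nbhs t)] --> filter_prod (within J (nbhs t)) (nbhs x).
  have i : u @[u --> within J (nbhs t)] --> within J (nbhs t) by exact: cvg_id.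
  have c : x @[u --> within J (nbhs t)] --> x by exact: cvg_cst.
  exact: (cvg_pair i c).
exact: (cvg_comp _ _ p (fc t x Jt Ox)).
Qed.

Lemma jcont_linc (X H : topologicalType) (O : set X) (l : X -> H) :
  continuous l -> jcont a b O (fun _ => l).
Proof.
move=> lc t x Jt Ox.
have sc : q.2 @[q --> filter_prod (within J (nbhs t)) (nbhs x)] --> x by exact: cvg_snd.
exact: (cvg_comp _ _ sc (lc x)).
Qed.

Lemma mixedC_linc k r (X H : tvsType R) (O : set X) (l : X -> H) :
  linc l -> mixedC k r O (fun _ => l).
Proof.
elim: k r X O l => [|k IH] r X O l ll; split=> //; [exact: jcont_linc ll.2..|].
split.
  exists (fun _ p => l p.2); split; first by move=> t x v _ _; exact: is_ddir_linc.
  by apply: (IH _ _ _ (l \o snd)); apply: linc_comp ll (linc_snd _ _).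
case: r => // r; exists (fun _ _ => 0); split.
  move=> t x Jt Ox; rewrite /tder; under eq_fun do rewrite subrr scaler0.
  exact: cvg_cst.
by apply: (IH _ _ O (fun=> 0)); exact: linc_cst0.
Qed.

Lemma mixedC_inner k r (X Y H : tvsType R) (O : set X) (Q : set Y)
    (f : R -> X -> H) (l : Y -> X) :
  linc l -> (forall y, Q y -> O (l y)) ->
  mixedC k r O f -> mixedC k r Q (fun t y => f t (l y)).
Proof.
elim: k r X Y O Q f l => [|k IH] r X Y O Q f l ll lO.
  by move=> [fc _]; split=> //; apply: jcont_inner lO fc; exact: ll.2.
move=> [fc [[df [fd dfC]] ftC]]; split; last split.
- by apply: jcont_inner lO fc; exact: ll.2.
- exists (fun t p => df t (l p.1, l p.2)); split.
    move=> t y v Jt Qy; rewrite /is_ddir.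
    under eq_fun do rewrite (lincD _ _ ll) (lincZ _ _ ll).
    exact: fd (lO _ Qy).
  apply: (IH _ _ _ (O `*` setT) _ df (fun p => (l p.1, l p.2))) dfC.
    by apply: linc_pair; apply: linc_comp ll _; [exact: linc_fst|exact: linc_snd].
  by move=> p [Qp _]; split=> //; exact: lO.
case: r {fc dfC} ftC => // r [ft [ftd ftC]]; exists (fun t y => ft t (l y)); split.
  by move=> t y Jt Qy; apply: ftd => //; exact: lO.
exact: IH lO ftC.
Qed.

Lemma mixedC_pair k r (X H1 H2 : tvsType R) (O : set X) (f : R -> X -> H1)
    (g : R -> X -> H2) : mixedC k r O f -> mixedC k r O g ->
  mixedC k r O (fun t x => (f t x, g t x)).
Proof.
elim: k r X O f g => [|k IH] r X O f g.
  by move=> [fc _] [gc _]; split=> //; exact: jcont_pair.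
move=> [fc [[df [fd dfC]] ftC]] [gc [[dg [gd dgC]] gtC]]; split; last split.
- exact: jcont_pair.
- exists (fun t p => (df t p, dg t p)); split; last exact: IH.
  move=> t x v Jt Ox.
  exact: (cvg_pair (fd t x v Jt Ox) (gd t x v Jt Ox)).
case: r {fc dfC gc dgC} ftC gtC => // r [ft [ftd ftC]] [gt [gtd gtC]].
exists (fun t p => (ft t p, gt t p)); split; last exact: IH.
move=> t x Jt Ox.
exact: (cvg_pair (ftd t x Jt Ox) (gtd t x Jt Ox)).
Qed.

Lemma open_setX (X Y : topologicalType) (O : set X) (Q : set Y) :
  open O -> open Q -> open (O `*` Q).
Proof.
rewrite !openE => oO oQ -[x y] [/= Ox Qy]; exists (O, Q) => //=; split.
  exact: oO.
exact: oQ.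
Qed.

Lemma open_setXT (X Y : topologicalType) (O : set X) :
  open O -> open (O `*` (setT : set Y)).
Proof. by move=> oO; apply: open_setX => //; exact: openT. Qed.

Lemma mixedC_eq k r (X H : tvsType R) (O : set X) (f g : R -> X -> H) : open O ->
  (forall t x, J t -> O x -> f t x = g t x) -> mixedC k r O f -> mixedC k r O g.
Proof.
move=> oO fg.
have gc : jcont a b O f -> jcont a b O g.
  move=> fc t x Jt Ox; rewrite -(fg _ _ Jt Ox); apply: cvg_trans (fc t x Jt Ox).
  apply: near_eq_cvg; exists (J, O) => /=.
    by split; [exact: withinT|exact: open_nbhs_nbhs].
  by move=> [u y] /= [Ju Oy]; exact: fg.
case: k => [|k]; first by move=> [fc _]; split=> //; exact: gc.
move=> [fc [[df [fd dfC]] ftC]]; split; [exact: gc|split].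
  exists df; split=> // t x v Jt Ox.
  apply: cvg_trans (fd t x v Jt Ox); apply: near_eq_cvg; near=> h.
  rewrite !fg//; near: h.
  have : nbhs x O by exact: open_nbhs_nbhs.
  move=> /(shift_cvg v (@continuous_idfun _)) [[C D] /= [HC HD] HCD].
  apply: (@filterS _ _ _ D).
    by move=> h Dh; apply: (HCD ((x, v), h)); split => //=; exact: nbhs_singleton.
  by apply: cvg_within HD.
case: r {fc dfC} ftC => // r [ft [ftd ftC]].
exists ft; split=> // t x Jt Ox; apply: cvg_trans (ftd t x Jt Ox).
apply: near_eq_cvg; apply: (@filterS _ _ _ J); last exact: withinT.
by move=> u Ju /=; rewrite !fg.
Unshelve. all: by end_near. Qed.

End mixed_class.

Section mixed_class_normed.
Context {R : realType} (a b : R) {E : normedModType R}.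
Local Notation J := (`[a, b]%classic : set R).
Local Notation mixedC := (@mixedC R a b).

Lemma is_ddirD (X : tvsType R) (f g : X -> E) v x l m :
  is_ddir f v x l -> is_ddir g v x m -> is_ddir (fun x => f x + g x) v x (l + m).
Proof.
move=> /is_ddirP Hf /is_ddirP Hg; apply/is_ddirP => e e0.
have e20 : 0 < e / 2 by rewrite divr_gt0.
apply: filterS2 (Hf _ e20) (Hg _ e20) => h H1 H2.
have -> : f (x + h *: v) + g (x + h *: v) - (f x + g x) - h *: (l + m) =
  (f (x + h *: v) - f x - h *: l) + (g (x + h *: v) - g x - h *: m) by zmodule.
by apply: (le_trans (ler_normD _ _)); rewrite (splitr e) mulrDl lerD.
Qed.

Lemma mixedC_add k r (X : tvsType R) (O : set X) (f g : R -> X -> E) :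
  mixedC k r O f -> mixedC k r O g -> mixedC k r O (fun t x => f t x + g t x).
Proof.
elim: k r X O f g => [|k IH] r X O f g.
  by move=> [fc _] [gc _]; split=> // t x Jt Ox; apply: cvgD; [exact: fc|exact: gc].
move=> [fc [[df [fd dfC]] ftC]] [gc [[dg [gd dgC]] gtC]]; split; last split.
- by move=> t x Jt Ox; apply: cvgD; [exact: fc|exact: gc].
- exists (fun t p => df t p + dg t p); split; last exact: IH.
  by move=> t x v Jt Ox; apply: is_ddirD; [exact: fd|exact: gd].
case: r {fc dfC gc dgC} ftC gtC => // r [ft [ftd ftC]] [gt [gtd gtC]].
exists (fun t p => ft t p + gt t p); split; last exact: IH.
by move=> t x Jt Ox; apply: tderD; [exact: ftd|exact: gtd].
Qed.

(** The differential of g o f is dg o (f, df), and its time derivative is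
    gt o f + dg o (f, ft).  These are compositions of the same kind with one
    derivative fewer. *)
Lemma mixedC_comp k r (X Y : tvsType R) (O : set X) (Q : set Y)
    (g : R -> Y -> E) (f : R -> X -> Y) : open Q ->
  (forall t x, J t -> O x -> Q (f t x)) ->
  mixedC k r Q g -> mixedC k r O f -> mixedC k r O (fun t x => g t (f t x)).
Proof.
elim: k r X Y O Q g f => [|k IH] r X Y O Q g f oQ fQ.
  by move=> [gc _] [fc _]; split=> //; exact: jcont_comp fQ gc.
move=> gC fC; have {}gC1 := mixedC_le1 gC; have {}fC1 := mixedC_le1 fC.
move: gC fC => [gc [[dg [gd dgC]] gtC]] [fc [[df [fd dfC]] ftC]].
have dgc := mixedC_cont dgC.
have oQT := @open_setXT Y Y Q oQ.
split; first exact: jcont_comp fQ gc.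
split.
  exists (fun t p => dg t (f t p.1, df t p)); split.
    move=> t x v Jt Ox; exact: (ddir_chain oQ gd dgc Jt (fQ t x Jt Ox) (fd t x v Jt Ox)).
  apply: (IH _ _ _ _ (Q `*` setT) dg (fun t p => (f t p.1, df t p))) => //.
    by move=> t p Jt [Op _]; split=> //; exact: fQ.
  apply: mixedC_pair dfC; apply: mixedC_inner fC1; first exact: linc_fst.
  by move=> p [].
case: r gC1 fC1 dgC dfC gtC ftC => // r gC1 fC1 dgC dfC [gt [gtd gtC]] [ft [ftd ftC]].
exists (fun t x => gt t (f t x) + dg t (f t x, ft t x)); split.
  move=> t x Jt Ox.
  apply: (tder_chain oQ gd dgc gtd (mixedC_cont gtC) Jt (fQ t x Jt Ox) _ (ftd t x Jt Ox)).
  exact: jcont_slice fc Jt Ox.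
apply: mixedC_add.
  by apply: IH gtC _ => //; exact: mixedC_ler1.
apply: (IH _ _ _ _ (Q `*` setT) dg (fun t p => (f t p, ft t p))) => //.
- by move=> t p Jt Op; split=> //; exact: fQ.
- exact: mixedC_ler1.
by apply: mixedC_pair ftC; exact: mixedC_ler1.
Qed.

End mixed_class_normed.

(** * Dependence of solutions on parameters *)

Section regularity.
Context {R : realType} {E : completeNormedModType R} (a b : R) (ab : a < b).
Context (L : R) (L0 : 0 <= L) (Lab : L * (b - a) <= 2^-1).
Context (tau : R).
Local Notation J := (`[a, b]%classic : set R).
Hypothesis Jtau : J tau.
Local Notation mixedC := (@mixedC R a b).
Local Notation jcont := (@jcont R a b).

(** The regularity of solutions when the right-hand side is in [mixedC k r]: the
    time derivative of the j-th differential is in [mixedC (k - j) r], for j up to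
    k.  Compared with [mixedC k r] one time derivative is gained. *)
Fixpoint solutionC (k r : nat) {X : tvsType R} (O : set X) (y : R -> X -> E)
    {struct k} : Prop :=
  [/\ jcont O y,
      exists yt : R -> X -> E,
        (forall t x, J t -> O x -> tder J (y ^~ x) t (yt t x)) /\ mixedC k r O yt &
      if k is k'.+1 then exists dy : R -> (X * X)%type -> E,
        (forall t x v, J t -> O x -> is_ddir (y t) v x (dy t (x, v))) /\
        solutionC k' r (O `*` setT) dy
      else True].

Lemma solutionC_mixedC k r (X : tvsType R) (O : set X) (y : R -> X -> E) :
  solutionC k r O y -> mixedC k r O y.
Proof.
elim: k r X O y => [|k IH] r X O y; first by case.
move=> [yc [yt [ytd ytC]] [dy [dyd dyC]]]; split=> //; split.
  by exists dy; split=> //; exact: IH.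
case: r ytC {dyC} => // r ytC; exists yt; split=> //.
by apply: mixedC_ler1; exact: mixedC_le1.
Qed.

Lemma jcont_path (Y H : topologicalType) (Q : set Y) (g : R -> Y -> H) (w : R -> Y) t :
  jcont Q g -> J t -> Q (w t) -> w u @[u --> within J (nbhs t)] --> w t ->
  g u (w u) @[u --> within J (nbhs t)] --> g t (w t).
Proof.
move=> gc Jt Qw wc.
have i : u @[u --> within J (nbhs t)] --> within J (nbhs t) by exact: cvg_id.
exact: (cvg_comp _ _ (cvg_pair i wc) (gc t _ Jt Qw)).
Qed.

Section one_equation.
Context {X : tvsType R} (O : set X) (U : set E) (oO : open O) (oU : open U).
Context (g : R -> (E * X)%type -> E) (y : R -> X -> E) (c : X -> E).
Hypotheses (gc : jcont (U `*` O) g)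
  (gL : forall t x z z', J t -> O x -> U z -> U z' ->
     `|g t (z, x) - g t (z', x)| <= L * `|z - z'|)
  (yU : forall t x, J t -> O x -> U (y t x))
  (yd : forall t x, J t -> O x -> tder J (y ^~ x) t (g t (y t x, x)))
  (yc : forall x, O x -> y tau x = c x) (cl : linc c).

(** The difference d of the solutions for x' and x satisfies |d'| <= L |d| + eta
    with eta small, uniformly in time, when x' is close to x. *)
Lemma ode_continuous : jcont O y.
Proof.
move=> t x Jt Ox; apply/cvgrPdist_le => e e0.
have ba0 : 0 < b - a by rewrite subr_gt0.
have e20 : 0 < e / 2 by rewrite divr_gt0.
have e80 : 0 < e / 8 by rewrite divr_gt0.
pose eta := e / 8 / (b - a); have eta0 : 0 < eta by rewrite divr_gt0.
have eta20 : 0 < eta / 2 by rewrite divr_gt0.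
have yx u : J u -> y v x @[v --> within J (nbhs u)] --> y u x.
  by move=> Ju; exact: tder_cvg (yd Ju Ox).
have H1 : \forall x' \near nbhs x, forall u, J u ->
    `|g u (y u x, x') - g u (y u x, x)| <= eta.
  apply: tube => u Ju; have Qu : (U `*` O) (y u x, x) by split=> //; exact: yU.
  have c1 : (q.1, (y q.1 x, q.2)) @[q --> filter_prod (within J (nbhs u)) (nbhs x)] -->
      filter_prod (within J (nbhs u)) (nbhs (y u x, x)).
    have f1 : q.1 @[q --> filter_prod (within J (nbhs u)) (nbhs x)] --> within J (nbhs u).
      exact: cvg_fst.
    have f2 : q.2 @[q --> filter_prod (within J (nbhs u)) (nbhs x)] --> x by exact: cvg_snd.
    have f3 : y q.1 x @[q --> filter_prod (within J (nbhs u)) (nbhs x)] --> y u x.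
      exact: (cvg_comp _ _ f1 (yx u Ju)).
    exact: (cvg_pair f1 (cvg_pair f3 f2)).
  have /cvgrPdist_le/(_ _ eta20) G1 := cvg_comp _ _ c1 (gc Ju Qu).
  have c2 : g v (y v x, x) @[v --> within J (nbhs u)] --> g u (y u x, x).
    apply: (jcont_path (w := fun v => (y v x, x)) gc Ju Qu).
    have cx : x @[v --> within J (nbhs u)] --> x by exact: cvg_cst.
    exact: cvg_pair (yx u Ju) cx.
  have /cvgrPdist_le/(_ _ eta20) G2 := c2.
  have {}G2 : \forall q \near filter_prod (within J (nbhs u)) (nbhs x),
     `|g u (y u x, x) - g q.1 (y q.1 x, x)| <= eta / 2.
    exact: (@cvg_fst _ _ (within J (nbhs u)) (nbhs x) _ _ G2).
  apply: filterS2 G1 G2 => q /= G1 G2.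
  rewrite -(subrKA (g u (y u x, x))) (splitr eta).
  by apply: (le_trans (ler_normD _ _)); rewrite lerD// distrC.
have H2 : \forall x' \near nbhs x, `|c x - c x'| <= e / 8.
  by have /cvgrPdist_le := cl.2 x; exact.
have H3 : \forall x' \near nbhs x, O x' by exact: open_nbhs_nbhs.
have H4 : \forall x' \near nbhs x, forall u, J u -> `|y u x' - y u x| <= e / 2.
  apply: filterS3 H1 H2 H3 => x' H1 H2 Ox' u Ju.
  have := @short_gronwall R E a b (fun s => y s x' - y s x)
    (fun s => g s (y s x', x') - g s (y s x, x)) L eta tau L0 (ltW eta0) Lab Jtau.
  move=> /(_ _ _ u Ju) => H; apply: (le_trans (H _ _)).
  - by move=> s Js; apply: tderB; exact: yd.
  - move=> s Js; rewrite -(subrKA (g s (y s x, x'))); apply: (le_trans (ler_normD _ _)).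
    by rewrite lerD ?H1//; apply: gL => //; exact: yU.
  - rewrite !yc// distrC /eta mulrC (mulrC (b - a)) divfK ?gt_eqF//; lra.
have /cvgrPdist_le/(_ _ e20) H5 := yx t Jt.
exists ([set u | J u /\ `|y t x - y u x| <= e / 2],
    [set x' | forall u, J u -> `|y u x' - y u x| <= e / 2]) => /=.
  by split=> //; apply: filterI H5; exact: withinT.
move=> [u x'] /= [[Ju Hu] Hx]; rewrite -(subrKA (y u x)) (splitr e).
by apply: (le_trans (ler_normD _ _)); rewrite lerD// distrC; exact: Hx.
Qed.

Context (dg : R -> ((E * X) * (E * X))%type -> E).
Hypotheses
  (gd : forall t x v, J t -> (U `*` O) x -> is_ddir (g t) v x (dg t (x, v)))
  (dgc : jcont ((U `*` O) `*` setT) dg).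

(** The Lipschitz constant passes to the differential, so the linearised equation
    is solvable on the same interval, on the whole of E. *)
Lemma ddir_lip t z0 x z z' m : J t -> U z0 -> O x ->
  `|dg t ((z0, x), (z, m)) - dg t ((z0, x), (z', m))| <= L * `|z - z'|.
Proof.
move=> Jt Uz Ox; have Q : (U `*` O) (z0, x) by [].
have nQ : nbhs (z0, x) (U `*` O).
  by apply: open_nbhs_nbhs; split=> //; exact: open_setX.
have inQ v : \forall h \near (0 : R), (U `*` O) ((z0, x) + h *: v).
  have [[C D] /= [HC HD] HCD] := shift_cvg v (@continuous_idfun _) nQ.
  apply: filterS HD => h Dh; apply: (HCD (((z0, x), v), h)); split=> //=.
  exact: nbhs_singleton HC.
apply/ler_addgt0Pr => e e0; have e20 : 0 < e / 2 by rewrite divr_gt0.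
have /is_ddirP/(_ _ e20) H1 := @gd t (z0, x) (z, m) Jt Q.
have /is_ddirP/(_ _ e20) H2 := @gd t (z0, x) (z', m) Jt Q.
have I1 := inQ (z, m); have I2 := inQ (z', m).
near (0 : R)^' => h.
have h0 : h != 0 by near: h; exact: nbhs_dnbhs_neq.
have K1 : `|g t ((z0, x) + h *: (z, m)) - g t (z0, x) - h *: dg t ((z0, x), (z, m))|
    <= e / 2 * `|h| by near: h; exact: (@cvg_within _ (nbhs (0 : R)) _ _ _ H1).
have K2 : `|g t ((z0, x) + h *: (z', m)) - g t (z0, x) - h *: dg t ((z0, x), (z', m))|
    <= e / 2 * `|h| by near: h; exact: (@cvg_within _ (nbhs (0 : R)) _ _ _ H2).
have K3 : (U `*` O) ((z0, x) + h *: (z, m)).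
  by near: h; exact: (@cvg_within _ (nbhs (0 : R)) _ _ _ I1).
have K4 : (U `*` O) ((z0, x) + h *: (z', m)).
  by near: h; exact: (@cvg_within _ (nbhs (0 : R)) _ _ _ I2).
have H3 : `|g t ((z0, x) + h *: (z, m)) - g t ((z0, x) + h *: (z', m))| <=
    L * (`|h| * `|z - z'|).
  have := gL Jt K3.2 K3.1 K4.1 => /le_trans; apply; rewrite ler_wpM2l//=.
  have -> : z0 + h *: z - (z0 + h *: z') = h *: (z - z') by zmodule.
  by rewrite normrZ.
have hp : 0 < `|h| by rewrite normr_gt0.
rewrite -(ler_pM2l hp) -normrZ scalerBr.
set A := h *: dg t (_, (z, m)) in K1 *; set B := h *: dg t (_, (z', m)) in K2 *.
set G1 := g t (_ + _) in K1 H3; set G2 := g t (_ + _) in K2 H3.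
have -> : A - B = (G1 - G2) - (G1 - g t (z0, x) - A) + (G2 - g t (z0, x) - B) by zmodule.
apply: (le_trans (ler_normD _ _)).
have := ler_normB (G1 - G2) (G1 - g t (z0, x) - A).
move: K1 K2 H3; rewrite mulrCA.
move: (`|_ - _ - _|) (`|G2 - _ - _|) (`|G1 - G2|) => *; lra.
Unshelve. all: by end_near. Qed.

Lemma variational_exists x m : O x -> exists z : R -> E, z tau = c m /\
  forall t, J t -> tder J z t (dg t ((y t x, x), (z t, m))).
Proof.
move=> Ox; have yx t : J t -> y v x @[v --> within J (nbhs t)] --> y t x.
  by move=> Jt; exact: tder_cvg (yd Jt Ox).
case: (@ode_exists R E a b ab
  (fun t z => dg t ((y t x, x), (z, m))) setT L tau (c m) L0 Lab Jtau) => //;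
  last by move=> z [ztau _ zd]; exists z.
- by move=> t z z' Jt _ _; apply: ddir_lip => //; exact: yU.
- move=> t z Jt _.
  apply: (jcont_path (w := fun v => ((y v x, x), (z, m))) dgc Jt).
    by split=> //; split=> //; exact: yU.
  have cx : x @[v --> within J (nbhs t)] --> x by exact: cvg_cst.
  have cz : (z, m) @[v --> within J (nbhs t)] --> (z, m) by exact: cvg_cst.
  exact: (cvg_pair (cvg_pair (yx t Jt) cx) cz).
Qed.

(** The error d of the first-order expansion satisfies |d'| <= L |d| + eta |h|:
    the solution for x + h m is compared with y + h z, and the increment of g from
    (y, x) to (y, x) + h (z, m) with the differential of g. *)
Lemma ode_differentiable x m (z : R -> E) : O x -> z tau = c m ->
  (forall t, J t -> tder J z t (dg t ((y t x, x), (z t, m)))) ->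
  forall t, J t -> is_ddir (y t) m x (z t).
Proof.
move=> Ox ztau zd t Jt; apply/is_ddirP => e e0.
have yx u : J u -> y v x @[v --> within J (nbhs u)] --> y u x.
  by move=> Ju; exact: tder_cvg (yd Ju Ox).
have zx u : J u -> z v @[v --> within J (nbhs u)] --> z u.
  by move=> Ju; exact: tder_cvg (zd u Ju).
have ba0 : 0 < b - a by rewrite subr_gt0.
pose eta := e / 2 / (b - a); have eta0 : 0 < eta by rewrite !divr_gt0.
have eta20 : 0 < eta / 2 by rewrite divr_gt0.
have oQ : open (U `*` O) by exact: open_setX.
have H1 : \forall h \near (0 : R), forall u, J u ->
    [/\ `|g u ((y u x, x) + h *: (z u, m)) - g u (y u x, x) -
          h *: dg u ((y u x, x), (z u, m))| <= eta * `|h| &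
       (U `*` O) ((y u x, x) + h *: (z u, m))].
  apply: (@tube R a b R (nbhs (0 : R)) _ (fun u h =>
    [/\ `|g u ((y u x, x) + h *: (z u, m)) - g u (y u x, x) -
          h *: dg u ((y u x, x), (z u, m))| <= eta * `|h| &
       (U `*` O) ((y u x, x) + h *: (z u, m))])) => u Ju.
  have Qu : (U `*` O) (y u x, x) by split=> //; exact: yU.
  have f1 : q.1 @[q --> filter_prod (within J (nbhs u)) (nbhs (0 : R))] --> within J (nbhs u).
    exact: cvg_fst.
  have f2 : q.2 @[q --> filter_prod (within J (nbhs u)) (nbhs (0 : R))] --> (0 : R).
    exact: cvg_snd.
  have f3 : x @[q --> filter_prod (within J (nbhs u)) (nbhs (0 : R))] --> x by exact: cvg_cst.
  have f4 : m @[q --> filter_prod (within J (nbhs u)) (nbhs (0 : R))] --> m by exact: cvg_cst.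
  have f5 := cvg_comp _ _ f1 (yx u Ju).
  have f6 := cvg_comp _ _ f1 (zx u Ju).
  have f7 : (((y q.1 x, x), (z q.1, m)), q.2)
      @[q --> filter_prod (within J (nbhs u)) (nbhs (0 : R))] -->
      (((y u x, x), (z u, m)), (0 : R)).
    exact: (cvg_pair (cvg_pair (cvg_pair f5 f3) (cvg_pair f6 f4)) f2).
  have D := diff_quotient (z u, m) oQ continuous_idfun gd dgc Ju Qu eta20.
  have f8 : (q.1, (((y q.1 x, x), (z q.1, m)), q.2))
      @[q --> filter_prod (within J (nbhs u)) (nbhs (0 : R))] -->
      filter_prod (within J (nbhs u)) (nbhs (((y u x, x), (z u, m)), (0 : R))).
    exact: (cvg_pair f1 f7).
  have G1 := f8 _ D.
  have c2 : dg v ((y v x, x), (z v, m)) @[v --> within J (nbhs u)] -->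
      dg u ((y u x, x), (z u, m)).
    apply: (jcont_path (w := fun v => ((y v x, x), (z v, m))) dgc Ju); first by split.
    have cx : x @[v --> within J (nbhs u)] --> x by exact: cvg_cst.
    have cm : m @[v --> within J (nbhs u)] --> m by exact: cvg_cst.
    exact: (cvg_pair (cvg_pair (yx u Ju) cx) (cvg_pair (zx u Ju) cm)).
  have /cvgrPdist_le/(_ _ eta20) G2 := c2.
  have {}G2 : \forall q \near filter_prod (within J (nbhs u)) (nbhs (0 : R)),
     `|dg u ((y u x, x), (z u, m)) - dg q.1 ((y q.1 x, x), (z q.1, m))| <= eta / 2.
    exact: (@cvg_fst _ _ (within J (nbhs u)) (nbhs (0 : R)) _ _ G2).
  have nQ : nbhs (y u x, x) (U `*` O) by exact: open_nbhs_nbhs.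
  have G3 := f7 _ (shift_cvg (z u, m) (@continuous_idfun _) nQ).
  apply: (@filterS3 _ (filter_prod (within J (nbhs u)) (nbhs (0 : R))) _ _ _ _ _ _ G1 G2 G3).
  move=> -[v h] /= {}G1 {}G2 {}G3; split=> //.
  set A := g v _ - g v _ in G1 *.
  rewrite -(subrKA (h *: dg u ((y u x, x), (z u, m)))) -scalerBr.
  apply: (le_trans (ler_normD _ _)); rewrite (splitr eta) mulrDl lerD//.
  by rewrite normrZ mulrC ler_wpM2r.
have nO : nbhs x O by exact: open_nbhs_nbhs.
have [[C D] /= [HC HD] HCD] := shift_cvg m (@continuous_idfun _) nO.
have H2 : \forall h \near (0 : R), O (x + h *: m).
  apply: filterS HD => h Dh; apply: (HCD ((x, m), h)); split=> //=.
  exact: nbhs_singleton HC.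
apply: filterS2 H1 H2 => h H1 H2.
have eh : 0 <= eta * `|h| by rewrite mulr_ge0// ltW.
have := @short_gronwall R E a b (fun s => y s (x + h *: m) - y s x - h *: z s)
    (fun s => g s (y s (x + h *: m), x + h *: m) - g s (y s x, x)
       - h *: dg s ((y s x, x), (z s, m))) L (eta * `|h|) tau L0 eh Lab Jtau.
move=> /(_ _ _ t Jt) => H; apply: (le_trans (H _ _)).
- by move=> s Js; apply: tderB; [apply: tderB; exact: yd|apply: tderZ; exact: zd].
- move=> s Js; have [G1 G2] := H1 s Js.
  set A := h *: dg s _ in G1 *.
  have -> : g s (y s (x + h *: m), x + h *: m) - g s (y s x, x) - A =
    (g s (y s (x + h *: m), x + h *: m) - g s ((y s x, x) + h *: (z s, m))) +
    (g s ((y s x, x) + h *: (z s, m)) - g s (y s x, x) - A) by zmodule.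
  apply: (le_trans (ler_normD _ _)); rewrite lerD//.
  apply: (le_trans (gL Js H2 (yU Js H2) G2.1)).
  by rewrite opprD addrA.
rewrite !yc// ztau (lincD _ _ cl) (lincZ _ _ cl) [c x + _]addrC addrK subrr normr0 add0r.
have -> : 2 * ((b - a) * (eta * `|h|)) = 2 * (eta * (b - a)) * `|h| by ring.
by rewrite /eta divfK ?gt_eqF// [2 * _]mulrC divfK.
Qed.

End one_equation.

(** The differential of y solves the linearised equation, which has the parameter
    (x, m) and a right-hand side with one derivative fewer; it is composed from dg
    and y, and y is as regular as necessary by the induction hypothesis. *)
Theorem ode_regularity k r (X : tvsType R) (O : set X) (U : set E)
    (g : R -> (E * X)%type -> E) (y : R -> X -> E) (c : X -> E) :
  open O -> open U -> mixedC k r (U `*` O) g ->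
  (forall t x z z', J t -> O x -> U z -> U z' ->
     `|g t (z, x) - g t (z', x)| <= L * `|z - z'|) ->
  (forall t x, J t -> O x -> U (y t x)) ->
  (forall t x, J t -> O x -> tder J (y ^~ x) t (g t (y t x, x))) ->
  (forall x, O x -> y tau x = c x) -> linc c -> solutionC k r O y.
Proof.
elim: k r X O U g y c => [|k IH] r X O U g y c oO oU gC gL yU yd yc cl.
  have yj := ode_continuous oO (mixedC_cont gC) gL yU yd yc cl.
  split=> //; exists (fun t x => g t (y t x, x)); split=> //.
  apply: (mixedC_comp (Q := U `*` O) (f := fun t x => (y t x, x))) gC _.
  - exact: open_setX.
  - by move=> t x Jt Ox; split=> //; exact: yU.
  by split=> //; apply: jcont_pair => //; apply: jcont_linc => ?; exact: cvg_id.
have yj := ode_continuous oO (mixedC_cont gC) gL yU yd yc cl.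
have oQ : open (U `*` O) by exact: open_setX.
have yQ t x : J t -> O x -> (U `*` O) (y t x, x) by move=> Jt Ox; split=> //; exact: yU.
have yC := solutionC_mixedC (IH r X O U g y c oO oU (mixedC_le1 gC) gL yU yd yc cl).
have [_ [[dg [gd dgC]] _]] := gC.
have dgc := mixedC_cont dgC.
have ex (p : X * X) : exists z : R -> E, O p.1 -> z tau = c p.2 /\
    forall t, J t -> tder J z t (dg t ((y t p.1, p.1), (z t, p.2))).
  have [Op|nOp] := pselect (O p.1); last by exists (fun=> 0).
  have [z Hz] := variational_exists oO oU c gL yU yd gd dgc p.2 Op.
  by exists z.
have {ex}[Z HZ] := choice ex.
pose dy t p := Z p t.
have dyd t x v : J t -> O x -> is_ddir (y t) v x (dy t (x, v)).
  move=> Jt Ox; have [Ztau Zd] := HZ (x, v) Ox.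
  exact: (ode_differentiable oO oU gL yU yd yc cl gd dgc Ox Ztau Zd Jt).
have oOT := @open_setXT X X O oO.
have dyC : solutionC k r (O `*` setT) dy.
  apply: (IH r _ (O `*` setT) setT
    (fun t q => dg t ((y t q.2.1, q.2.1), (q.1, q.2.2))) dy (c \o snd)) => //.
  - exact: openT.
  - apply: (mixedC_comp (Q := (U `*` O) `*` setT)
      (f := fun t (q : E * (X * X)) => ((y t q.2.1, q.2.1), (q.1, q.2.2)))) dgC _.
    + exact: open_setXT.
    + by move=> t [z [x v]] Jt [_ [/= Ox _]]; split=> //; exact: yQ.
    have l1 : linc (fun q : E * (X * X) => q.2.1).
      exact: (linc_comp (linc_fst _ _) (linc_snd _ _)).
    have l2 : linc (fun q : E * (X * X) => q.2.2).
      exact: (linc_comp (linc_snd _ _) (linc_snd _ _)).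
    apply: mixedC_pair; apply: mixedC_pair.
    + by apply: (mixedC_inner (l := fun q : E * (X * X) => q.2.1) l1 _ yC) => q [_ []].
    + exact: mixedC_linc.
    + exact: mixedC_linc (linc_fst _ _).
    + exact: mixedC_linc.
  - by move=> t [x v] z z' Jt [/= Ox _] _ _; apply: (ddir_lip oO oU gL gd) => //; exact: yU.
  - by move=> t [x v] Jt [/= Ox _]; exact: (HZ (x, v) Ox).2.
  - by move=> [x v] [/= Ox _]; exact: (HZ (x, v) Ox).1.
  - by apply: linc_comp => //; exact: linc_snd.
have idC k' r' : mixedC k' r' O (fun _ : R => @id X) by apply: mixedC_linc; exact: linc_id.
have yC1 : mixedC k.+1 r O y.
  split=> //; split; first by exists dy; split=> //; exact: solutionC_mixedC.
  case: r gC yC {dyC dgC} => // r gC yC; exists (fun t x => g t (y t x, x)); split=> //.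
  apply: (mixedC_comp (f := fun t x => (y t x, x)) oQ yQ); last first.
    by apply: mixedC_pair (idC _ _); exact: mixedC_ler1.
  by apply: mixedC_ler1; exact: mixedC_le1.
split=> //; last by exists dy.
exists (fun t x => g t (y t x, x)); split=> //.
exact: (mixedC_comp (f := fun t x => (y t x, x)) oQ yQ gC (mixedC_pair yC1 (idC _ _))).
Qed.

End regularity.

(** * Derivatives up to the boundary and Schwarz's theorem *)

Section up_to_the_boundary.
Context {R : realType} {E : normedModType R} (a b : R) (ab : a < b).
Local Notation J := (`[a, b]%classic : set R).
Local Notation jcont := (@jcont R a b).

(** Inner points different from t approximate every point t of [a, b]. *)
Lemma inner_point t (P : R -> Prop) : J t ->
  (\forall u \near within J (nbhs t), P u) ->
  exists u, [/\ a < u < b, u != t & P u].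
Proof.
rewrite /= in_itv/= => /andP[at_ tb]; rewrite near_withinE => /nbhs_ballP[r /= r0 Hr].
have [tb'|bt] := ltP t b.
  pose d := Num.min (r / 2) ((b - t) / 2).
  have d0 : 0 < d by rewrite lt_min !divr_gt0// subr_gt0.
  have dr : d <= r / 2 by rewrite ge_min lexx.
  have db : d <= (b - t) / 2 by rewrite ge_min lexx orbT.
  exists (t + d); split; first by apply/andP; split; lra.
    by rewrite -subr_eq0 addrAC subrr add0r gt_eqF.
  apply: Hr; last by rewrite /= in_itv/=; apply/andP; split; lra.
  by rewrite /ball/= opprD addrA subrr sub0r normrN gtr0_norm//; lra.
pose d := Num.min (r / 2) ((b - a) / 2).
have d0 : 0 < d by rewrite lt_min !divr_gt0// subr_gt0.
have dr : d <= r / 2 by rewrite ge_min lexx.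
have db : d <= (b - a) / 2 by rewrite ge_min lexx orbT.
exists (t - d); split; first by apply/andP; split; lra.
  by rewrite -subr_eq0 addrAC subrr add0r oppr_eq0 gt_eqF.
apply: Hr; last by rewrite /= in_itv/=; apply/andP; split; lra.
by rewrite /ball/= subKr gtr0_norm//; lra.
Qed.

(** A derivative in the interior which extends continuously to an endpoint is the
    one-sided derivative there. *)
Lemma tder_boundary (x x' : R -> E) :
  (forall t, J t -> x u @[u --> within J (nbhs t)] --> x t) ->
  (forall t, J t -> x' u @[u --> within J (nbhs t)] --> x' t) ->
  (forall t, a < t < b -> tder J x t (x' t)) -> forall t, J t -> tder J x t (x' t).
Proof.
move=> xc x'c xd t Jt; apply/tderP => e e0.
have /cvgrPdist_le/(_ _ e0) := x'c t Jt; rewrite !near_withinE.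
move=> /nbhs_ballP[r /= r0 Hr]; apply/nbhs_ballP; exists r => //= u.
rewrite /ball/= distrC => ut Ju.
apply: (@mean_value_oo _ _ a b x x') => //; first exact: ltW.
move=> s /andP[as_ sb] su; rewrite distrC; apply: Hr.
  by rewrite /ball/= distrC (le_lt_trans su).
by rewrite /= in_itv/= !ltW.
Qed.

Lemma tder_bound (x : R -> E) t l c K : J t -> tder J x t l ->
  (\forall u \near within J (nbhs t), `|x u - x t - (u - t) *: c| <= K * `|u - t|) ->
  `|l - c| <= K.
Proof.
move=> Jt /tderP xl H; apply/ler_addgt0Pr => e e0.
have [u [_ ut [H1 H2]]] := inner_point Jt (filterI (xl e e0) H).
have ut0 : 0 < `|u - t| by rewrite normr_gt0 subr_eq0.
rewrite -(ler_pM2l ut0) -normrZ.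
have -> : (u - t) *: (l - c) =
   (x u - x t - (u - t) *: c) - (x u - x t - (u - t) *: l) by zmodule.
by apply: (le_trans (ler_normB _ _)); rewrite mulrDr [_ * K]mulrC [_ * e]mulrC lerD.
Qed.

Context {X : tvsType R} (O : set X) (oO : open O).

Lemma near_segment x v : O x -> forall B : set X, nbhs x B ->
  \forall h \near (0 : R), forall s, 0 <= s <= 1 -> (B `&` O) (x + (s * h) *: v).
Proof.
move=> Ox B nB; have nBO : nbhs x (B `&` O).
  by apply: filterI => //; exact: open_nbhs_nbhs.
have [[C D] /= [HC HD] HCD] := shift_cvg v (@continuous_idfun _) nBO.
move: HD => /nbhs_ballP[r /= r0 Hr]; apply/nbhs_ballP; exists r => //= h.
rewrite /ball/= sub0r normrN => hr s /andP[s0 s1].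
apply: (HCD ((x, v), s * h)); split=> /=; first exact: nbhs_singleton HC.
apply: Hr; rewrite /ball/= sub0r normrN normrM (ger0_norm s0).
by apply: le_lt_trans hr; rewrite ler_piMl.
Qed.

Lemma segment_mean_value (g g' : X -> E) (v x : X) (c : E) (K h : R) : 0 <= K ->
  (forall s, 0 <= s <= 1 -> is_ddir g v (x + (s * h) *: v) (g' (x + (s * h) *: v))) ->
  (forall s, 0 <= s <= 1 -> `|g' (x + (s * h) *: v) - c| <= K) ->
  `|g (x + h *: v) - g x - h *: c| <= K * `|h|.
Proof.
move=> K0 gd gK.
have := @mean_value_itv R E 0 1 (fun s => g (x + (s * h) *: v))
  (fun s => h *: g' (x + (s * h) *: v)) (h *: c) (K * `|h|) 0 1.
rewrite mul1r mul0r scale0r addr0 subr0 scale1r normr1 mulr1; apply.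
- by rewrite mulr_ge0.
- by rewrite /= in_itv/= lexx ler01.
- by rewrite /= in_itv/= lexx ler01.
- by move=> s; rewrite /= in_itv/= => s01; apply: line_tder; apply: gd.
move=> s; rewrite /= in_itv/= => s01 _.
by rewrite -scalerBr normrZ mulrC ler_wpM2r// gK.
Qed.

(** The mean value inequality on a segment in space holds at inner times and
    passes to the limit as the time tends to an endpoint. *)
Lemma ddir_boundary (f df : R -> X -> E) v :
  jcont O f -> jcont O df ->
  (forall t x, a < t < b -> O x -> is_ddir (f t) v x (df t x)) ->
  forall t x, J t -> O x -> is_ddir (f t) v x (df t x).
Proof.
move=> fc dfc fd t x Jt Ox; apply/is_ddirP => e e0.
have /cvgrPdist_le/(_ _ e0)[[A B] /= [HA HB] HAB] := dfc t x Jt Ox.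
apply: filterS (near_segment v Ox HB) => h Hh.
have Oxh : O (x + h *: v) by have [] := Hh 1; rewrite ?ler01 ?lexx// mul1r.
apply/ler_addgt0Pr => d d0; have d20 : 0 < d / 2 by rewrite divr_gt0.
have /cvgrPdist_le/(_ _ d20) F1 := jcont_slice fc Jt Oxh.
have /cvgrPdist_le/(_ _ d20) F2 := jcont_slice fc Jt Ox.
have [u [uab _ [[F1u F2u] Au]]] := inner_point Jt (filterI (filterI F1 F2) HA).
have Ju : J u by move/andP: uab => [? ?]; rewrite /= in_itv/= !ltW.
have H : `|f u (x + h *: v) - f u x - h *: df t x| <= e * `|h|.
  apply: (segment_mean_value (g' := df u)); first exact: ltW.
    by move=> s s01; apply: fd => //; exact: (Hh s s01).2.
  move=> s s01; rewrite distrC; apply: (HAB (u, x + (s * h) *: v)).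
  by split=> //=; exact: (Hh s s01).1.
have -> : f t (x + h *: v) - f t x - h *: df t x =
   (f u (x + h *: v) - f u x - h *: df t x) +
   ((f t (x + h *: v) - f u (x + h *: v)) - (f t x - f u x)) by zmodule.
apply: (le_trans (ler_normD _ _)); rewrite lerD// (splitr d).
by apply: (le_trans (ler_normB _ _)); rewrite lerD.
Qed.

(** The mixed second increment of f in time and space is estimated by the mean
    value inequality in both variables; letting the increment of time tend to 0
    leaves the increment of ft in space. *)
Lemma schwarz (f ft fv ftv : R -> X -> E) v : jcont O ftv ->
  (forall t x, J t -> O x -> tder J (f ^~ x) t (ft t x)) ->
  (forall t x, J t -> O x -> is_ddir (f t) v x (fv t x)) ->
  (forall t x, J t -> O x -> tder J (fv ^~ x) t (ftv t x)) ->
  forall t x, J t -> O x -> is_ddir (ft t) v x (ftv t x).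
Proof.
move=> ftvc ftd fvd ftvd t x Jt Ox; apply/is_ddirP => e e0.
have /cvgrPdist_le/(_ _ e0)[[A B] /= [HA HB] HAB] := ftvc t x Jt Ox.
apply: filterS (near_segment v Ox HB) => h Hh.
have Oxh : O (x + h *: v) by have [] := Hh 1; rewrite ?ler01 ?lexx// mul1r.
apply: (@tder_bound (fun u => f u (x + h *: v) - f u x) t) => //.
  by apply: tderB; exact: ftd.
move: HA; rewrite !near_withinE => /nbhs_ballP[r /= r0 Hr].
apply/nbhs_ballP; exists r => //= u; rewrite /ball/= distrC => ut Ju.
have H : `|(f u (x + h *: v) - f t (x + h *: v)) - (f u x - f t x) -
    h *: ((u - t) *: ftv t x)| <= e * `|u - t| * `|h|.
  apply: (segment_mean_value (g := fun x => f u x - f t x)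
      (g' := fun x => fv u x - fv t x)); first by rewrite mulr_ge0// ltW.
    move=> s s01; have [_ Os] := Hh s s01.
    have /is_ddirP H1 := fvd u _ Ju Os; have /is_ddirP H2 := fvd t _ Jt Os.
    apply/is_ddirP => d d0; have d20 : 0 < d / 2 by rewrite divr_gt0.
    apply: filterS2 (H1 _ d20) (H2 _ d20) => k {}H1 {}H2.
    set y := x + _ in H1 H2 *.
    have -> : f u (y + k *: v) - f t (y + k *: v) - (f u y - f t y) - k *: (fv u y - fv t y)
      = (f u (y + k *: v) - f u y - k *: fv u y) -
        (f t (y + k *: v) - f t y - k *: fv t y) by zmodule.
    by apply: (le_trans (ler_normB _ _)); rewrite (splitr d) mulrDl lerD.
  move=> s s01; have [Bs Os] := Hh s s01.
  apply: (@mean_value_itv _ _ a b (fv ^~ (x + (s * h) *: v)) (ftv ^~ (x + (s * h) *: v))) => //.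
  - exact: ltW.
  - by move=> w Jw; exact: ftvd.
  move=> w Jw wu; rewrite distrC; apply: (HAB (w, x + (s * h) *: v)); split=> //=.
  by apply: Hr => //; rewrite /ball/= distrC (le_lt_trans wu).
rewrite scalerA mulrC -scalerA in H.
rewrite mulrAC; apply: le_trans H; rewrite le_eqVlt; apply/predU1P; left.
by congr (`|_|); zmodule.
Qed.

End up_to_the_boundary.

(** * Multilinearity of iterated derivatives *)

Section iterated_product.
Context {R : realType} {X : tvsType R}.

(** A base point followed by j directions, ((x, v_1), ...), v_j; the nesting makes
    it a pairing to append a direction. *)
Fixpoint iter_prod (j : nat) : tvsType R :=
  if j is j'.+1 then (iter_prod j' * X)%type else X.

Fixpoint base_of (j : nat) : iter_prod j -> X :=
  match j with 0 => id | j'.+1 => fun z => base_of z.1 end.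

Fixpoint dirs_of (j : nat) : iter_prod j -> seq X :=
  match j with 0 => fun _ => [::] | j'.+1 => fun z => rcons (dirs_of z.1) z.2 end.

(** The direction that moves the base point and no other component. *)
Fixpoint base_dir (j : nat) : X -> iter_prod j :=
  match j with 0 => id | j'.+1 => fun y => (base_dir j' y, 0) end.

Lemma size_dirs_of j (z : iter_prod j) : size (dirs_of z) = j.
Proof. by elim: j z => [//|j IH] z /=; rewrite size_rcons IH. Qed.

Lemma linc_base_of j : linc (@base_of j).
Proof.
elim: j => [|j IH]; first exact: linc_id.
exact: (linc_comp IH (linc_fst _ _)).
Qed.

Lemma linc_base_dir j : linc (@base_dir j).
Proof.
elim: j => [|j IH]; first exact: linc_id.
exact: (linc_pair IH (linc_cst0 _ _)).
Qed.

Lemma base_of_emb j y : base_of (base_dir j y) = y.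
Proof. by elim: j => //=. Qed.

Definition above (O : set X) j : set (iter_prod j) := [set z | O (base_of z)].

Lemma open_above (O : set X) j : open O -> open (above O (j := j)).
Proof. by move=> oO; apply: open_comp => // z _; exact: (linc_base_of j).2. Qed.

End iterated_product.

Section multilinear.
Context {R : realType} {X : tvsType R} {E : normedModType R} (O : set X) (oO : open O).
Local Notation iter_prod := (@iter_prod R X).

Let pair_shift (Y Z : tvsType R) (z w : Y) (v : Z) (h : R) :
  (z, v) + h *: (w, 0) = (z + h *: w, v).
Proof. by congr (_, _); rewrite /= scaler0 addr0. Qed.

(** Linearity in each of the j directions, over base points in O. *)
Fixpoint multilinear (j : nat) : (iter_prod j -> E) -> Prop :=
  match j with
  | 0 => fun _ => True
  | j'.+1 => fun F => (forall v, multilinear (fun z => F (z, v))) /\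
      forall z v w (c : R), O (base_of z) -> F (z, c *: v + w) = c *: F (z, v) + F (z, w)
  end.

(** The contribution of the directions to the derivative of a multilinear map: the
    sum, over all slots, of F with the entry of z in the slot replaced by that
    of w. *)
Fixpoint subst_sum (j : nat) : (iter_prod j -> E) -> iter_prod j -> iter_prod j -> E :=
  match j with
  | 0 => fun _ _ _ => 0
  | j'.+1 => fun F z w => subst_sum (fun z' => F (z', z.2)) z.1 w.1 + F (z.1, w.2)
  end.

Lemma near_above j (z w : iter_prod j) : O (base_of z) ->
  \forall h \near (0 : R), O (base_of (z + h *: w)).
Proof.
move=> Oz; have oj := @open_above R X O j oO.
have nz : nbhs z (above O (j := j)) by exact: open_nbhs_nbhs.
apply: filterS (near_segment oj w Oz nz) => h /(_ 1).
by rewrite ler01 lexx mul1r => /(_ isT) [].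
Qed.

(** Leibniz' rule; B is the contribution of the base point. *)
Lemma is_ddir_multilinear j (F : iter_prod j -> E) z w B :
  multilinear F -> O (base_of z) ->
  (forall z, O (base_of z) -> F y @[y --> z] --> F z) ->
  is_ddir F (base_dir j (base_of w)) z B -> is_ddir F w z (B + subst_sum F z w).
Proof.
elim: j F z w B => [|j IH] F z w B; first by move=> _ _ _ /=; rewrite addr0.
case: z w => [z v] [w u] /= [Fm Fl] Oz Fc Fd.
have Fvc p z' : O (base_of z') -> F (y, p) @[y --> z'] --> F (z', p).
  move=> Oz'; have i : y @[y --> z'] --> z' by exact: cvg_id.
  have c : p @[y --> z'] --> p by exact: cvg_cst.
  exact: (cvg_comp _ _ (cvg_pair i c) (Fc (z', p) Oz')).
have Fvd : is_ddir (fun z => F (z, v)) (base_dir j (base_of w)) z B.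
  move: Fd; rewrite /is_ddir; apply: cvg_trans; apply: near_eq_cvg; near=> h.
  by rewrite pair_shift.
have /is_ddirP H := IH _ z w B (Fm v) Oz (Fvc v) Fvd.
apply/is_ddirP => e e0; have e20 : 0 < e / 2 by rewrite divr_gt0.
have H1 := H _ e20.
have H2 := near_above w Oz.
have H3 : \forall h \near (0 : R), `|F (z, u) - F (z + h *: w, u)| <= e / 2.
  have /cvgrPdist_le/(_ _ e20) := Fvc u z Oz.
  move=> /(shift_cvg w (@continuous_idfun _)) [[C D] /= [HC HD] HCD].
  apply: filterS HD => h Dh; apply: (HCD ((z, w), h)); split=> //=.
  exact: nbhs_singleton HC.
apply: filterS3 H1 H2 H3 => h H1 H2 H3.
have -> : F ((z, v) + h *: (w, u)) = h *: F (z + h *: w, u) + F (z + h *: w, v).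
  by rewrite -Fl// [h *: u + v]addrC.
set S := subst_sum _ _ _ in H1 *.
have -> : h *: F (z + h *: w, u) + F (z + h *: w, v) - F (z, v) - h *: (B + (S + F (z, u))) =
   (F (z + h *: w, v) - F (z, v) - h *: (B + S)) - h *: (F (z, u) - F (z + h *: w, u)).
  by zmodule.
apply: (le_trans (ler_normB _ _)); rewrite (splitr e) mulrDl lerD//.
by rewrite normrZ mulrC ler_wpM2r.
Unshelve. all: by end_near. Qed.

(** In a base direction, difference quotients of a multilinear map are
    multilinear. *)
Lemma multilinear_ddir j (F G : iter_prod j -> E) v : multilinear F ->
  (forall z, O (base_of z) -> is_ddir F (base_dir j v) z (G z)) -> multilinear G.
Proof.
elim: j F G => [//|j IH] F G /= [Fm Fl] FG; split.
  move=> u; apply: (IH _ _ (Fm u)) => z Oz.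
  have := FG (z, u) Oz; rewrite /is_ddir; apply: cvg_trans; apply: near_eq_cvg; near=> h.
  by rewrite pair_shift.
move=> z u w c Oz.
apply: (is_ddir_unique (FG (z, c *: u + w) Oz)); apply/is_ddirP => e e0.
have c1 : 0 < `|c| + 1 by rewrite ltr_wpDl.
have e1 : 0 < e / 2 / (`|c| + 1) by rewrite !divr_gt0.
have e20 : 0 < e / 2 by rewrite divr_gt0.
have /is_ddirP/(_ _ e1) H1 := FG (z, u) Oz.
have /is_ddirP/(_ _ e20) H2 := FG (z, w) Oz.
apply: filterS3 H1 H2 (near_above (base_dir j v) Oz) => h H1 H2 Oh.
move: H1 H2; rewrite /= !pair_shift !Fl// => H1 H2.
set F1 := F (_, u) in H1 *; set F2 := F (_, w) in H2 *.
have -> : c *: F1 + F2 - (c *: F (z, u) + F (z, w)) - h *: (c *: G (z, u) + G (z, w)) =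
  c *: (F1 - F (z, u) - h *: G (z, u)) + (F2 - F (z, w) - h *: G (z, w)).
  have -> : h *: (c *: G (z, u) + G (z, w)) = c *: (h *: G (z, u)) + h *: G (z, w).
    by rewrite scalerDr !scalerA mulrC.
  by zmodule.
apply: (le_trans (ler_normD _ _)); rewrite (splitr e) mulrDl lerD// normrZ.
apply: (@le_trans _ _ ((`|c| + 1) * (e / 2 / (`|c| + 1) * `|h|))).
  by rewrite ler_pM// lerDl.
by rewrite mulrA [(_ + 1) * _]mulrC divfK// gt_eqF.
Unshelve. all: by end_near. Qed.

Context (a b : R).
Local Notation J := (`[a, b]%classic : set R).
Local Notation mixedC := (@mixedC R a b).
Local Notation jcont := (@jcont R a b).

(** The recursion that defines [subst_sum] fixes the last direction of z, which
    has to be carried along as a parameter. *)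
Let mixedC_subst_sum_param j (V : tvsType R) m r (f : R -> (iter_prod j * V)%type -> E) :
  mixedC m r (above O (j := j) `*` setT) f ->
  mixedC m r ((above O (j := j) `*` setT) `*` setT)
    (fun t (q : ((iter_prod j * iter_prod j) * V)%type) =>
       subst_sum (fun z => f t (z, q.2)) q.1.1 q.1.2).
Proof.
elim: j V f => [|j IH] V f fC /=; first by apply: mixedC_linc; exact: linc_cst0.
have lf := @linc_fst R; have ls := @linc_snd R.
pose f' t (p : (iter_prod j * (X * V))%type) := f t ((p.1, p.2.1), p.2.2).
have f'C : mixedC m r (above O (j := j) `*` setT) f'.
  apply: (mixedC_inner (l := fun p : iter_prod j * (X * V) => ((p.1, p.2.1), p.2.2))) fC.
    apply: linc_pair; last exact: (linc_comp (ls _ _) (ls _ _)).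
    by apply: linc_pair => //; exact: (linc_comp (lf _ _) (ls _ _)).
  by move=> [z p] [].
have := IH _ f' f'C => {}IH; apply: mixedC_add.
  apply: (mixedC_inner (O := (above O (j := j) `*` setT) `*` setT)
    (l := fun q : ((iter_prod j * X) * (iter_prod j * X)) * V =>
      ((q.1.1.1, q.1.2.1), (q.1.1.2, q.2)))
    (f := fun t q => subst_sum (fun z => f' t (z, q.2)) q.1.1 q.1.2)) IH.
    have l1 := linc_comp (lf (iter_prod j * X)%type (iter_prod j * X)%type)
      (lf ((iter_prod j * X) * (iter_prod j * X))%type V).
    have l2 := linc_comp (ls (iter_prod j * X)%type (iter_prod j * X)%type)
      (lf ((iter_prod j * X) * (iter_prod j * X))%type V).
    apply: linc_pair.
      by apply: linc_pair; [exact: (linc_comp (lf _ _) l1)|exact: (linc_comp (lf _ _) l2)].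
    by apply: linc_pair => //; exact: (linc_comp (ls _ _) l1).
  by move=> [[[z v] [w u]] p] [[/= Oz _] _].
apply: (mixedC_inner
  (l := fun q : ((iter_prod j * X) * (iter_prod j * X)) * V => ((q.1.1.1, q.1.2.2), q.2))) fC.
  have l1 := linc_comp (lf (iter_prod j * X)%type (iter_prod j * X)%type)
    (lf ((iter_prod j * X) * (iter_prod j * X))%type V).
  have l2 := linc_comp (ls (iter_prod j * X)%type (iter_prod j * X)%type)
    (lf ((iter_prod j * X) * (iter_prod j * X))%type V).
  apply: linc_pair => //.
  by apply: linc_pair; [exact: (linc_comp (lf _ _) l1)|exact: (linc_comp (ls _ _) l2)].
by move=> [[[z v] [w u]] p] [[/= Oz _] _].
Qed.

Lemma mixedC_subst_sum j m r (f : R -> iter_prod j -> E) :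
  mixedC m r (above O (j := j)) f ->
  mixedC m r (above O (j := j) `*` setT)
    (fun t (q : (iter_prod j * iter_prod j)%type) => subst_sum (f t) q.1 q.2).
Proof.
move=> fC.
have f'C : mixedC m r (above O (j := j) `*` setT) (fun t (p : (iter_prod j * X)%type) => f t p.1).
  by apply: mixedC_inner fC; [exact: linc_fst|move=> p []].
apply: (mixedC_inner (l := fun q : iter_prod j * iter_prod j => (q, 0 : X)))
  (mixedC_subst_sum_param f'C).
  by apply: linc_pair; [exact: linc_id|exact: linc_cst0].
by move=> q [].
Qed.

End multilinear.

(** In this section h i j is the i-th time derivative of the j-th derivative in
    space of h 0 0, with the directions of the latter as arguments; as in
    [dij], space is differentiated before time. *)
Section jets.
Context {R : realType} {X : tvsType R} {E : normedModType R} (O : set X) (oO : open O).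
Context (a b : R) (ab : a < b).
Local Notation J := (`[a, b]%classic : set R).
Local Notation mixedC := (@mixedC R a b).
Local Notation jcont := (@jcont R a b).
Local Notation iter_prod := (@iter_prod R X).

Lemma is_ddirZ (Y : tvsType R) (g : Y -> E) v x l c :
  is_ddir g v x l -> is_ddir g (c *: v) x (c *: l).
Proof.
move=> /is_ddirP H; apply/is_ddirP => e e0.
have c1 : 0 < `|c| + 1 by rewrite ltr_wpDl.
have e1 : 0 < e / (`|c| + 1) by rewrite divr_gt0.
have /nbhs_ballP[r /= r0 Hr] := H _ e1.
apply/nbhs_ballP; exists (r / (`|c| + 1)) => /=; first by rewrite divr_gt0.
move=> h; rewrite /ball/= sub0r normrN ltr_pdivlMr// => hr.
have hb : `|h * c| <= `|h| * (`|c| + 1) by rewrite normrM ler_wpM2l// lerDl.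
have := Hr (h * c); rewrite /ball/= sub0r normrN => /(_ (le_lt_trans hb hr)).
rewrite !scalerA => /le_trans; apply.
rewrite -mulrA [_^-1 * _]mulrC mulrA ler_pdivrMr// -mulrA ler_wpM2l//; exact: ltW.
Qed.

Context (r k : nat) (h : forall i j : nat, R -> iter_prod j -> E).
Hypotheses
  (hc : forall i j, (i <= r)%N -> (j <= k)%N -> jcont (above O (j := j)) (h i (j := j)))
  (ht : forall i j, (i < r)%N -> (j <= k)%N -> forall t z, J t -> O (base_of z) ->
     tder J (fun u => h i u z) t (h i.+1 (j := j) t z))
  (hy0 : forall j, (j < k)%N -> forall t z y, J t -> O (base_of z) ->
     is_ddir (h 0 t) (base_dir j y) z (h 0 (j := j.+1) t (z, y))).

(** Space derivatives pass all time derivatives by Schwarz's theorem. *)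
Lemma jets_ddir i j t z y : (i <= r)%N -> (j < k)%N -> J t -> O (base_of z) ->
  is_ddir (h i t) (base_dir j y) z (h i (j := j.+1) t (z, y)).
Proof.
elim: i t z => [|i IH] t z ir jk Jt Oz; first exact: hy0.
have oj := @open_above R X O j oO.
apply: (@schwarz R E a b ab (iter_prod j) (above O (j := j)) oj (h i (j := j)) (h i.+1 (j := j))
  (fun t z => h i (j := j.+1) t (z, y)) (fun t z => h i.+1 (j := j.+1) t (z, y))) => //.
- apply: (jcont_inner (l := fun z : iter_prod j => (z, y))) (hc ir jk) => //.
  move=> w; have c1 : p @[p --> w] --> w by exact: cvg_id.
  have c2 : y @[p --> w] --> y by exact: cvg_cst.
  exact: (cvg_pair c1 c2).
- by move=> u w Ju Ow; apply: ht => //; exact: ltnW.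
- by move=> u w Ju Ow; apply: IH => //; exact: ltnW.
by move=> u w Ju Ow; apply: ht.
Qed.

(** The last direction enters linearly because a continuous directional
    derivative is additive in the direction, the other ones because a derivative
    of a multilinear map is multilinear. *)
Lemma jets_multilinear i j t : (i <= r)%N -> (j <= k)%N -> J t ->
  multilinear O (h i (j := j) t).
Proof.
move=> ir; elim: j => [//|j IH] jk Jt; have {}IH := IH (ltnW jk) Jt; split.
  move=> v; apply: (multilinear_ddir oO IH (v := v)) => z Oz.
  exact: jets_ddir.
move=> z v w c Oz.
have oj := @open_above R X O j oO; have le := linc_base_dir (X := X) j.
have hZ p : h i (j := j.+1) t (z, c *: p) = c *: h i (j := j.+1) t (z, p).
  have H := @jets_ddir i j t z (c *: p) ir jk Jt Oz.
  apply: is_ddir_unique H _.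
  by rewrite (lincZ _ _ le); apply: is_ddirZ; exact: jets_ddir.
rewrite -hZ; move: (c *: v) => {}v.
apply: (is_ddir_unique (@jets_ddir i j t z (v + w) ir jk Jt Oz)); apply/is_ddirP => e e0.
have e20 : 0 < e / 2 by rewrite divr_gt0.
have d t' z' v' : J t' -> above O (j := j) z' ->
    is_ddir (h i t') (base_dir j v') z' (h i (j := j.+1) t' (z', v')).
  by move=> Jt' Oz'; exact: jets_ddir.
have hc' : jcont (above O (j := j) `*` setT) (h i (j := j.+1)).
  by move=> t' z' Jt' [Oz' _]; exact: (hc ir jk).
have [[A B] /= [HA HB] HAB] := diff_quotient w oj le.2 d hc' Jt Oz e20.
have At : A t by apply: (nbhs_singleton HA).
have /is_ddirP/(_ _ e20) H1 := @jets_ddir i j t z v ir jk Jt Oz.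
have H2 : \forall s \near (0 : R), B ((z + s *: base_dir j v, w), s).
  have c1 : z + s *: base_dir j v @[s --> (0 : R)] --> z.
    have i1 : z @[s --> (0 : R)] --> z by exact: cvg_cst.
    have i2 : v @[s --> (0 : R)] --> v by exact: cvg_cst.
    have i3 : s @[s --> (0 : R)] --> (0 : R) by exact: cvg_id.
    have i4 : ((z, v), s) @[s --> (0 : R)] --> ((z, v), (0 : R)).
      exact: (cvg_pair (cvg_pair i1 i2) i3).
    exact: (cvg_comp _ _ i4 (shift_cvg v le.2)).
  have c2 : w @[s --> (0 : R)] --> w by exact: cvg_cst.
  have c3 : s @[s --> (0 : R)] --> (0 : R) by exact: cvg_id.
  have c4 : ((z + s *: base_dir j v, w), s) @[s --> (0 : R)] --> ((z, w), (0 : R)).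
    exact: (cvg_pair (cvg_pair c1 c2) c3).
  exact: (c4 _ HB).
apply: filterS2 H1 H2 => s H1 Bs.
have := HAB (t, ((z + s *: base_dir j v, w), s)); move=> /(_ (conj At Bs)) /= H2.
rewrite (lincD _ _ le) [s *: (_ + _)]scalerDr addrA.
set F2 := h i t (_ + _ + _) in H2 *; set F1 := h i t (z + _) in H1 H2.
set Gv := h i (j := j.+1) t (z, v) in H1 *; set Gw := h i (j := j.+1) t (z, w) in H2 *.
have -> : F2 - h i t z - s *: (Gv + Gw) =
  (F2 - F1 - s *: Gw) + (F1 - h i t z - s *: Gv) by zmodule.
by apply: (le_trans (ler_normD _ _)); rewrite (splitr e) mulrDl lerD.
Qed.

(** By Leibniz' rule the differential of h i j is a sum of terms of the same form:
    h i (j + 1) in the direction of the base point, and h i j with one of the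
    directions replaced. *)
Lemma jets_mixedC m i j : (i <= r)%N -> (j + m <= k)%N ->
  mixedC m (r - i) (above O (j := j)) (h i (j := j)).
Proof.
elim: m i j => [|m IH] i j ir jmk.
  by split=> //; apply: hc => //; rewrite addn0 in jmk.
have jk : (j < k)%N by apply: leq_trans jmk; rewrite addnS ltnS leq_addr.
split; first exact: hc (ltnW jk).
split.
  exists (fun t q => h i (j := j.+1) t (q.1, base_of q.2) + subst_sum (h i (j := j) t) q.1 q.2).
  split.
    move=> t z w Jt Oz; apply: (is_ddir_multilinear oO) => //.
    - by apply: jets_multilinear => //; exact: ltnW.
    - move=> y Oy; have cy : (t, p) @[p --> y] --> filter_prod (within J (nbhs t)) (nbhs y).
        have i1 : t @[p --> y] --> within J (nbhs t).
          move=> P; rewrite /within/= => /nbhs_singleton/(_ Jt) Pt.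
          exact: (@filterE _ (nbhs y) _ (fun=> P t) (fun=> Pt)).
        have i2 : p @[p --> y] --> y by exact: cvg_id.
        exact: (cvg_pair i1 i2).
      exact: (cvg_comp _ _ cy (hc ir (ltnW jk) Jt Oy)).
    exact: jets_ddir.
  apply: mixedC_add.
    apply: (mixedC_inner (l := fun q : iter_prod j * iter_prod j => (q.1, base_of q.2)))
        (IH i j.+1 ir _).
    - apply: linc_pair; first exact: linc_fst.
      exact: (linc_comp (linc_base_of j) (linc_snd _ _)).
    - by move=> q [].
    - by rewrite addSnnS.
  by apply: mixedC_subst_sum; apply: IH => //; rewrite addnS in jmk; exact: ltnW.
case E1 : (r - i)%N => [//|r'].
have ir' : (i < r)%N by rewrite -subn_gt0 E1.
exists (h i.+1 (j := j)); split; first by move=> t z Jt Oz; apply: ht => //; exact: ltnW.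
have -> : r' = (r - i.+1)%N by rewrite subnS E1.
by apply: IH => //; rewrite addnS in jmk; exact: ltnW.
Qed.

End jets.

(** * From iterated directional derivatives to the mixed class *)

Section pointwise_topology.

Lemma ptws_cvg {T I : Type} {Y : topologicalType} (F : set_system T) {FF : Filter F}
    (g : T -> {ptws I -> Y}) (p : {ptws I -> Y}) :
  (forall i, g x i @[x --> F] --> p i) -> g x @[x --> F] --> p.
Proof.
move=> H; apply/cvg_sup => i A; rewrite nbhsE => -[B [[C oC <-] Cp] BA].
have nC : nbhs (p i) C by apply: open_nbhs_nbhs.
apply: (@filterS _ (g x @[x --> F]) _ (@^~ i @^-1` C)) => //.
exact: (H i C nC).
Qed.

Lemma ptws_eval {I : eqType} {Y : topologicalType} (i : I) :
  continuous (fun p : {ptws I -> Y} => p i).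
Proof. exact: (@proj_continuous I (fun=> Y) i). Qed.

Lemma cvg_within_app {T U : Type} (F : set_system T) {FF : Filter F} (G : set_system U)
    (A : set U) (f : T -> U) :
  f x @[x --> F] `=>` G -> (\forall x \near F, A (f x)) -> f x @[x --> F] `=>` within A G.
Proof.
move=> fG fA P; rewrite /within/= => /fG GP.
by apply: (@filterS2 _ F FF _ _ _ _ GP fA) => x; exact.
Qed.

End pointwise_topology.

Section iterated_derivatives.
Context {R : realType} {V : tvsType R} {E : normedModType R}.

Lemma ddirP (f : V -> E) v z :
  (exists l, is_ddir f v z l) -> is_ddir f v z (ddir f v z).
Proof. by move=> [l fl]; rewrite /ddir; apply: (xgetPex 0); exists l. Qed.

Lemma iter_ddir_rcons (f : V -> E) hs v :
  iter_ddir f (rcons hs v) = ddir (iter_ddir f hs) v.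
Proof. by rewrite /iter_ddir -cats1 foldl_cat. Qed.

Lemma ex_iter_ddir_rcons (W : set V) (f : V -> E) hs v z :
  ex_iter_ddir W f (rcons hs v) -> W z ->
  is_ddir (iter_ddir f hs) v z (iter_ddir f (rcons hs v) z).
Proof.
rewrite iter_ddir_rcons => H Wz; elim: hs f H => [|w hs IH] f /= [exf exhs].
  exact/ddirP/exf.
exact: IH.
Qed.

End iterated_derivatives.

Section class_of_data.
Context {R : realType} {X : tvsType R} {E : normedModType R} (O : set X) (oO : open O).
Context (a b : R) (ab : a < b) (Jb : set R).
Local Notation J := (`[a, b]%classic : set R).
Local Notation jcont := (@jcont R a b).
Hypothesis JJb : J `<=` Jb.
Context (f : (R * X)%type -> E) (r k : enat) (fC : CRS r k Jb O f).
Context (r0 k0 : nat) (r0r : le_enat r0 r) (k0k : le_enat k0 k).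

Let le_trans_enat i n (m : enat) : (i <= n)%N -> le_enat n m -> le_enat i m.
Proof. by case: m => //= m; exact: leq_trans. Qed.

Let in_interior t x : a < t < b -> O x -> (Jb° `*` O°) (t, x).
Proof.
move=> tab Ox; split=> /=; last by move/interior_id: oO => ->.
have tI : t \in `]a, b[ by rewrite in_itv.
apply: filterS (near_in_itvoo tI) => u uab; apply: JJb.
by rewrite /=; exact: subset_itv_oo_cc.
Qed.

Let extension i j (ij : (i <= r0)%N /\ (j <= k0)%N) :
  exists g : ((R * X) * ({ptws 'I_i -> R} * {ptws 'I_j -> X}))%type -> E,
      [/\ {within (Jb `*` O) `*` setT, continuous g},
          {in (Jb° `*` O°) `*` setT, g =1 @dij _ _ _ _ i j f} &
          (i = 0 -> j = 0 -> {in (Jb `*` O) `*` setT, forall q, g q = f q.1})%N].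
Proof. by apply: fC.2; [exact: le_trans_enat ij.1 r0r|exact: le_trans_enat ij.2 k0k]. Qed.

Let ext i j : ((R * X) * ({ptws 'I_i -> R} * {ptws 'I_j -> X}))%type -> E :=
  if pselect ((i <= r0)%N /\ (j <= k0)%N) is left ij then sval (cid (extension ij))
  else fun=> 0.

Let extP i j : (i <= r0)%N -> (j <= k0)%N ->
      [/\ {within (Jb `*` O) `*` setT, continuous (@ext i j)},
          {in (Jb° `*` O°) `*` setT, @ext i j =1 @dij _ _ _ _ i j f} &
          (i = 0 -> j = 0 -> {in (Jb `*` O) `*` setT, forall q, @ext i j q = f q.1})%N].
Proof.
move=> ir jk; rewrite /ext; case: pselect => [ij|]; last by case.
by case: (cid _).
Qed.

Let dirsv j (z : @iter_prod R X j) : {ptws 'I_j -> X} := fun i => nth 0 (dirs_of z) i.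

Let dirsv_continuous j : continuous (@dirsv j).
Proof.
move=> z; apply: ptws_cvg => -[i ij]; rewrite /dirsv /=.
elim: j z i ij => [//|j IH] z i ij /=.
move: (ij); rewrite ltnS leq_eqVlt => /predU1P[->|ij'].
  have E1 (x : iter_prod j.+1) : nth 0 (rcons (dirs_of x.1) x.2) j = x.2.
    by rewrite nth_rcons size_dirs_of ltnn eqxx.
  rewrite E1; under eq_fun do rewrite E1; exact: cvg_snd.
have E1 (x : iter_prod j.+1) : nth 0 (rcons (dirs_of x.1) x.2) i = nth 0 (dirs_of x.1) i.
  by rewrite nth_rcons size_dirs_of ij'.
rewrite E1; under eq_fun do rewrite E1.
have c1 : x.1 @[x --> z] --> z.1 by exact: cvg_fst.
exact: (cvg_comp _ _ c1 (IH z.1 i ij')).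
Qed.

Let h i j t (z : @iter_prod R X j) : E :=
  @ext i j ((t, base_of z), ((fun=> 1), dirsv z)).

(* The iterated derivative with the directions as a list, which makes it easy to
   append one more. *)
Let D i (s : seq X) : (R * X)%type -> E :=
  iter_ddir f ([seq (0, y) | y <- s] ++ nseq i (1, 0)).

Let hD i j t (z : @iter_prod R X j) : (i <= r0)%N -> (j <= k0)%N -> a < t < b -> O (base_of z) ->
  h i t z = D i (dirs_of z) (t, base_of z).
Proof.
move=> ir jk tab Oz; have [_ H _] := extP ir jk; rewrite /h H; last first.
  by rewrite inE; split=> //; exact: in_interior.
rewrite /dij /D /= /dirs; congr (iter_ddir f (_ ++ _) _).
  rewrite /dirsv -[in RHS](mkseq_nth 0 (dirs_of z)) size_dirs_of /mkseq -val_enum_ord -!map_comp.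
  by [].
by rewrite -[in RHS](card_ord i) cardE; elim: (enum _) => //= ? ? ->.
Qed.

Let exD i (s : seq X) : (i <= r0)%N -> (size s <= k0)%N ->
  ex_iter_ddir (Jb° `*` O°) f ([seq (0, y) | y <- s] ++ nseq i (1, 0)).
Proof.
move=> ir jk; have [] := fC.1 i (size s) (le_trans_enat ir r0r) (le_trans_enat jk k0k).
move=> /(_ (fun=> 1) (fun b => nth 0 s b)) + _.
rewrite /dirs; congr (ex_iter_ddir _ f (_ ++ _)).
  rewrite -[in RHS](mkseq_nth 0 s) /mkseq -val_enum_ord -!map_comp //.
by rewrite -[in RHS](card_ord i) cardE; elim: (enum _) => //= ? ? ->.
Qed.

Let h_cont i j : (i <= r0)%N -> (j <= k0)%N -> jcont (above O (j := j)) (h i (j := j)).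
Proof.
move=> ir jk t z Jt Oz; have [/subspace_continuousP H _ _] := extP ir jk.
have Q : ((Jb `*` O) `*` [set: {ptws 'I_i -> R} * {ptws 'I_j -> X}])
    ((t, base_of z), ((fun=> 1), dirsv z)) by split=> //; split=> //; exact: JJb.
apply: (cvg_comp _ _ _ (H _ Q)); apply: cvg_within_app.
  have f1 : q.1 @[q --> filter_prod (within J (nbhs t)) (nbhs z)] --> t.
    have f0 : q.1 @[q --> filter_prod (within J (nbhs t)) (nbhs z)] --> within J (nbhs t).
      exact: cvg_fst.
    by move=> P nP; apply: (f0 P); exact: (@near_withinW _ _ (nbhs t) _ _ nP).
  have f2 : q.2 @[q --> filter_prod (within J (nbhs t)) (nbhs z)] --> z by exact: cvg_snd.
  have f3 : base_of q.2 @[q --> filter_prod (within J (nbhs t)) (nbhs z)] --> base_of z.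
    exact: (cvg_comp _ _ f2 ((linc_base_of j).2 z)).
  have f4 : dirsv q.2 @[q --> filter_prod (within J (nbhs t)) (nbhs z)] --> dirsv z.
    exact: (cvg_comp _ _ f2 (@dirsv_continuous j z)).
  pose one : {ptws 'I_i -> R} := fun=> 1.
  have f5 : one @[q --> filter_prod (within J (nbhs t)) (nbhs z)] --> one.
    exact: cvg_cst.
  have f6 : (q.1, base_of q.2) @[q --> filter_prod (within J (nbhs t)) (nbhs z)] -->
    (t, base_of z) by exact: (cvg_pair f1 f3).
  have f7 : (one, dirsv q.2) @[q --> filter_prod (within J (nbhs t)) (nbhs z)] -->
    (one, dirsv z) by exact: (cvg_pair f5 f4).
  exact: (cvg_pair f6 f7).
exists (J, above O (j := j)) => /=.
  by split; [exact: withinT|apply: open_nbhs_nbhs; split => //; exact: open_above].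
by move=> [u w] /= [Ju Ow]; split=> //; split=> //; exact: JJb.
Qed.

Let h_slice i j t (z : @iter_prod R X j) : (i <= r0)%N -> (j <= k0)%N -> J t -> O (base_of z) ->
  h i u z @[u --> within J (nbhs t)] --> h i t z.
Proof. by move=> ir jk Jt Oz; apply: jcont_slice (h_cont ir jk) Jt Oz. Qed.

Let h_time i j : (i < r0)%N -> (j <= k0)%N -> forall t z, J t -> O (base_of z) ->
     tder J (fun u => h i u z) t (h i.+1 (j := j) t z).
Proof.
move=> ir jk t z Jt Oz.
apply: (@tder_boundary R E a b (fun u => h i u z) (fun u => h i.+1 u z)) => //.
- by move=> u Ju; apply: h_slice => //; exact: ltnW.
- by move=> u Ju; apply: h_slice.
move=> u uab; rewrite (hD ir jk uab Oz).
have szk : (size (dirs_of z) <= k0)%N by rewrite size_dirs_of.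
have uz : (Jb° `*` O°) (u, base_of z) by exact: in_interior.
have eD : [seq (0, y) | y <- dirs_of z] ++ nseq i.+1 (1, 0) =
   rcons ([seq (0, y) | y <- dirs_of z] ++ nseq i (1, 0)) ((1, 0) : R * X).
  by rewrite rcons_cat; congr (_ ++ _); elim: (i) => //= n ->.
have := exD ir szk; rewrite eD => /ex_iter_ddir_rcons/(_ uz).
rewrite -eD -/(D i (dirs_of z)) -/(D i.+1 (dirs_of z)) => /is_ddirP H.
apply/tderP => e e0; apply: near_withinW; have /nbhs_ballP[d /= d0 Hd] := H _ e0.
have uI : u \in `]a, b[ by rewrite in_itv.
have nu : \forall w \near nbhs u, `|w - u| < d.
  by apply/nbhs_ballP; exists d => //= w; rewrite /ball/= distrC.
apply: filterS2 (near_in_itvoo uI) nu => w; rewrite in_itv/= => wab wd.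
rewrite (hD (ltnW ir) jk wab Oz) (hD (ltnW ir) jk uab Oz).
have := Hd (w - u); rewrite /ball/= sub0r normrN => /(_ wd).
congr (`|D i _ _ - _ - _| <= _).
by congr (_, _); rewrite /= ?scaler0 ?addr0// [_ *: _]mulr1 addrC subrK.
Qed.

Let h_space j : (j < k0)%N -> forall t z y, J t -> O (base_of z) ->
     is_ddir (h 0 t) (base_dir j y) z (h 0 (j := j.+1) t (z, y)).
Proof.
move=> jk t z y Jt Oz; have oj := @open_above R X O j oO.
apply: (@ddir_boundary R E a b ab (iter_prod j) (above O (j := j)) oj (h 0 (j := j))
  (fun t z => h 0 (j := j.+1) t (z, y))) => //.
- by apply: h_cont => //; exact: ltnW.
- apply: (jcont_inner (l := fun z : iter_prod j => (z, y))) (h_cont (leq0n r0) jk) => //.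
  move=> w; have c1 : p @[p --> w] --> w by exact: cvg_id.
  have c2 : y @[p --> w] --> y by exact: cvg_cst.
  exact: (cvg_pair c1 c2).
move=> {Jt}t {Oz}z tab Oz; rewrite (@hD 0 j.+1 t (z, y) (leq0n r0) jk tab Oz).
have szk : (size (rcons (dirs_of z) y) <= k0)%N by rewrite size_rcons size_dirs_of.
have tz : (Jb° `*` O°) (t, base_of z) by exact: in_interior.
have := exD (leq0n r0) szk; rewrite /D /= !cats0 map_rcons => /ex_iter_ddir_rcons/(_ tz).
move=> /is_ddirP H; apply/is_ddirP => e e0.
apply: filterS2 (near_above oO (base_dir j y) Oz) (H _ e0) => s Os.
rewrite (hD (leq0n r0) (ltnW jk) tab Os) (hD (leq0n r0) (ltnW jk) tab Oz) /D /= !cats0.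
have -> : dirs_of (z + s *: base_dir j y) = dirs_of z.
  elim: (j) z {Os Oz tz H szk} => [//|n IH] [z v] /=.
  by rewrite scaler0 addr0 IH.
have le := linc_base_of (X := X) j.
rewrite (lincD _ _ le) (lincZ _ _ le) base_of_emb.
congr (`|iter_ddir _ _ _ - _ - _| <= _).
by congr (_, _); rewrite /= scaler0 addr0.
Qed.

(** On a compact interval in the time domain, a map of class C^{r,k} has all mixed
    derivatives in any order, also at the ends of the interval, where the
    definition of that class provides only continuous extensions. *)
Lemma CRS_mixedC : mixedC a b k0 r0 O (fun t x => f (t, x)).
Proof.
have := @jets_mixedC R X E O oO a b ab r0 k0 h h_cont h_time h_space k0 0 0 (leq0n _).
rewrite add0n subn0 => /(_ (leqnn _)); apply: mixedC_eq => // t x Jt Ox.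
have [_ _ /(_ erefl erefl) H] := extP (leq0n r0) (leq0n k0).
rewrite /h H// inE; split=> //; split=> //; exact: JJb.
Qed.

End class_of_data.

(** * Iterated directional derivatives of solutions *)

Section derivative_chains.
Context {R : realType} {V : tvsType R} {E : normedModType R}.

(** F is an iterated derivative of f along hs on W.  The intermediate derivatives
    are explicit functions, known on W only, in contrast with [iter_ddir], which
    fixes them everywhere. *)
Fixpoint chain (W : set V) (f : V -> E) (hs : seq V) (F : V -> E) : Prop :=
  if hs is v :: hs' then exists f' : V -> E,
    (forall z, W z -> is_ddir f v z (f' z)) /\ chain W f' hs' F
  else forall z, W z -> f z = F z.

Lemma is_ddir_eq (W : set V) (f g : V -> E) v z l : open W -> W z ->
  (forall z, W z -> f z = g z) -> is_ddir f v z l -> is_ddir g v z l.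
Proof.
move=> oW Wz fg /is_ddirP H; apply/is_ddirP => e e0.
have nW : nbhs z W by exact: open_nbhs_nbhs.
apply: filterS2 (near_segment oW v Wz nW) (H e e0) => h /(_ 1).
by rewrite ler01 lexx mul1r => /(_ isT) [_ Wh]; rewrite !fg.
Qed.

Lemma chain_eq (W : set V) (f g : V -> E) hs F : open W ->
  (forall z, W z -> f z = g z) -> chain W f hs F -> chain W g hs F.
Proof.
move=> oW fg; case: hs => [|v hs] /=.
  by move=> H z Wz; rewrite -fg// H.
move=> [f' [fd ch]]; exists f'; split=> // z Wz.
by apply: (is_ddir_eq oW Wz fg); exact: fd.
Qed.

Lemma chain_cat (W : set V) (f : V -> E) hs1 hs2 F G : open W ->
  chain W f hs1 G -> chain W G hs2 F -> chain W f (hs1 ++ hs2) F.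
Proof.
move=> oW; elim: hs1 f => [|v hs IH] f /=.
  by move=> fG; apply: chain_eq => // z Wz; rewrite fG.
by move=> [f' [fd ch]] chG; exists f'; split=> //; exact: IH.
Qed.

Lemma chain_iter_ddir (W : set V) (f : V -> E) hs F : open W -> chain W f hs F ->
  ex_iter_ddir W f hs /\ forall z, W z -> iter_ddir f hs z = F z.
Proof.
move=> oW; elim: hs f => [|v hs IH] f //= [f' [fd ch]].
have ff' z : W z -> f' z = ddir f v z.
  move=> Wz; apply: (is_ddir_unique (fd z Wz)); apply: ddirP; exists (f' z); exact: fd.
have [ex it] := IH _ (chain_eq oW ff' ch).
by split=> //; split=> // z Wz; exists (f' z); exact: fd.
Qed.

End derivative_chains.

Section solutions_are_CRS.
Context {R : realType} {E : completeNormedModType R} (a b : R).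
Local Notation J := (`[a, b]%classic : set R).
Local Notation mixedC := (@mixedC R a b).
Local Notation jcont := (@jcont R a b).
Local Notation solutionC := (@solutionC R E a b).

(** Differentiating in x with v fixed is differentiating in (x, v) along (u, 0). *)
Lemma chain_slice (X : tvsType R) (W : set (R * X)) (W' : set (R * (X * X)))
    (f F : (R * (X * X))%type -> E) (v : X) us :
  (forall z, W z -> W' (z.1, (z.2, v))) ->
  chain W' f [seq (0, (u, 0)) | u <- us] F ->
  chain W (fun z => f (z.1, (z.2, v))) [seq (0, u) | u <- us] (fun z => F (z.1, (z.2, v))).
Proof.
move=> WW; elim: us f => [|u us IH] f /=.
  by move=> fF z Wz; apply: fF; exact: WW.
move=> [f' [fd ch]]; exists (fun z => f' (z.1, (z.2, v))); split; last exact: IH.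
move=> [t x] Wz; have /is_ddirP H := fd _ (WW _ Wz).
apply/is_ddirP => e e0; apply: filterS (H e e0) => h.
congr (`|f _ - _ - _| <= _).
by congr (_, (_, _)); rewrite /= scaler0 addr0.
Qed.

Lemma time_derivatives (X : tvsType R) (O : set X) k r (g : R -> X -> E) :
  mixedC k r O g -> (r <= k)%N -> exists G : nat -> R -> X -> E,
    [/\ G 0%N = g, forall i, (i <= r)%N -> jcont O (G i) &
      forall i t x, (i < r)%N -> J t -> O x -> tder J (G i ^~ x) t (G i.+1 t x)].
Proof.
elim: r k g => [|r IH] [|k] g gC // rk.
- by exists (fun=> g); split=> // i _; exact: mixedC_cont gC.
- by exists (fun=> g); split=> // i _; exact: mixedC_cont gC.
have [gc [_ [gt [gtd gtC]]]] := gC.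
have [G [G0 Gc Gd]] := IH k gt gtC rk.
exists (fun i => if i is i'.+1 then G i' else g); split=> //.
  by case.
by case=> [|i] t x ir Jt Ox; [rewrite G0; exact: gtd|exact: Gd].
Qed.

Lemma open_JO (X : tvsType R) (O : set X) : open O -> open (J° `*` O).
Proof. by move=> oO; apply: open_setX => //; exact: open_interior. Qed.

(** Y i is the i-th time derivative of the j-th derivative in space, the directions
    being an argument.  The first derivative in space is dy, and the remaining
    ones are derivatives of dy on the tangent space along (u, 0). *)
Lemma solution_derivatives j (X : tvsType R) (O : set X) k r (y : R -> X -> E) :
  open O -> solutionC k r O y -> (j + r <= k)%N ->
  exists Y : nat -> R -> (X * {ptws 'I_j -> X})%type -> E,
  [/\ forall v : {ptws 'I_j -> X}, chain (J° `*` O) (fun z => y z.1 z.2)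
        [seq (0, v c) | c <- enum 'I_j] (fun z => Y 0%N z.1 (z.2, v)),
      forall i, (i <= r.+1)%N -> jcont (O `*` setT) (Y i),
      forall i t x v, (i <= r)%N -> J t -> O x ->
        tder J (fun u => Y i u (x, v)) t (Y i.+1 t (x, v)) &
      j = 0%N -> forall t x v, Y 0%N t (x, v) = y t x].
Proof.
elim: j X O k r y => [|j IH] X O k r y oO.
  case: k => [|k].
    move=> [yc [yt [ytd [ytc _]]] _]; rewrite add0n leqn0 => /eqP ->.
    exists (fun i t q => if i is _.+1 then yt t q.1 else y t q.1); split.
    - by move=> v; rewrite enum_ord0.
    - have fc : continuous (@fst X {ptws 'I_0 -> X}) by move=> q; exact: cvg_fst.
      by case=> [|i] _; [apply: (jcont_inner fc _ yc)|apply: (jcont_inner fc _ ytc)] => q [].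
    - by move=> [|i] t x v //= _ Jt Ox; exact: ytd.
    - by [].
  move=> [yc [yt [ytd ytC]] _] rk.
  have [G [G0 Gc Gd]] := time_derivatives ytC rk.
  exists (fun i t q => if i is i'.+1 then G i' t q.1 else y t q.1); split.
  - by move=> v; rewrite enum_ord0.
  - have fc : continuous (@fst X {ptws 'I_0 -> X}) by move=> q; exact: cvg_fst.
    by case=> [|i] ir; [apply: (jcont_inner fc _ yc)|apply: (jcont_inner fc _ (Gc i ir))] => q [].
  - by move=> [|i] t x v ir Jt Ox; [rewrite /= G0; exact: ytd|exact: Gd].
  - by [].
case: k => [//|k] [yc [yt [ytd ytC]] [dy [dyd dyC]]]; rewrite addSn ltnS => jrk.
have [Y [Ych Yc Yd _]] := IH _ (O `*` setT) k r dy (open_setXT oO) dyC jrk.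
pose split_dirs (v : {ptws 'I_j.+1 -> X}) : {ptws 'I_j -> (X * X)%type} :=
  fun c => (v (lift ord0 c), 0).
exists (fun i t q => Y i t ((q.1, q.2 ord0), split_dirs q.2)); split.
- move=> v; rewrite enum_ordSl /=; exists (fun z => dy z.1 (z.2, v ord0)); split.
    move=> [t x] [/= Jt Ox]; have /is_ddirP H := dyd t x (v ord0) (interior_subset Jt) Ox.
    apply/is_ddirP => e e0; apply: filterS (H e e0) => h.
    congr (`|y _ _ - _ - _| <= _); by rewrite /= scaler0 addr0.
  pose us := [seq v (lift ord0 c) | c <- enum 'I_j].
  have e1 : [seq (0, v c) | c <- [seq lift ord0 c | c <- enum 'I_j]] =
      [seq (0, u) | u <- us] :> seq (R * X) by rewrite /us -!map_comp.
  have e2 : [seq (0, split_dirs v c) | c <- enum 'I_j] =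
      [seq (0, (u, 0)) | u <- us] :> seq (R * (X * X)) by rewrite /us -map_comp.
  have := Ych (split_dirs v); rewrite e1 e2.
  have WW z : (J° `*` O) z -> (J° `*` (O `*` setT)) (z.1, (z.2, v ord0)) by case: z => ? ? [].
  exact: (chain_slice WW).
- move=> i ir; apply: (jcont_inner (l := fun q : X * {ptws 'I_j.+1 -> X} =>
    ((q.1, q.2 ord0), split_dirs q.2))) (Yc i ir); last by move=> q [].
  move=> q.
  have f1 : p.1 @[p --> q] --> q.1 by exact: cvg_fst.
  have f2 : p.2 @[p --> q] --> q.2 by exact: cvg_snd.
  have f3 : p.2 ord0 @[p --> q] --> q.2 ord0.
    exact: (cvg_comp _ _ f2 (@ptws_eval _ X ord0 q.2)).
  have f4 : split_dirs p.2 @[p --> q] --> split_dirs q.2.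
    apply: ptws_cvg => c.
    have g1 : p.2 (lift ord0 c) @[p --> q] --> q.2 (lift ord0 c).
      exact: (cvg_comp _ _ f2 (@ptws_eval _ X (lift ord0 c) q.2)).
    have g2 : (0 : X) @[p --> q] --> (0 : X) by exact: cvg_cst.
    exact: (cvg_pair g1 g2).
  have f5 : (p.1, p.2 ord0) @[p --> q] --> (q.1, q.2 ord0) by exact: (cvg_pair f1 f3).
  exact: (cvg_pair f5 f4).
- by move=> i t x v ir Jt Ox; apply: Yd.
- by [].
Qed.

Lemma tder_is_ddir (X : tvsType R) (g : R -> X -> E) (w : R) t x l : J° t ->
  tder J (g ^~ x) t l ->
  is_ddir (fun z : (R * X)%type => g z.1 z.2) (w, 0) (t, x) (w *: l).
Proof.
move=> Jt /tderP H.
have H1 : is_ddir (g ^~ x) (1 : R^o) t l.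
  apply/is_ddirP => e e0; have := H e e0; rewrite near_withinE => He.
  have c : t + h @[h --> (0 : R)] --> t.
    have c1 : t @[h --> (0 : R)] --> t by exact: cvg_cst.
    have c2 : h @[h --> (0 : R)] --> (0 : R) by exact: cvg_id.
    by have := cvgD c1 c2; rewrite addr0 => c3; apply: c3.
  apply: (@filterS _ (nbhs (0 : R)) _ _ _ _ (c _ (filterI He Jt))) => h [/= He' Jh].
  have -> : h *: (1 : R^o) = h by exact: mulr1.
  by have := He' Jh; rewrite [t + h - t]addrAC subrr add0r.
have /is_ddirP H2 : is_ddir (g ^~ x) (w *: (1 : R^o)) t (w *: l) by exact: is_ddirZ.
apply/is_ddirP => e e0; apply: filterS (H2 e e0) => h.
have -> : w *: (1 : R^o) = w by exact: mulr1.
by rewrite /= scaler0 addr0.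
Qed.

(** Time is one-dimensional: a derivative along w is w times the time
    derivative, so the directions contribute their product. *)
Lemma time_chain (X : tvsType R) (O : set X) N (G : nat -> R -> X -> E) :
  (forall i t x, (i < N)%N -> J t -> O x -> tder J (G i ^~ x) t (G i.+1 t x)) ->
  forall ws m c, (m + size ws <= N)%N ->
  chain (J° `*` O) (fun z => c *: G m z.1 z.2) [seq (w, 0) | w <- ws]
    (fun z => (c * \prod_(w <- ws) w) *: G (m + size ws)%N z.1 z.2).
Proof.
move=> Gd; elim=> [|w ws IH] m c /=.
  by move=> _ z _; rewrite big_nil mulr1 addn0.
rewrite addnS => mN.
exists (fun z => (c * w) *: G m.+1 z.1 z.2); split; last first.
  by rewrite big_cons mulrA -addSn; apply: IH; rewrite addSn.
move=> [t x] [/= Jt Ox]; rewrite [c * w]mulrC -scalerA.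
apply: (@tder_is_ddir X (fun t x => c *: G m t x) w) => //.
apply: tderZ; apply: Gd => //; last exact: interior_subset.
by apply: leq_trans mN; rewrite ltnS leq_addr.
Qed.

Lemma cvg_prod_seq {T I : Type} (F : set_system T) {FF : Filter F} (l : seq I)
    (g : T -> I -> R) (w : I -> R) :
  (forall c, g x c @[x --> F] --> w c) ->
  \prod_(c <- l) g x c @[x --> F] --> \prod_(c <- l) w c.
Proof.
move=> gw; elim: l => [|c l IHl].
  have -> : (fun x => \prod_(c <- [::]) g x c) = (fun=> 1).
    by apply: funext => p; rewrite big_nil.
  by rewrite big_nil; exact: cvg_cst.
have -> : (fun x => \prod_(d <- c :: l) g x d) = (fun x => g x c * \prod_(d <- l) g x d).
  by apply: funext => p; rewrite big_cons.
by rewrite big_cons; apply: cvgM => //; exact: gw.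
Qed.

(** i time derivatives of y are i - 1 time derivatives of the right-hand side,
    whence the range of m. *)
Lemma solutionC_CRS (r s : enat) (X : tvsType R) (O : set X) (y : R -> X -> E) :
  open O ->
  (forall m j : nat, le_enat m r -> le_enat j s -> solutionC (m + j) m O y) ->
  CRS (add_enat r (Some 1%N)) s J O (fun z : (R * X)%type => y z.1 z.2).
Proof.
move=> oO yC; have oW := open_JO oO.
have main (i j : nat) : le_enat i (add_enat r (Some 1%N)) -> le_enat j s ->
  exists g : ((R * X) * ({ptws 'I_i -> R} * {ptws 'I_j -> X}))%type -> E,
  [/\ {within (J `*` O) `*` setT, continuous g},
    forall w v, chain (J° `*` O) (fun z : (R * X)%type => y z.1 z.2) (dirs w v)
      (fun z => g (z, (w, v))) &
    (i = 0 -> j = 0 -> forall q, g q = y q.1.1 q.1.2)%N].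
  move=> ir js.
  have ir' : le_enat i.-1 r.
    by case: r ir {yC} => //= n; rewrite addn1; case: (i).
  have [Y [Ych Yc Yd Y0]] := solution_derivatives oO (yC i.-1 j ir' js) (eq_leq (addnC _ _)).
  have ii : (i <= i.-1.+1)%N by case: (i).
  exists (fun q => (\prod_(c < i) q.2.1 c) *: Y i q.1.1 (q.1.2, q.2.2)); split.
  - apply/subspace_continuousP => -[[t x] [w v]] [[/= Jt Ox] _].
    set p := ((t, x), (w, v)).
    set FF := within _ _.
    have i0 : q @[q --> FF] --> p by exact: cvg_within.
    have i1 : q.1 @[q --> FF] --> p.1 by exact: (cvg_comp _ _ i0 (@cvg_fst _ _ _ _ _)).
    have i2 : q.2 @[q --> FF] --> p.2 by exact: (cvg_comp _ _ i0 (@cvg_snd _ _ _ _ _)).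
    have i3 : q.1.1 @[q --> FF] --> t by exact: (cvg_comp _ _ i1 (@cvg_fst _ _ _ _ _)).
    have i4 : q.1.2 @[q --> FF] --> x by exact: (cvg_comp _ _ i1 (@cvg_snd _ _ _ _ _)).
    have i5 : q.2.1 @[q --> FF] --> w by exact: (cvg_comp _ _ i2 (@cvg_fst _ _ _ _ _)).
    have i6 : q.2.2 @[q --> FF] --> v by exact: (cvg_comp _ _ i2 (@cvg_snd _ _ _ _ _)).
    have i7 : q.1.1 @[q --> FF] --> within J (nbhs t).
      apply: cvg_within_app => //; rewrite /FF near_withinE; apply: nearW.
      by move=> q [[]].
    have i8 : (q.1.2, q.2.2) @[q --> FF] --> (x, v) by exact: (cvg_pair i4 i6).
    have i9 : (q.1.1, (q.1.2, q.2.2)) @[q --> FF] -->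
        filter_prod (within J (nbhs t)) (nbhs (x, v)) by exact: (cvg_pair i7 i8).
    have i10 : Y i q.1.1 (q.1.2, q.2.2) @[q --> FF] --> Y i t (x, v).
      apply: (cvg_comp _ _ i9 (Yc i ii t (x, v) Jt _)); by split.
    have i11 : \prod_(c < i) q.2.1 c @[q --> FF] --> \prod_(c < i) w c.
      apply: cvg_prod_seq => c; exact: (cvg_comp _ _ i5 (@ptws_eval _ R c w)).
    exact: cvgZ.
  - move=> w v; rewrite /dirs; apply: (chain_cat oW (Ych v)).
    have := @time_chain X O i.-1.+1 (fun i t x => Y i t (x, v)) _
      [seq w c | c <- enum 'I_i] 0%N 1.
    rewrite add0n size_map size_enum_ord -map_comp mul1r big_map big_enum /=.
    move=> H; apply: (chain_eq oW _ (H _ ii)); first by move=> z _; rewrite scale1r.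
    by move=> i' t x ii' Jt Ox; apply: Yd.
  - move=> i0 j0 [[t x] [w v]]; have Y00 := Y0 j0.
    by subst i; rewrite big_ord0 scale1r Y00.
have oO' : O° = O by exact/interior_id.
split.
  move=> i j ir js; have [g [gc gch _]] := main i j ir js; rewrite oO'; split.
    by move=> w v; have [] := chain_iter_ddir oW (gch w v).
  have gd q : ((J° `*` O) `*` setT) q -> @dij _ _ _ _ i j (fun z => y z.1 z.2) q = g q.
    by case: q => [z [w v]] [Wz _]; have [_ H] := chain_iter_ddir oW (gch w v); exact: H.
  move/subspace_continuousP: gc => gc; apply/subspace_continuousP => q Wq.
  rewrite /from_subspace gd//.
  have WW : (J° `*` O) `*` setT `<=` (J `*` O) `*`
      [set: {ptws 'I_i -> R} * {ptws 'I_j -> X}].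
    by move=> [z p] [[/= Jz Oz] _]; split=> //; split=> //=; exact: (interior_subset Jz).
  apply: cvg_trans (cvg_withinS WW (gc q (WW q Wq))).
  by apply: near_eq_cvg; rewrite near_withinE; apply: nearW => p Wp; rewrite gd.
move=> i j ir js; have [g [gc gch g0]] := main i j ir js; exists g; split=> //.
  move=> [z [w v]]; rewrite inE oO' => -[Wz _].
  by have [_ H] := chain_iter_ddir oW (gch w v); rewrite /dij /= H.
by move=> i0 j0 q _; exact: g0.
Qed.

End solutions_are_CRS.

(** * The local flow *)

Section local_flow.
Context {R : realType}.

Lemma convex_itv (a b : R) : convex_set (`[a, b]%classic : set (convex_lmodType R^o)).
Proof.
move=> x y l; rewrite !inE /= /conv /= !in_itv/= => /andP[ax xb] /andP[ay yb].
have l0 : 0 <= l%:num :> R by [].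
have l1 : l%:num <= 1 :> R by [].
change ((a <= l%:num * (x : R) + (1 - l%:num) * (y : R)) &&
  (l%:num * (x : R) + (1 - l%:num) * (y : R) <= b)).
move: (l%:num) l0 l1 => c c0 c1; apply/andP; split; nra.
Qed.

(** If t0 is an endpoint of J, it is an endpoint of the chosen interval as well,
    which is a neighbourhood of t0 only relative to J. *)
Lemma shrink_interval (J : set R) t0 e : is_interval J ->
  (exists x y, [/\ J x, J y & x < y]) -> J t0 -> 0 < e ->
  exists a b, [/\ a < b, a <= t0 <= b, `[a, b]%classic `<=` J, b - a <= e &
    \forall u \near nbhs t0, J u -> u \in `[a, b]].
Proof.
move=> itvJ [x [y [Jx Jy xy]]] Jt e0; have e20 : 0 < e / 2 by rewrite divr_gt0.
have [b [tb bJ be nb sb]] : exists b, [/\ t0 <= b, J b, b <= t0 + e / 2,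
    (exists2 d, 0 < d & forall u, J u -> u < t0 + d -> u <= b) &
    (exists2 z, J z & t0 < z) -> t0 < b].
  have [[z Jz tz]|nz] := pselect (exists2 z, J z & t0 < z).
    exists (Num.min z (t0 + e / 2)); split=> //.
    - by rewrite le_min (ltW tz)/= lerDl ltW.
    - apply: (itvJ t0 z) => //; apply/andP; split; last by rewrite ge_min lexx.
      by rewrite le_min (ltW tz)/= lerDl ltW.
    - by rewrite ge_min lexx orbT.
    - exists (Num.min (z - t0) (e / 2)); first by rewrite lt_min subr_gt0 tz.
      move=> u _; rewrite -ltrBlDl lt_min => /andP[u1 u2].
      by rewrite le_min; apply/andP; split; lra.
    - by rewrite lt_min tz ltrDl.
  exists t0; split=> //; first by rewrite lerDl ltW.
  exists 1 => // u Ju _; have [//|tu] := leP u t0.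
  by exfalso; apply: nz; exists u.
have [a [at_ aJ ae na sa]] : exists a, [/\ a <= t0, J a, t0 - e / 2 <= a,
    (exists2 d, 0 < d & forall u, J u -> t0 - d < u -> a <= u) &
    (exists2 z, J z & z < t0) -> a < t0].
  have [[z Jz tz]|nz] := pselect (exists2 z, J z & z < t0).
    exists (Num.max z (t0 - e / 2)); split=> //.
    - by rewrite ge_max (ltW tz)/= gerBl ltW.
    - apply: (itvJ z t0) => //; apply/andP; split; first by rewrite le_max lexx.
      by rewrite ge_max (ltW tz)/= gerBl ltW.
    - by rewrite le_max lexx orbT.
    - exists (Num.min (t0 - z) (e / 2)); first by rewrite lt_min subr_gt0 tz.
      move=> u _; rewrite ltrBlDr -ltrBlDl lt_min => /andP[u1 u2].
      by rewrite ge_max; apply/andP; split; lra.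
    - by rewrite gt_max tz gtrBl.
  exists t0; split=> //; first by rewrite gerBl ltW.
  exists 1 => // u Ju _; have [//|tu] := leP t0 u.
  by exfalso; apply: nz; exists u.
exists a, b; split.
- have [yt|ty] := leP y t0.
    by apply: lt_le_trans tb; apply: sa; exists x => //; exact: lt_le_trans xy yt.
  by apply: le_lt_trans at_ _; apply: sb; exists y.
- by rewrite at_.
- by move=> u; rewrite /= in_itv/= => /andP[au ub]; apply: (itvJ a b) => //; apply/andP.
- by lra.
have [d d0 Hd] := nb; have [c c0 Hc] := na.
have H1 : \forall u \near nbhs t0, u < t0 + d by apply: lt_nbhsl; rewrite ltrDl.
have H2 : \forall u \near nbhs t0, t0 - c < u by apply: lt_nbhsr; rewrite gtrBl.
by apply: filterS2 H1 H2 => u u1 u2 Ju; rewrite in_itv/= Hc//= Hd.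
Qed.

Context {E : completeNormedModType R} {F : tvsType R}.

(** Lipschitz continuity follows from [diff_quotient] at the zero direction, where
    the differential vanishes: z - z' is h v with |v| < d and |h| < d', and the
    increment is at most |h|, a multiple of |z - z'|. *)
Lemma local_bounds (J : set R) (U : set E) (P : set F) (r s : enat)
    (f : (R * (E * F))%type -> E) t0 z0 q0 :
  is_interval J -> (exists x y, [/\ J x, J y & x < y]) -> open U -> open P ->
  le_enat 1%N s -> CRS r s J (U `*` P) f -> J t0 -> U z0 -> P q0 ->
  exists (rho e L M : R) (P0 : set F),
  [/\ [/\ 0 < rho, 0 < e, 0 <= L & 0 <= M],
      [/\ open P0, P0 q0, P0 `<=` P & ball z0 rho `<=` U],
      (forall t z p, J t -> `|t - t0| < e -> ball z0 rho z -> P0 p -> `|f (t, (z, p))| <= M) &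
      (forall t z z' p, J t -> `|t - t0| < e -> ball z0 rho z -> ball z0 rho z' -> P0 p ->
        `|f (t, (z, p)) - f (t, (z', p))| <= L * `|z - z'|)].
Proof.
move=> itvJ ndJ oU oP s1 fC Jt0 Uz Pq.
have [a [b [ab at0b abJ _ nab]]] := shrink_interval itvJ ndJ Jt0 ltr01.
have oO : open (U `*` P) by exact: open_setX.
have := @CRS_mixedC R _ E _ oO a b ab J abJ f r s fC 0%N 1%N.
have -> : le_enat 0 r by case: (r).
move=> /(_ isT s1) [fc [[df [fd [dfc _]]] _]].
have Jab : (`[a, b]%classic : set R) t0 by rewrite /= in_itv.
have Oz : (U `*` P) (z0, q0) by [].
have df0 : df t0 ((z0, q0), (0, 0)) = 0.
  apply: (is_ddir_unique (fd t0 (z0, q0) (0, 0) Jab Oz)).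
  apply/is_ddirP => e e0; apply: (@filterE _ (nbhs (0 : R))) => h.
  have -> : ((0, 0) : (E * F)%type) = 0 by [].
  by rewrite !(scaler0, addr0, subrr, normr0) mulr_ge0// ltW.
have D := diff_quotient (0, 0) oO continuous_idfun fd dfc Jab Oz ltr01.
move: D => [[A B] /= [HA [[B1 B2] /= [[[C1 C2] /= [HC1 HC2] HC] HB2] HB]] HAB].
have /cvgrPdist_le/(_ _ ltr01)[[A' B'] /= [HA' HB'] HAB'] := fc t0 _ Jab Oz.
move: HC1 => [[Cz Cp] /= [HCz HCp] HC1].
move: HC2 => [[Vz Vp] /= [HVz HVp] HC2].
move: HB' => [[Bz Bp] /= [HBz HBp] HB'].
have [d d0 Hd] : exists2 d : R, 0 < d & forall v, `|v| < d -> Vz v.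
  move: HVz => /nbhs_ballP[d /= d0 Hd]; exists d => // v vd.
  by apply: Hd; rewrite -ball_normE /= sub0r normrN.
have [d' d'0 Hd'] : exists2 d : R, 0 < d & forall h, `|h| < d -> B2 h.
  move: HB2 => /nbhs_ballP[d1 /= d10 Hd1]; exists d1 => // v vd.
  by apply: Hd1; rewrite -ball_normE /= sub0r normrN.
have nUz : nbhs z0 (Cz `&` Bz `&` U).
  by apply: filterI; [exact: filterI|exact: open_nbhs_nbhs].
have [rho1 rho10 Hrho] : exists2 d : R, 0 < d & ball z0 d `<=` Cz `&` Bz `&` U.
  by move: nUz => /nbhs_ballP[d1 /= d10 Hd1]; exists d1.
have [e e0 He] : exists2 d : R, 0 < d & forall t, J t -> `|t - t0| < d ->
    t \in `[a, b] /\ A t /\ A' t.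
  have HA1 : nbhs t0 (fun t => t \in `[a, b] -> A t) := HA.
  have HA2 : nbhs t0 (fun t => t \in `[a, b] -> A' t) := HA'.
  have HA3 : nbhs t0 (fun t => (J t -> t \in `[a, b]) /\
      ((t \in `[a, b] -> A t) /\ (t \in `[a, b] -> A' t))).
    exact: (filterI nab (filterI HA1 HA2)).
  have /nbhs_ballP[d1 /= d10 Hd1] := HA3.
  exists d1 => // t Jt td; have : ball t0 d1 t by rewrite -ball_normE /= distrC.
  by move=> /Hd1 [/(_ Jt) tab [At A't]]; split=> //; split; [exact: At|exact: A't].
have nP : nbhs q0 (Cp `&` Bp `&` P).
  by apply: filterI; [exact: filterI|exact: open_nbhs_nbhs].
(* With h = 2 |z - z'| / d the vector (z - z') / h has norm d / 2; the bound on rho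
   ensures |h| < d'. *)
pose rho := Num.min rho1 (d * d' / 8).
have rho0 : 0 < rho by rewrite lt_min rho10/= !(divr_gt0, mulr_gt0).
have rhor z : ball z0 rho z -> ball z0 rho1 z.
  by rewrite -ball_normE /= => /lt_le_trans; apply; rewrite ge_min lexx.
exists rho, e, (2 / d), (`|f (t0, (z0, q0))| + 1), (Cp `&` Bp `&` P)°.
split.
- by split=> //; rewrite divr_ge0 ?ltW.
- split=> //; [exact: open_interior|by move=> p /interior_subset []|].
  by move=> z /rhor /Hrho [].
- move=> t z p Jt te /rhor/Hrho [[_ Bzz] _] /interior_subset [[_ Bpp] _].
  have [_ [_ A't]] := He t Jt te.
  have := HAB' (t, (z, p)) (conj A't (HB' (z, p) (conj Bzz Bpp))) => /= H.
  rewrite -lerBlDl; apply: le_trans H; rewrite distrC; exact: lerB_dist.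
move=> t z z' p Jt te bz bz' /interior_subset [[Cpp _] _].
have [_ [At _]] := He t Jt te.
have [->|zz'] := eqVneq z z'; first by rewrite !subrr !normr0 mulr0.
have [[Cz' _] _] := Hrho _ (rhor _ bz').
have n0 : 0 < `|z - z'| by rewrite normr_gt0 subr_eq0.
pose h := 2 / d * `|z - z'|.
have h0 : 0 < h by rewrite mulr_gt0 ?divr_gt0.
have hd' : h < d'.
  have dist : `|z - z'| < rho + rho.
    rewrite -(subrKA z0); apply: (le_lt_trans (ler_normD _ _)).
    by move: bz bz'; rewrite -!ball_normE /= [`|z - z0|]distrC => ? ?; rewrite ltrD.
  have rd : rho <= d * d' / 8 by rewrite ge_min lexx orbT.
  rewrite /h mulrAC ltr_pdivrMr//; lra.
have vd : `|h^-1 *: (z - z')| < d.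
  rewrite normrZ gtr0_norm ?invr_gt0// mulrC ltr_pdivrMr// /h mulrA.
  by rewrite [d * _]mulrC divfK ?gt_eqF//; lra.
have := HAB (t, (((z', p), (h^-1 *: (z - z'), 0)), h)).
have Bq : B (((z', p), (h^-1 *: (z - z'), 0)), h).
  apply: HB; split=> /=; last by apply: Hd'; rewrite gtr0_norm.
  apply: HC; split=> /=; first exact: HC1.
  by apply: HC2; split=> /=; [exact: Hd|exact: nbhs_singleton HVp].
move=> /(_ (conj At Bq)) /=; rewrite df0 scaler0 subr0 mul1r gtr0_norm//.
congr (`|f (_, _) - _| <= _).
by congr (_, _); rewrite /= ?scaler0 ?addr0// scalerA mulfV ?gt_eqF// scale1r subrKC.
Qed.

End local_flow.

Theorem theoremC (R : realType) (E : completeNormedModType R) (F : tvsType R)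
    (hausF : hausdorff_space F)
    (J : set R) (intJ : is_interval J)
    (ndJ : exists a b : R, [/\ J a, J b & a < b])
    (U : set E) (oU : open U) (P : set F) (oP : open P)
    (r s : enat) (s1 : le_enat 1%N s)
    (f : (R * (E * F))%type -> E)
    (fC : CRS r (add_enat r s) J (U `*` P) f)
    (t0 : R) (z0 : E) (q0 : F) (Jt0 : J t0) (Uz0 : U z0) (Pq0 : P q0) :
  exists (J0 : set R) (U0 : set E) (P0 : set F),
    [/\ [/\ J0 `<=` J, within J (nbhs t0) J0 &
            convex_set (J0 : set (convex_lmodType R^o))],
        [/\ open U0, U0 z0 & U0 `<=` U],
        [/\ open P0, P0 q0 & P0 `<=` P] &
        exists phi : R -> E -> F -> R -> E,
          (forall tau x0 p0, J0 tau -> U0 x0 -> P0 p0 ->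
             is_solution f J0 U tau x0 p0 (phi tau x0 p0) /\
             (forall x : R -> E, is_solution f J0 U tau x0 p0 x ->
                forall t, J0 t -> x t = phi tau x0 p0 t)) /\
          (forall tau, J0 tau ->
             CRS (add_enat r (Some 1%N)) s J0 (U0 `*` P0)
               (fun z : (R * (E * F))%type => phi tau z.2.1 z.2.2 z.1))].
Proof.
have s1' : le_enat 1%N (add_enat r s).
  case: r s s1 {fC} => [r|] [s|] //=; first by move=> /leq_trans; apply; rewrite leq_addl.
have [rho [e [L [M [P0 [[rho0 e0 L0 M0] [oP0 P0q P0P BU] fM fL]]]]]] :=
  local_bounds intJ ndJ oU oP s1' fC Jt0 Uz0 Pq0.
(* Short enough for the bounds near t0 to hold, for the contraction estimate, and
   for a solution that starts within rho / 2 of z0 to move by at most rho / 4. *)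
pose len := Num.min (e / 2) (Num.min (2^-1 / (L + 1)) (rho / 4 / (M + 1))).
have L1 : 0 < L + 1 by rewrite ltr_wpDl.
have M1 : 0 < M + 1 by rewrite ltr_wpDl.
have len0 : 0 < len by rewrite !lt_min !divr_gt0.
have [a [b [ab /andP[at0 t0b] abJ len_ab nab]]] := shrink_interval intJ ndJ Jt0 len0.
have len1 : b - a <= e / 2 by apply: (le_trans len_ab); rewrite ge_min lexx.
have len2 : (L + 1) * (b - a) <= 2^-1.
  rewrite mulrC -ler_pdivlMr//; apply: (le_trans len_ab).
  by rewrite !ge_min lexx orbT.
have len3 : (M + 1) * (b - a) <= rho / 4.
  rewrite mulrC -ler_pdivlMr//; apply: (le_trans len_ab).
  by rewrite !ge_min lexx !orbT.
have ba0 : 0 <= b - a by rewrite subr_ge0 ltW.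
have Lab : L * (b - a) <= 2^-1.
  by apply: le_trans len2; rewrite ler_wpM2r// lerDl.
have Mab : M * (b - a) <= rho / 4.
  by apply: le_trans len3; rewrite ler_wpM2r// lerDl.
pose J0 : set R := `[a, b]%classic.
have J0e t : J0 t -> J t /\ `|t - t0| < e.
  move=> J0t; split; first exact: abJ.
  have J00 : J0 t0 by rewrite /J0 /= in_itv/= at0.
  by apply: (le_lt_trans (itv_dist J00 J0t)); lra.
pose B := ball z0 rho; pose U0 := ball z0 (rho / 2).
have oB : open B by exact: ball_open.
have oU0 : open U0 by apply: ball_open; rewrite divr_gt0.
have gL t p z z' : J0 t -> P0 p -> B z -> B z' ->
    `|f (t, (z, p)) - f (t, (z', p))| <= L * `|z - z'|.
  by move=> /J0e[Jt te] Pp Bz Bz'; exact: fL.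
have oUP : open (U `*` P) by exact: open_setX.
have fcls (m k : nat) : le_enat m r -> le_enat k (add_enat r s) ->
    mixedC a b k m (U `*` P) (fun t x => f (t, x)).
  by move=> mr ks; exact: (CRS_mixedC oUP ab abJ fC).
have fc : jcont a b (U `*` P) (fun t x => f (t, x)).
  by have [] := fcls 0%N 1%N (ltac:(by case: (r))) s1'.
have sol (q : R * (E * F)) : exists x : R -> E, J0 q.1 -> U0 q.2.1 -> P0 q.2.2 ->
    [/\ x q.1 = q.2.1, forall t, J0 t -> B (x t) &
      forall t, J0 t -> tder J0 x t (f (t, (x t, q.2.2)))].
  case: q => tau [x0 p] /=.
  have [[J0tau [U0x P0p]]|nq] := pselect (J0 tau /\ (U0 x0 /\ P0 p)); last first.
    by exists (fun=> 0) => *; exfalso; apply: nq.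
  pose W := closed_ball x0 (rho / 4).
  have rho40 : 0 < rho / 4 by rewrite divr_gt0.
  have WE z : W z <-> `|x0 - z| <= rho / 4 by rewrite /W closed_ballE.
  have WB z : W z -> B z.
    move=> /WE Wz; rewrite /B -ball_normE /= -(subrKA x0).
    apply: (le_lt_trans (ler_normD _ _)).
    by move: U0x; rewrite /U0 -ball_normE /= => U0x; lra.
  case: (@ode_exists R E a b ab (fun t z => f (t, (z, p))) W L tau x0 L0 Lab J0tau).
  - by apply/WE; rewrite subrr normr0 ltW.
  - exact: closed_ball_closed.
  - by move=> t z z' J0t /WB Bz /WB Bz'; exact: gL.
  - move=> t z J0t /WB Bz.
    apply: (jcont_slice (f := fun t x => f (t, x)) fc J0t).
    by split; [exact: BU|exact: P0P].
  - move=> y Y yW Yd Ytau t J0t; apply/WE; rewrite -Ytau distrC.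
    apply: le_trans Mab; apply: (@le_trans _ _ (M * `|t - tau|)).
      have := @mean_value_itv R E a b Y (fun t => f (t, (y t, p))) 0 M tau t M0 J0tau J0t Yd.
      rewrite scaler0 subr0; apply=> u J0u _; rewrite subr0.
      have [Ju ue] := J0e u J0u; apply: fM => //; exact/WB/yW.
    by rewrite ler_wpM2l// itv_dist.
  move=> x [xtau xW xd]; exists x => _ _ _; split=> // t J0t.
  exact/WB/xW.
have {sol}[psi Hpsi] := choice sol.
exists J0, U0, P0; split.
- split=> //; exact: convex_itv.
- split=> //; first by apply: ballxx; rewrite divr_gt0.
  move=> z U0z; apply: BU; apply: le_ball U0z; lra.
- by [].
exists (fun tau x0 p0 => psi (tau, (x0, p0))); split.
  move=> tau x0 p0 J0tau U0x P0p.
  have [ptau pB pd] := Hpsi (tau, (x0, p0)) J0tau U0x P0p.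
  split; first by split=> // t J0t; apply: BU; exact: pB.
  move=> x [xU xd xtau].
  apply: (@ode_unique R E a b (fun t z => f (t, (z, p0))) B L tau) => //.
  - by move=> t z z' J0t Bz Bz'; exact: gL.
  - by rewrite xtau ptau.
move=> tau J0tau.
have oO : open (U0 `*` P0) by exact: open_setX.
apply: (@solutionC_CRS R E a b r s _ (U0 `*` P0) (fun t q => psi (tau, (q.1, q.2)) t) oO).
move=> m j mr js.
have l1 : linc (fun q : E * (E * F) => (q.1, q.2.2)).
  apply: linc_pair; first exact: linc_fst.
  exact: (linc_comp (linc_snd _ _) (linc_snd _ _)).
apply: (@ode_regularity R E a b ab L L0 Lab tau J0tau (m + j) m _ (U0 `*` P0) B
  (fun t q => f (t, (q.1, q.2.2))) _ fst) => //.
- apply: (mixedC_inner (l := fun q : E * (E * F) => (q.1, q.2.2))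
      (f := fun t x => f (t, x)) l1 _ (fcls m (m + j)%N mr _)).
    by move=> [z [x p]] [/= Bz [_ Pp]]; split; [exact: BU|exact: P0P].
  by case: r mr {fC s1' fcls} => [r|] mr; case: s js {s1} => [s|] js //=; exact: leq_add.
- by move=> t [x p] z z' J0t [/= _ P0p] Bz Bz'; exact: gL.
- by move=> t [x p] J0t [/= U0x P0p]; have [_ pB _] := Hpsi (tau, (x, p)) J0tau U0x P0p; exact: pB.
- by move=> t [x p] J0t [/= U0x P0p]; have [_ _ pd] := Hpsi (tau, (x, p)) J0tau U0x P0p; exact: pd.
- by move=> [x p] [/= U0x P0p]; have [] := Hpsi (tau, (x, p)) J0tau U0x P0p.
- exact: linc_fst.
Qed.
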